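(* Every determined compact group is metrizable.
   Context: All groups are Hausdorff. $\mathbb U(n)$ is the unitary group with the operator-norm metric. For a topological group $G$, $\mathrm{irrep}_n(G)$ is the set of irreducible continuous homomorphisms $G\to\mathbb U(n)$, $\widehat G_n$ is its set of unitary equivalence classes, and $\widehat G=\bigcup_{n<\omega}\widehat G_n$. $\mu_{\mathcal K}$ on $\mathrm{irrep}_n(G)$ is the uniformity of uniform convergence on compact subsets of $G$, with basic bands $\{(\varphi,\psi):\|\varphi(x)-\psi(x)\|<\epsilon\ \forall x\in K\}$, $K\subseteq G$ compact, $\epsilon>0$; $\mu_{\mathcal K}\widehat G_n$ is $\widehat G_n$ with the final uniformity (the finest making the canonical quotient map $\mathrm{irrep}_n(G)\to\widehat G_n$ uniformly continuous); $\mu_{\mathcal K}\widehat G$ is the free uniform sum of the $\mu_{\mathcal K}\widehat G_n$, $n<\omega$. A dense subgroup $H$ of $G$ determines $G$ if the restriction mapping $\mu_{\mathcal K}\widehat G\to\mu_{\mathcal K}\widehat H$, $[\varphi]\mapsto[\varphi|_H]$, is an isomorphism of uniform spaces. $G$ is determined if every dense subgroup of $G$ determines $G$. *)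

(* Defs.v *)
From HB Require Import structures.
From mathcomp Require Import all_boot all_order all_algebra.
From mathcomp Require Import ring lra.
From mathcomp Require Import complex.
From mathcomp Require Import all_classical reals topology.

Set Implicit Arguments.
Unset Strict Implicit.
Unset Printing Implicit Defensive.

Import Order.TTheory GRing.Theory Num.Theory.

Local Open Scope classical_set_scope.
Local Open Scope ring_scope.

HB.mixin Record isTopologicalGroup G & Topological G & Group G := {
  mulg_continuous : continuous (fun xy : G * G => (xy.1 * xy.2)%g) ;
  invg_continuous : continuous (fun x : G => (x^-1)%g)
}.

#[short(type="topologicalGroupType")]
HB.structure Definition TopologicalGroup :=
  {G of Topological G & Group G & isTopologicalGroup G}.

Record subgroup (G : groupType) := Subgroup {
  subgroup_set :> set G ;
  subgroup_closed : group_closed (fun x => x \in subgroup_set)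
}.

Definition subgroup_type (G : topologicalGroupType) (H : subgroup G) : Type :=
  set_type H.

Section SubgroupType.
Variables (G : topologicalGroupType) (H : subgroup G).

HB.instance Definition _ := SubChoice.on (subgroup_type H).
HB.instance Definition _ :=
  SubChoice_isSubGroup.Build G (fun x => x \in subgroup_set H)
    (subgroup_type H) (subgroup_closed H).
HB.instance Definition _ := Topological.copy (subgroup_type H) (set_type H).

Definition subgroup_incl (x : subgroup_type H) : G := \val x.

Lemma subgroup_incl_continuous : continuous subgroup_incl.
Proof. exact: (@initial_continuous (set_type H) G set_val). Qed.

Lemma subgroup_inclM x y :
  subgroup_incl (x * y)%g = (subgroup_incl x * subgroup_incl y)%g.
Proof. exact: valM. Qed.


Lemma continuous_to_subgroup (T : topologicalType) (f : T -> subgroup_type H) :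
  continuous (subgroup_incl \o f) -> continuous f.
Proof. exact: (@continuous_comp_initial (set_type H) T G set_val f). Qed.

Let subgroup_mulg_continuous :
  continuous (fun xy : subgroup_type H * subgroup_type H => (xy.1 * xy.2)%g).
Proof.
apply: continuous_to_subgroup => -[x y].
pose h (xy : subgroup_type H * subgroup_type H) :=
  (subgroup_incl xy.1, subgroup_incl xy.2).
rewrite (_ : _ \o _ = (fun xy : G * G => xy.1 * xy.2)%g \o h); last first.
  by apply/funext => xy /=; rewrite subgroup_inclM.
apply: continuous_comp; last exact: mulg_continuous.
apply: cvg_pair; (apply: cvg_comp; last exact: subgroup_incl_continuous).
- exact: cvg_fst.
- exact: cvg_snd.
Qed.

Let subgroup_invg_continuous :
  continuous (fun x : subgroup_type H => (x^-1)%g).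
Proof.
apply: continuous_to_subgroup => x.
rewrite (_ : _ \o _ = (fun x : G => x^-1)%g \o subgroup_incl); last first.
  by apply/funext => y /=; exact: gmulfV.
apply: continuous_comp; first exact: subgroup_incl_continuous.
exact: invg_continuous.
Qed.

HB.instance Definition _ := isTopologicalGroup.Build (subgroup_type H)
  subgroup_mulg_continuous subgroup_invg_continuous.

End SubgroupType.

Section OperatorNorm.
Variable R : realType.
Local Notation C := R[i].
Local Notation normc := (@ComplexField.Normc.normc R).

Definition l2norm n (v : 'cV[C]_n) : R :=
  Num.sqrt (\sum_(i < n) normc (v i 0) ^+ 2).

Definition opnorm n (A : 'M[C]_n) : R :=
  sup [set l2norm (A *m v) | v in [set v : 'cV[C]_n | l2norm v <= 1]].

Let normc_ge0 z : 0 <= normc z.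
Proof. by case: z => a b; rewrite /normc sqrtr_ge0. Qed.

Lemma l2norm_ge0 n (v : 'cV[C]_n) : 0 <= l2norm v.
Proof. exact: sqrtr_ge0. Qed.

Lemma l2norm0 n : l2norm (0 : 'cV[C]_n) = 0.
Proof.
rewrite /l2norm big1 ?sqrtr0// => i _.
by rewrite mxE ComplexField.Normc.normc0 expr0n.
Qed.

Lemma l2norm_eq0 n (v : 'cV[C]_n) : l2norm v = 0 -> v = 0.
Proof.
move=> /eqP; rewrite sqrtr_eq0 => le0.
have /eqP : \sum_(i < n) normc (v i 0) ^+ 2 = 0.
  by apply/eqP; rewrite eq_le le0 sumr_ge0// => i _; exact: sqr_ge0.
rewrite psumr_eq0 => [/allP v0|i _]; last exact: sqr_ge0.
apply/colP => i; rewrite mxE; apply: ComplexField.Normc.eq0_normc.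
by apply/eqP; rewrite -sqrf_eq0; apply: v0; rewrite mem_index_enum.
Qed.


Lemma l2normZ n (a : C) (v : 'cV[C]_n) : l2norm (a *: v) = normc a * l2norm v.
Proof.
rewrite /l2norm -[in RHS](ger0_norm (normc_ge0 a)) -sqrtr_sqr -sqrtrM ?sqr_ge0//.
rewrite mulr_sumr; congr Num.sqrt; apply: eq_bigr => i _.
by rewrite mxE ComplexField.Normc.normcM exprMn.
Qed.

Let l2norm_sq n (v : 'cV[C]_n) :
  l2norm v ^+ 2 = \sum_(i < n) normc (v i 0) ^+ 2.
Proof. by rewrite sqr_sqrtr// sumr_ge0// => i _; exact: sqr_ge0. Qed.

Let cauchy_schwarz n (u v : 'cV[C]_n) :
  \sum_(i < n) normc (u i 0) * normc (v i 0) <= l2norm u * l2norm v.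
Proof.
set a := l2norm u; set b := l2norm v.
have [u0|u0] := eqVneq a 0.
  rewrite (l2norm_eq0 u0) big1 ?mulr_ge0 ?l2norm_ge0// => i _.
  by rewrite mxE ComplexField.Normc.normc0 mul0r.
have [v0|v0] := eqVneq b 0.
  rewrite (l2norm_eq0 v0) big1 ?mulr_ge0 ?l2norm_ge0// => i _.
  by rewrite mxE ComplexField.Normc.normc0 mulr0.
have ab0 : 0 < a * b by rewrite mulr_gt0// lt0r ?u0 ?v0 l2norm_ge0.
rewrite -(ler_pM2l ab0).
have : \sum_(i < n) (2 * (a * b)) * (normc (u i 0) * normc (v i 0)) <=
    \sum_(i < n) (b ^+ 2 * normc (u i 0) ^+ 2 + a ^+ 2 * normc (v i 0) ^+ 2).
  apply: ler_sum => i _.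
  have := sqr_ge0 (b * normc (u i 0) - a * normc (v i 0)).
  nra.
rewrite big_split/= -!mulr_sumr -!l2norm_sq -/a -/b; nra.
Qed.

Lemma l2normD n (u v : 'cV[C]_n) : l2norm (u + v) <= l2norm u + l2norm v.
Proof.
rewrite -(@ler_pXn2r _ 2)// ?nnegrE ?addr_ge0 ?l2norm_ge0//.
apply: (@le_trans _ _ (\sum_(i < n) (normc (u i 0) + normc (v i 0)) ^+ 2)).
  rewrite l2norm_sq; apply: ler_sum => i _; rewrite mxE.
  by rewrite ler_pXn2r ?nnegrE ?addr_ge0// le_normcD.
rewrite (eq_bigr (fun i => normc (u i 0) ^+ 2 +
  (2 * (normc (u i 0) * normc (v i 0)) + normc (v i 0) ^+ 2))); last first.
  by move=> i _; ring.
rewrite !big_split/= -mulr_sumr -!l2norm_sq.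
have := cauchy_schwarz u v; nra.
Qed.

Let ler_l2norm_sum n (I : finType) (F : I -> 'cV[C]_n) :
  l2norm (\sum_i F i) <= \sum_i l2norm (F i).
Proof.
elim/big_ind2 : _ => [|x1 x2 y1 y2 h1 h2|//]; first by rewrite l2norm0.
exact: le_trans (l2normD _ _) (lerD h1 h2).
Qed.

Let normc_le_l2norm n (v : 'cV[C]_n) i : normc (v i 0) <= l2norm v.
Proof.
rewrite -(@ler_pXn2r _ 2)// ?nnegrE ?l2norm_ge0// l2norm_sq (bigD1 i)//=.
by rewrite lerDl sumr_ge0// => j _; exact: sqr_ge0.
Qed.

Lemma linear_bounded n (f : {linear 'cV[C]_n -> 'cV[C]_n}) :
  exists2 c : R, 0 <= c & forall v, l2norm (f v) <= c * l2norm v.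
Proof.
exists (\sum_(i < n) l2norm (f (delta_mx i 0))).
  by apply: sumr_ge0 => i _; exact: l2norm_ge0.
move=> v; rewrite mulr_suml {1}(matrix_sum_delta v) linear_sum/=.
apply: le_trans (ler_l2norm_sum _) _; apply: ler_sum => i _.
rewrite big_ord1 linearZ/= l2normZ mulrC.
by apply: ler_wpM2l; [exact: l2norm_ge0|exact: normc_le_l2norm].
Qed.

Lemma opnorm_has_sup n (A : 'M[C]_n) :
  has_sup [set l2norm (A *m v) | v in [set v : 'cV[C]_n | l2norm v <= 1]].
Proof.
split; first by exists (l2norm (A *m 0)), 0; rewrite //= l2norm0.
have [c c0 Ac] := linear_bounded (mulmx A).
exists c => _ [v /= v1 <-]; apply: le_trans (Ac v) _.
by rewrite ler_piMr.
Qed.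

Lemma opnormP n (A : 'M[C]_n) (v : 'cV[C]_n) :
  l2norm (A *m v) <= opnorm A * l2norm v.
Proof.
have [v0|v0] := eqVneq (l2norm v) 0.
  by rewrite (l2norm_eq0 v0) mulmx0 l2norm0 mulr0.
have vgt0 : 0 < l2norm v by rewrite lt0r v0 l2norm_ge0.
pose a : C := (l2norm v)^-1%:C%C.
have na : normc a = (l2norm v)^-1.
  by rewrite /a /= expr0n addr0 sqrtr_sqr ger0_norm// invr_ge0 ltW.
rewrite -ler_pdivrMr// mulrC -na -l2normZ scalemxAr.
apply: ub_le_sup; first exact: (opnorm_has_sup A).2.
by exists (a *: v) => //=; rewrite l2normZ na mulVf.
Qed.

Lemma opnorm_le n (A : 'M[C]_n) (c : R) :
  (forall v, l2norm v <= 1 -> l2norm (A *m v) <= c) -> opnorm A <= c.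
Proof.
move=> Ac; apply: ge_sup; first exact: (opnorm_has_sup A).1.
by move=> _ [v /= v1 <-]; exact: Ac.
Qed.

Lemma opnorm_ge0 n (A : 'M[C]_n) : 0 <= opnorm A.
Proof.
rewrite -(l2norm0 n) -(mulmx0 _ A); apply: ub_le_sup.
  exact: (opnorm_has_sup A).2.
by exists 0; rewrite //= l2norm0.
Qed.

Lemma opnorm0 n : opnorm (0 : 'M[C]_n) = 0.
Proof.
apply/eqP; rewrite eq_le opnorm_ge0 andbT; apply: opnorm_le => v _.
by rewrite mul0mx l2norm0.
Qed.

Lemma opnormN n (A : 'M[C]_n) : opnorm (- A) = opnorm A.
Proof.
rewrite /opnorm; congr sup; apply/seteqP; split => _ [v /= v1 <-];
  exists (- v); rewrite /= ?mulNmx ?mulmxN ?opprK//;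
  by rewrite -scaleN1r l2normZ normcN ComplexField.Normc.normc1 mul1r.
Qed.

Lemma opnormD n (A B : 'M[C]_n) : opnorm (A + B) <= opnorm A + opnorm B.
Proof.
apply: opnorm_le => v v1; rewrite mulmxDl.
apply: le_trans (l2normD _ _) _.
apply: lerD; apply: le_trans (opnormP _ _) _;
  by rewrite ler_piMr// opnorm_ge0.
Qed.

End OperatorNorm.

Local Open Scope relation_scope.

Record uniformity T (V : set_system (T * T)) : Prop := Uniformity {
  uniformity_filter : Filter V ;
  uniformity_diagonal : forall A, V A -> diagonal `<=` A ;
  uniformity_inv : forall A, V A -> V A^-1 ;
  uniformity_split : forall A, V A -> exists2 B, V B & B \; B `<=` A
}.

Definition unif_continuous_for (X : uniformType) T (f : X -> T)
    (V : set_system (T * T)) :=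
  forall A, V A -> entourage [set p : X * X | A (f p.1, f p.2)].

(* The uniformities on [T] making [f] uniformly continuous are directed, so
   their union is the finest one; see [final_entourage_finest]. *)
Definition final_entourage (X : uniformType) T (f : X -> T) :
    set_system (T * T) :=
  [set A | exists V, [/\ uniformity V, unif_continuous_for f V & V A]].

Section Final.
Variables (X : uniformType) (T : Type) (f : X -> T).

Let uniformity_indiscrete : uniformity [set [set: T * T]].
Proof.
split => [|_ -> //|_ -> //|_ ->]; last by exists setT.
split => // [_ _ -> ->|P Q PQ P1]; first by rewrite setTI.
by apply/seteqP; split => // x _; apply: PQ; rewrite P1.
Qed.

Let join (V W : set_system (T * T)) : set_system (T * T) :=
  [set A | exists B C, [/\ V B, W C & B `&` C `<=` A]].

Let uniformity_join V W : uniformity V -> uniformity W -> uniformity (join V W).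
Proof.
move=> [fV dV iV sV] [fW dW iW sW]; split.
- split.
  + by exists setT, setT; split => //; exact: filterT.
  + move=> P Q [B [C [VB WC BC]]] [B' [C' [VB' WC' BC']]].
    exists (B `&` B'), (C `&` C'); split; [exact: filterI|exact: filterI|].
    by move=> x [[Bx B'x] [Cx C'x]]; split; [exact: BC|exact: BC'].
  + move=> P Q PQ [B [C [VB WC BC]]]; exists B, C; split => //.
    exact: subset_trans PQ.
- move=> A [B [C [VB WC BC]]] x dx; apply: BC.
  by split; [exact: dV dx|exact: dW dx].
- move=> A [B [C [VB WC BC]]]; exists B^-1, C^-1; split; [exact: iV|exact: iW|].
  by move=> [x y] [Bx Cx]; apply: BC.
- move=> A [B [C [VB WC BC]]].
  have [B' VB' BB] := sV _ VB; have [C' WC' CC] := sW _ WC.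
  exists (B' `&` C'); first by exists B', C'; split.
  move=> [x z] [y [Bxy Cxy] [Byz Cyz]]; apply: BC.
  by split; [apply: BB; exists y|apply: CC; exists y].
Qed.

Let unif_continuous_join V W : unif_continuous_for f V ->
  unif_continuous_for f W -> unif_continuous_for f (join V W).
Proof.
move=> cV cW A [B [C [/cV VB /cW WC BC]]].
by apply: filterS (filterI VB WC) => p [Bp Cp]; exact: BC.
Qed.

Lemma final_uniformity : uniformity (final_entourage f).
Proof.
split.
- split.
  + exists [set setT]; split => // _ -> /=.
    by rewrite (_ : [set p | _] = setT)//; exact: filterT.
  + move=> P Q [V [uV cV VP]] [W [uW cW WQ]]; exists (join V W); split.
    * exact: uniformity_join.
    * exact: unif_continuous_join.
    * by exists P, Q; split.
  + move=> P Q PQ [V [uV cV VP]]; exists V; split => //.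
    by apply: (@filterS _ _ (uniformity_filter uV)) VP.
- by move=> A [V [uV cV VA]]; exact: (uniformity_diagonal uV VA).
- move=> A [V [uV cV VA]]; exists V; split => //.
  exact: (uniformity_inv uV).
- move=> A [V [uV cV VA]]; have [B VB BA] := uniformity_split uV VA.
  by exists B => //; exists V; split.
Qed.

Lemma final_unif_continuous : unif_continuous_for f (final_entourage f).
Proof. by move=> A [V [_ cV /cV]]. Qed.

Lemma final_entourage_finest V :
  uniformity V -> unif_continuous_for f V -> V `<=` final_entourage f.
Proof. by move=> uV cV A VA; exists V; split. Qed.

End Final.

Definition uniform_quotient (X : uniformType) (Q : quotType X) : Type := Q.

Section UniformQuotient.
Variables (X : uniformType) (Q : quotType X).
Local Notation Q' := (uniform_quotient Q).
Local Notation piQ := (\pi_Q%qT : X -> Q').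

HB.instance Definition _ := Quotient.copy Q' Q.
HB.instance Definition _ := [Sub Q' of X by %/].
HB.instance Definition _ := [Choice of Q' by <:].
HB.instance Definition _ := isUniform.Build Q'
  (uniformity_filter (final_uniformity piQ))
  (uniformity_diagonal (final_uniformity piQ))
  (uniformity_inv (final_uniformity piQ))
  (uniformity_split (final_uniformity piQ)).

End UniformQuotient.

Definition uniform_sum (I : choiceType) (X : I -> uniformType) : Type :=
  {i & X i}.

(* The coproduct in uniform spaces; see [sum_entourage_finest]. *)
Definition sum_entourage (I : choiceType) (X : I -> uniformType) :
    set_system (uniform_sum X * uniform_sum X) :=
  [set A | forall i, entourage
     [set p : X i * X i | A (existT _ i p.1, existT _ i p.2)]].

Section UniformSum.
Variables (I : choiceType) (X : I -> uniformType).

Lemma sum_uniformity : uniformity (@sum_entourage I X).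
Proof.
split.
- split.
  + by move=> i; exact: filterT.
  + by move=> P Q sP sQ i; exact: filterI (sP i) (sQ i).
  + by move=> P Q PQ sP i; apply: filterS (sP i) => p; exact: PQ.
- move=> A sA [p q] pq; have <- : p = q := pq; case: p {pq} => i x.
  exact: (@entourage_refl _ _ x (sA i)).
- move=> A sA i; exact: entourage_inv (sA i).
- move=> A sA.
  pose F i := split_ent [set p : X i * X i | A (existT _ i p.1, existT _ i p.2)].
  pose B := [set p : uniform_sum X * uniform_sum X |
    exists i x y, p = (existT _ i x, existT _ i y) /\ F i (x, y)].
  exists B.
    move=> i; apply: filterS (entourage_split_ent (sA i)) => -[x y] Fxy.
    by exists i, x, y.
  move=> [p r] [q [i [x [y [[/= -> ->] Fxy]]]] [j [y' [z [[/= ij eq_y ->] Fyz]]]]].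
  subst j.
  rewrite -(eq_from_Tagged eq_y) in Fyz.
  exact: (@subset_split_ent _ _ (sA i) (x, z) (ex_intro2 _ _ y Fxy Fyz)).
Qed.

Lemma sum_entourage_finest (V : set_system (uniform_sum X * uniform_sum X)) :
  (forall i, unif_continuous_for (existT X i : X i -> uniform_sum X) V) ->
  V `<=` @sum_entourage I X.
Proof. by move=> cV A VA i; exact: cV VA. Qed.

HB.instance Definition _ := Choice.on (uniform_sum X).
HB.instance Definition _ := isUniform.Build (uniform_sum X)
  (uniformity_filter sum_uniformity)
  (uniformity_diagonal sum_uniformity)
  (uniformity_inv sum_uniformity)
  (uniformity_split sum_uniformity).

End UniformSum.

Definition uniform_isomorphism (X Y : uniformType) (f : X -> Y) :=
  exists g : Y -> X,
    [/\ cancel f g, cancel g f, unif_continuous f & unif_continuous g].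

Local Close Scope relation_scope.

(* [phi x] acts on column vectors; the zero space is not irreducible. *)
Definition irreducible (R : realType) T n (phi : T -> 'M[R[i]]_n) :=
  (0 < n)%N /\
  forall W : {vspace 'cV[R[i]]_n},
    (forall x v, v \in W -> phi x *m v \in W) -> W = 0%VS \/ W = fullv.

Record irrep (R : realType) (G : topologicalGroupType) n := Irrep {
  irrep_fun :> G -> 'M[R[i]]_n ;
  irrep_unitary : forall x, irrep_fun x \is unitarymx ;
  irrepM : forall x y, irrep_fun (x * y)%g = irrep_fun x *m irrep_fun y ;
  irrep_continuous : forall x e, 0 < e ->
    \forall y \near x, opnorm (irrep_fun y - irrep_fun x) < e ;
  irrep_irreducible : irreducible irrep_fun
}.

Section Irrep.
Variables (R : realType) (G : topologicalGroupType) (n : nat).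
Local Notation irrep := (irrep R G n).

HB.instance Definition _ := gen_eqMixin irrep.
HB.instance Definition _ := gen_choiceMixin irrep.

Definition compact_band (K : set G) (e : R) : set (irrep * irrep) :=
  [set p : irrep * irrep | forall x, K x -> opnorm (p.1 x - p.2 x) < e].

Definition compact_entourage : set_system (irrep * irrep) :=
  [set A | exists K e, [/\ compact K, 0 < e & compact_band K e `<=` A]].

Lemma compact_uniformity : uniformity compact_entourage.
Proof.
split.
- split.
  + by exists set0, 1; split => //; exact: compact0.
  + move=> P Q [K [e [cK e0 KP]]] [L [d [cL d0 LQ]]].
    exists (K `|` L), (Num.min e d).
    split; [exact: compactU|by rewrite lt_min e0|].
    move=> p KLp; split.
      by apply: KP => x Kx; have := KLp x (or_introl Kx); rewrite lt_min => /andP[].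
    by apply: LQ => x Lx; have := KLp x (or_intror Lx); rewrite lt_min => /andP[].
  + move=> P Q PQ [K [e [cK e0 KP]]]; exists K, e; split => //.
    exact: subset_trans PQ.
- move=> A [K [e [_ e0 KA]]] [p q] pq; have <- : p = q := pq.
  by apply: KA => x _ /=; rewrite subrr opnorm0.
- move=> A [K [e [cK e0 KA]]]; exists K, e; split => // -[p q] Kpq.
  by apply: (KA (q, p)) => x /Kpq /=; rewrite -opnormN opprB.
- move=> A [K [e [cK e0 KA]]]; exists (compact_band K (e / 2)).
    by exists K, (e / 2); split => //; rewrite divr_gt0.
  move=> [p r] [q pq qr]; apply: KA => x Kx /=.
  rewrite -(subrKA (q x)) (splitr e).
  by apply: le_lt_trans (opnormD _ _) _; apply: ltrD; [exact: pq|exact: qr].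
Qed.

HB.instance Definition _ := isUniform.Build irrep
  (uniformity_filter compact_uniformity)
  (uniformity_diagonal compact_uniformity)
  (uniformity_inv compact_uniformity)
  (uniformity_split compact_uniformity).

Definition unitary_equiv : rel irrep := fun phi psi =>
  `[< exists2 U : 'M[R[i]]_n, U \is unitarymx &
      forall x, U *m phi x = psi x *m U >].

Lemma unitary_equivP : equiv_class_of unitary_equiv.
Proof.
split.
- move=> phi; apply/asboolP; exists 1%:M.
    by apply/unitarymxP; rewrite mul1mx trmx1 map_mx1.
  by move=> x; rewrite mul1mx mulmx1.
- suff sym phi psi : unitary_equiv phi psi -> unitary_equiv psi phi.
    by move=> phi psi; apply/idP/idP; exact: sym.
  move=> /asboolP[U uU pU]; apply/asboolP; exists (invmx U).
    by rewrite invmx_unitary// trmxC_unitary.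
  move=> x; have Uu := unitarymx_unit uU.
  by rewrite -[psi x](mulmxK Uu) -pU mulmxA mulKmx.
- move=> psi phi xi /asboolP[U uU pU] /asboolP[V uV pV]; apply/asboolP.
  exists (V *m U); first exact: mul_unitarymx.
  by move=> x; rewrite -mulmxA pU mulmxA pV mulmxA.
Qed.

Canonical unitary_equiv_rel := EquivRelPack unitary_equivP.

End Irrep.

Definition unitary_dual_n (R : realType) (G : topologicalGroupType) (n : nat) :
    uniformType :=
  uniform_quotient {eq_quot (@unitary_equiv_rel R G n)}%qT.

Definition unitary_dual (R : realType) (G : topologicalGroupType) : uniformType :=
  uniform_sum (unitary_dual_n R G).

Section Restriction.
Variables (R : realType) (G : topologicalGroupType) (H : subgroup G).
Hypothesis denseH : dense H.
Variable n : nat.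
Implicit Type phi : irrep R G n.

Let res phi (x : subgroup_type H) := phi (subgroup_incl x).

Lemma res_continuous phi (x : subgroup_type H) e : 0 < e ->
  \forall y \near x, opnorm (res phi y - res phi x) < e.
Proof.
move=> e0; exact: (subgroup_incl_continuous (irrep_continuous phi _ e0)).
Qed.

Lemma res_irreducible phi : irreducible (res phi).
Proof.
have [n0 irr] := irrep_irreducible phi; split => // W WH; apply: irr => g v Wv.
(* [f] has kernel [W], and [f (phi g *m v) = 0] by density and continuity *)
pose f w := w - projv W w.
have fP w : (f w == 0) = (w \in W).
  rewrite subr_eq0; apply/eqP/idP => [->|/projv_id ->//]; exact: memv_proj.
have f_linear : linear f.
  by move=> a u w; rewrite /f linearP scalerBr opprD addrACA.
pose fL : {linear 'cV[R[i]]_n -> 'cV[R[i]]_n} :=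
  HB.pack f (GRing.isLinear.Build _ _ _ _ f f_linear).
have [c c0 fc] := linear_bounded fL.
rewrite -fP; apply/eqP; apply: l2norm_eq0; apply/eqP.
rewrite eq_le l2norm_ge0 andbT leNgt; apply/negP => fg_gt0.
set d := l2norm (f _) in fg_gt0.
pose e := d / (c * l2norm v + 1).
have cv0 : 0 < c * l2norm v + 1.
  by rewrite ltr_wpDl// mulr_ge0// l2norm_ge0.
have e0 : 0 < e by rewrite divr_gt0.
have : nbhs g [set y | opnorm (phi y - phi g) < e] by exact: irrep_continuous.
rewrite nbhsE => -[O [oO Og] Oe].
have [h [Oh Hh]] := denseH (ex_intro _ g Og) oO.
have fh0 : f (phi h *m v) = 0.
  apply/eqP; rewrite fP.
  exact: (WH (exist _ h (mem_set Hh) : subgroup_type H)).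
have := Oe _ Oh => /=; apply/negP; rewrite -leNgt.
have := fc ((phi h - phi g) *m v).
rewrite mulmxBl [fL _](linearB fL) /= fh0 sub0r.
rewrite -scaleN1r l2normZ normcN ComplexField.Normc.normc1 mul1r -/d => dle.
rewrite leNgt; apply/negP => lt_e.
have : d <= c * (e * l2norm v).
  apply: le_trans dle _; apply: ler_wpM2l => //.
  rewrite -mulmxBl; apply: le_trans (opnormP _ _) _.
  by apply: ler_wpM2r; [exact: l2norm_ge0|exact: ltW].
apply/negP; rewrite -ltNge.
have -> : d = e * (c * l2norm v + 1) by rewrite /e divfK// gt_eqF.
by rewrite mulrCA ltr_pM2l// ltrDl.
Qed.

Definition restrict_irrep phi : irrep R (subgroup_type H) n := {|
  irrep_fun := res phi ;
  irrep_unitary := fun x => irrep_unitary phi (subgroup_incl x) ;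
  irrepM := fun x y => etrans (congr1 phi (subgroup_inclM x y)) (irrepM phi _ _) ;
  irrep_continuous := @res_continuous phi ;
  irrep_irreducible := res_irreducible phi
|}.

Definition restrict_dual_n (xi : unitary_dual_n R G n) :
    unitary_dual_n R (subgroup_type H) n :=
  \pi_(unitary_dual_n R (subgroup_type H) n)%qT (restrict_irrep (repr xi)).

Lemma restrict_dual_nE phi :
  restrict_dual_n (\pi_(unitary_dual_n R G n)%qT phi) =
  \pi_(unitary_dual_n R (subgroup_type H) n)%qT (restrict_irrep phi).
Proof.
apply/eqmodP => /=.
have /eqmodP/asboolP[U uU pU] := reprK (\pi_(unitary_dual_n R G n)%qT phi).
by apply/asboolP; exists U => // x; exact: pU.
Qed.

End Restriction.

Definition restrict_dual (R : realType) (G : topologicalGroupType)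
    (H : subgroup G) (dH : dense H) (s : unitary_dual R G) :
    unitary_dual R (subgroup_type H) :=
  existT _ (tag s) (restrict_dual_n dH (tagged s)).

Definition determines (R : realType) (G : topologicalGroupType)
    (H : subgroup G) (dH : dense H) :=
  uniform_isomorphism (@restrict_dual R G H dH).

Definition determined (R : realType) (G : topologicalGroupType) :=
  forall (H : subgroup G) (dH : dense H), determines R dH.

Definition metrizable (R : realType) (T : topologicalType) :=
  exists d : T -> T -> R,
    [/\ forall x, d x x = 0,
        forall x y, d x y = 0 -> x = y,
        forall x y, d x y = d y x,
        forall x y z, d x z <= d x y + d y z &
        forall x, nbhs x =
          filter_from [set e | 0 < e] (fun e => [set y | d x y < e])].

(* Main.v *)
(* A determined compact group that is not metrizable is refuted in four steps.

   (1) Peter-Weyl.  The Haar mean is the limit of averages over minimal covers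
   by translates of small neighbourhoods; Hall's marriage theorem shows that these
   averages are almost invariant.  A convolution operator that does not vanish on
   the functions orthogonal to everything invariant under the common kernel of all
   finite-dimensional representations would have there a nonzero, finite-dimensional
   eigenspace, i.e. a representation seeing the kernel.  So irreducible unitary
   representations separate the points of a compact Hausdorff group [G], and if [G]
   is not metrizable, some [unitary_dual_n R G n] is uncountable.

   (2) By Schur's lemma inequivalent representations of a compact [G] are at uniform
   distance at least [1], so the dual of [G] is uniformly discrete.  If a dense [H]
   determines [G], then so is the dual of [H]: some compact [K] in [H] and [e > 0]
   are such that representations which are [e]-close on [K] are equivalent.

   (3) By Zorn's lemma there are an uncountable set [S] of classes of dimension [n]
   and a sequence which is dense modulo their common kernel [N]: a sequence that is
   dense (and keeps returning everywhere) modulo the kernel of countably many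
   representations can be corrected, without changing its classes, to be dense
   for one more representation, because quotient maps of groups are open.

   (4) Let [H] be the preimage of the countable dense subgroup of [G / N] generated by
   this sequence.  A compact [K] in [H] is countable modulo [N], so its image is
   metrizable, its continuous functions are separable, and two distinct elements of
   the uncountable [S] are [e]-close on [K], contradicting (2). *)
Require Import Defs.
From HB Require Import structures.
From mathcomp Require Import all_boot all_order all_algebra.
From mathcomp Require Import ring lra complex.
From mathcomp Require Import all_classical reals topology normedtype.
Set Implicit Arguments.
Unset Strict Implicit.
Unset Printing Implicit Defensive.
Import Order.TTheory GRing.Theory Num.Theory numFieldNormedType.Exports.
Local Open Scope classical_set_scope.
Local Open Scope ring_scope.

(** * Hall's marriage theorem *)

Section Hall.
Variable T : finType.
Implicit Types (A B : {set T}) (r : T -> T -> bool).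

Let nbr r A := [set j | [exists i in A, r i j]]%SET.

(** Induction on [#|A|]. If some nonempty proper [B] has exactly [#|B|] neighbours, match [B], then
    match the rest of [A] outside the neighbours of [B]. Otherwise nonempty proper subsets have a
    neighbour to spare, so any pair [i0], [j0] may be matched and removed. *)
Lemma hall_marriage_on r A :
  (forall B, B \subset A -> #|B| <= #|nbr r B|)%N ->
  exists s : T -> T, {in A &, injective s} /\ {in A, forall i, r i (s i)}.
Proof.
have [n] := ubnP #|A|; elim: n r A => // n IH r A ltAn hallA.
have [->|[i0 i0A]] := set_0Vmem A.
  by exists id; split => [i j|i]; rewrite inE.
have [/existsP[B /and4P[BA B0 neBA /eqP cB]]|noB] :=
    boolP [exists B : {set T},
      [&& B \subset A, B != finset.set0, B != A & #|nbr r B| == #|B|]].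
  have pBA : B \proper A by rewrite finset.properEneq neBA.
  have ltBn : (#|B| < n)%N by exact: leq_trans (proper_card pBA) _.
  have [s1 [s1I s1r]] : exists s : T -> T,
      {in B &, injective s} /\ {in B, forall i, r i (s i)}.
    by apply: IH => // C CB; apply: hallA; exact: fintype.subset_trans BA.
  pose r' i j := r i j && (j \notin nbr r B).
  have [s2 [s2I s2r]] : exists s : T -> T,
      {in (A :\: B)%SET &, injective s} /\ {in (A :\: B)%SET, forall i, r' i (s i)}.
    apply: IH.
      apply: leq_trans (_ : #|A| <= n)%N => //.
      by rewrite cardsD (finset.setIidPr BA) ltn_subrL !card_gt0 B0; apply/set0Pn; exists i0.
    move=> C CAB.
    have CA : C \subset A := fintype.subset_trans CAB (finset.subsetDl _ _).
    have dCB : fintype.disjoint (mem C) (mem B) by move: CAB; rewrite finset.subsetD => /andP[].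
    (* Hall's condition for the union, less the [#|B|] neighbours of [B], is the condition for [C]
       and [r']. *)
    have := hallA (C :|: B)%SET; rewrite finset.subUset CA BA => /(_ isT).
    rewrite cardsU finset.disjoint_setI0// cards0 subn0 => /leq_trans h.
    have : (#|nbr r (C :|: B)%SET| <= #|nbr r' C| + #|nbr r B|)%N.
      apply: leq_trans (_ : #|(nbr r' C :|: nbr r B)%SET| <= _)%N.
        apply/subset_leq_card/fintype.subsetP => j; rewrite !inE.
        move=> /existsP[i /andP[]]; rewrite inE => /orP[iC|iB] rij.
          case: (boolP [exists i in B, r i j]) => [|nj]; rewrite ?orbT//.
          by rewrite orbF; apply/existsP; exists i; rewrite iC /r' rij inE.
        by apply/orP; right; apply/existsP; exists i; rewrite iB.
      by rewrite cardsU leq_subr.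
    by move/h; rewrite cB leq_add2r.
  exists (fun i => if i \in B then s1 i else s2 i); split.
    have s1s2 i j : i \in B -> j \in A -> j \notin B -> s1 i <> s2 j.
      move=> iB jA jB e; have /andP[_] : r' j (s2 j).
        by apply: s2r; rewrite finset.in_setD jB.
      by rewrite -e inE => /negP; apply; apply/existsP; exists i; rewrite iB s1r.
    move=> i j iA jA; case: ifPn => iB; case: ifPn => jB.
    - exact: s1I.
    - by move=> e; case: (s1s2 i j).
    - by move=> e; case: (s1s2 j i).
    - by apply: s2I; rewrite finset.in_setD ?iB ?jB.
  move=> i iA; case: ifPn => iB; first exact: s1r.
  by have /andP[] : r' i (s2 i) by apply: s2r; rewrite finset.in_setD iB.
have [j0 rj0] : exists j, r i0 j.
  have := hallA [set i0]%SET; rewrite finset.sub1set => /(_ i0A).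
  rewrite cards1 card_gt0 => /set0Pn[j]; rewrite inE => /existsP[i /andP[]].
  by rewrite inE => /eqP -> ?; exists j.
pose r' i j := r i j && (j != j0).
have [s [sI sr]] : exists s : T -> T,
    {in (A :\ i0)%SET &, injective s} /\ {in (A :\ i0)%SET, forall i, r' i (s i)}.
  apply: IH; first by move: ltAn; rewrite [in X in (X < _)%N](cardsD1 i0) i0A.
  move=> C CA; have [->|[c cC]] := set_0Vmem C; first by rewrite cards0.
  have CA' : C \subset A := fintype.subset_trans CA (finset.subD1set _ _).
  have neC : (#|C| < #|nbr r C|)%N.
    rewrite ltn_neqAle hallA// andbT; apply/negP => /eqP e.
    move/negP: noB; apply; apply/existsP; exists C; rewrite CA' -e eqxx andbT /=.
    apply/andP; split; first by apply/set0Pn; exists c.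
    by apply: contraTneq CA => ->; rewrite finset.subsetD1 i0A andbF.
  have : (#|nbr r C| <= #|nbr r' C| + 1)%N.
    rewrite -(cards1 j0); apply: leq_trans (_ : #|(nbr r' C :|: [set j0])%SET| <= _)%N.
      apply/subset_leq_card/fintype.subsetP => j; rewrite !inE.
      move=> /existsP[i /andP[iC rij]]; have [//|jj] := eqVneq j j0; rewrite ?orbT//.
      by rewrite orbF; apply/existsP; exists i; rewrite iC /r' rij.
    by rewrite cardsU leq_subr.
  by rewrite addn1 => /(leq_trans neC).
have sj i : i \in A -> i != i0 -> s i != j0.
  by move=> iA ne; have /andP[] : r' i (s i) by apply: sr; rewrite !inE ne.
exists (fun i => if i == i0 then j0 else s i); split.
  move=> i j iA jA; case: (eqVneq i i0) => [->|ni]; case: (eqVneq j i0) => [->|nj] //.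
  - by move=> e; have := sj j jA nj; rewrite -e eqxx.
  - by move=> e; have := sj i iA ni; rewrite e eqxx.
  - by apply: sI; rewrite !inE ?ni ?nj.
move=> i iA; case: eqVneq => [->//|ni].
by have /andP[] : r' i (s i) by apply: sr; rewrite !inE ni.
Qed.

Lemma hall_marriage r : (forall B, #|B| <= #|nbr r B|)%N ->
  exists s : T -> T, injective s /\ forall i, r i (s i).
Proof.
move=> h; have [s [sI sr]] := @hall_marriage_on r [set: T]%SET (fun B _ => h B).
by exists s; split => [i j|i]; [apply: sI|apply: sr]; rewrite inE.
Qed.

End Hall.

(** * Compactness and continuity *)

Section CompactNear.
Variable T : topologicalType.
Hypothesis cT : compact [set: T].

(** The tube lemma for filters: a property that holds locally in [x], eventually in [i], holds
    eventually for all [x] at once. Most uniformity arguments below go through it. *)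
Lemma compact_near_all I (F : set_system I) (P : I -> T -> Prop) : Filter F ->
  (forall x : T, filter_prod (nbhs x) F [set p | P p.2 p.1]) ->
  \forall i \near F, forall x, P i x.
Proof.
move=> FF h; have := (compact_near_coveringP _).1 cT I F P FF (fun x _ => h x).
by apply: filterS => i Pi x; exact: Pi.
Qed.

Lemma compact_finite_net (U : T -> set T) : (forall x, nbhs x (U x)) ->
  exists s : seq T, forall x, exists2 a, a \in s & U a x.
Proof.
move=> nU; pose F : set_system (seq T) :=
  [set A : set (seq T) | exists s0 : seq T, forall s : seq T, {subset s0 <= s} -> A s].
have FF : Filter F.
  split; first by exists [::].
    move=> A B [s1 A1] [s2 B2]; exists (s1 ++ s2) => s ss; split.
      by apply: A1 => x xs; apply: ss; rewrite mem_cat xs.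
    by apply: B2 => x xs; apply: ss; rewrite mem_cat xs orbT.
  by move=> A B AB [s As]; exists s => s' /As /AB.
have [s hs] : F [set s : seq T | forall x, exists2 a, a \in s & U a x].
  apply: (@compact_near_all _ F (fun s x => exists2 a, a \in s & U a x)) => x.
  exists (U x, [set s : seq T | x \in s]) => /=.
    by split => //; exists [:: x] => s; apply; rewrite inE.
  by move=> [y s] [/= Uy xs]; exists x.
by exists s; exact: hs.
Qed.

End CompactNear.

Section Continuity.
Variables (S T U : topologicalType) (R : realType) (G : topologicalGroupType).

Lemma ctsC (c : U) : continuous (fun _ : T => c).
Proof. by move=> x; exact: cvg_cst. Qed.

Lemma cts_id : continuous (fun x : T => x).
Proof. by move=> x; exact: cvg_id. Qed.

Lemma cts_comp (g : S -> T) (f : T -> U) :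
  continuous g -> continuous f -> continuous (fun x => f (g x)).
Proof. by move=> cg cf x; apply: continuous_comp; [exact: cg|exact: cf]. Qed.

Lemma cts_pair (f : S -> T) (g : S -> U) :
  continuous f -> continuous g -> continuous (fun x => (f x, g x)).
Proof. by move=> cf cg x; apply: cvg_pair; [exact: cf|exact: cg]. Qed.

Lemma cts_fst : continuous (@fst T U).
Proof. by move=> [x y]; exact: cvg_fst. Qed.

Lemma cts_snd : continuous (@snd T U).
Proof. by move=> [x y]; exact: cvg_snd. Qed.

Lemma cts_add (f g : T -> R) :
  continuous f -> continuous g -> continuous (fun x => f x + g x).
Proof. by move=> cf cg x; apply: cvgD; [exact: cf|exact: cg]. Qed.

Lemma cts_opp (f : T -> R) : continuous f -> continuous (fun x => - f x).
Proof. by move=> cf x; apply: cvgN; exact: cf. Qed.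

Lemma cts_sub (f g : T -> R) :
  continuous f -> continuous g -> continuous (fun x => f x - g x).
Proof. by move=> cf cg x; apply: cvgB; [exact: cf|exact: cg]. Qed.

Lemma cts_mul (f g : T -> R) :
  continuous f -> continuous g -> continuous (fun x => f x * g x).
Proof. by move=> cf cg x; apply: cvgM; [exact: cf|exact: cg]. Qed.

Lemma cts_norm (f : T -> R) : continuous f -> continuous (fun x => `|f x|).
Proof. by move=> cf x; apply: cvg_norm; exact: cf. Qed.

Lemma cts_sum (I : Type) (r : seq I) (f : I -> T -> R) :
  (forall i, continuous (f i)) -> continuous (fun x => \sum_(i <- r) f i x).
Proof.
move=> cf; elim: r => [|i r IH].
  have -> : (fun x => \sum_(i <- [::]) f i x) = (fun=> 0 : R).
    by apply/funext => x; rewrite big_nil.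
  by move=> x; exact: cvg_cst.
have -> : (fun x => \sum_(j <- i :: r) f j x) =
    (fun x => f i x + \sum_(j <- r) f j x).
  by apply/funext => x; rewrite big_cons.
exact: cts_add.
Qed.

Lemma cts_mulg (f g : T -> G) :
  continuous f -> continuous g -> continuous (fun x => f x * g x)%g.
Proof.
move=> cf cg x; apply: (@continuous_comp _ _ _ (fun x => (f x, g x))
  (fun p : G * G => (p.1 * p.2)%g)); last exact: mulg_continuous.
by apply: cvg_pair; [exact: cf|exact: cg].
Qed.

Lemma cts_invg (f : T -> G) :
  continuous f -> continuous (fun x => (f x)^-1)%g.
Proof.
move=> cf x; apply: (@continuous_comp _ _ _ f (fun y : G => y^-1)%g).
  exact: cf.
exact: invg_continuous.
Qed.

Lemma ctsP (f : T -> R) : continuous f <->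
  forall x e, 0 < e -> \forall y \near x, `|f y - f x| < e.
Proof.
split=> [cf x e e0|cf x].
  have /cvgrPdistC_lt h : f @ x --> f x by exact: cf.
  exact: h.
by apply/cvgrPdistC_lt => e e0; exact: cf.
Qed.

End Continuity.

(** * The Haar mean of a compact group *)

Section Average.
Variables (R : realType) (T : choiceType).
Implicit Types (s : seq T) (f : T -> R).

(** Repetitions in [s] count, and the empty sequence averages to [0], whence the conditions on
    [size s]. *)
Definition avg s f : R := (\sum_(a <- s) f a) / (size s)%:R.

Lemma avgD s f g : avg s (fun x => f x + g x) = avg s f + avg s g.
Proof. by rewrite /avg big_split mulrDl. Qed.

Lemma avgZ s c f : avg s (fun x => c * f x) = c * avg s f.
Proof. by rewrite /avg -mulr_sumr mulrA. Qed.

Lemma avg_cst s c : (0 < size s)%N -> avg s (fun=> c) = c.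
Proof.
move=> s0; rewrite /avg big_const_seq count_predT iter_addr_0 -[c *+ _]mulr_natr mulfK//.
by rewrite pnatr_eq0 -lt0n.
Qed.

Lemma avgB s f g : avg s (fun x => f x - g x) = avg s f - avg s g.
Proof. by rewrite /avg sumrB mulrBl. Qed.

Lemma le_avg s f g : (forall x, f x <= g x) -> avg s f <= avg s g.
Proof.
by move=> fg; apply: ler_wpM2r; [rewrite invr_ge0 ler0n|apply: ler_sum].
Qed.

Lemma avg_close s f g e : (0 < size s)%N ->
  (forall x, `|f x - g x| <= e) -> `|avg s f - avg s g| <= e.
Proof.
move=> s0 fg; rewrite -avgB ler_norml -{1}(avg_cst (- e) s0) -{2}(avg_cst e s0).
by apply/andP; split; apply: le_avg => x; have := fg x; rewrite ler_norml => /andP[].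
Qed.

Lemma avg_exch s t (F : T -> T -> R) :
  avg s (fun a => avg t (F a)) = avg t (fun b => avg s (fun a => F a b)).
Proof.
rewrite /avg -!mulr_suml exchange_big/= mulrAC; congr (_ * _).
Qed.

End Average.

(** * Almost invariant finite sets *)

Section Nets.
Variables (R : realType) (G : topologicalGroupType).
Implicit Types (f : G -> R) (V : set G) (s : seq G) (e : R) (x : G).

Definition rosc V e f := forall x v, V v -> `|f (x * v)%g - f x| <= e.
Definition losc V e f := forall x v, V v -> `|f (v * x)%g - f x| <= e.

(** Controlled right oscillation makes the average over [s] almost invariant under left translation;
    [s] depends on [V] alone, not on [f] or [e]. In [lnet] the sides are exchanged. *)
Definition rnet V s := (0 < size s)%N /\
  forall f e, rosc V e f -> forall x, `|avg s (fun a => f (x * a)%g) - avg s f| <= e.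
Definition lnet V s := (0 < size s)%N /\
  forall f e, losc V e f -> forall x, `|avg s (fun a => f (a * x)%g) - avg s f| <= e.

Lemma sub_losc V W e f : V `<=` W -> losc W e f -> losc V e f.
Proof. by move=> VW h x v /VW; exact: h. Qed.

(* Two minimal covers of [G] by left translates of a neighbourhood are matched
   by Hall's theorem, so a minimal cover is an almost invariant finite set. *)
Lemma rnet_ex V : compact [set: G] -> nbhs 1%g V -> exists s, rnet V s.
Proof.
move=> cG nV.
have [W nW WV] : exists2 W : set G, nbhs 1%g W &
    forall w w', W w -> W w' -> V (w / w')%g.
  have : \forall p \near ((1, 1) : G * G)%g, V (p.1 / p.2)%g.
    have c : continuous (fun p : G * G => p.1 / p.2)%g.
      apply: cts_mulg; first exact: cts_fst.
      by apply: cts_invg; exact: cts_snd.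
    by apply: (c (1, 1)%g); rewrite /= divg1.
  move=> [[A B] [/= nA nB] AB]; exists (A `&` B); first exact: filterI.
  by move=> w w' [Aw _] [_ Bw']; exact: (AB (w, w')).
pose covers (s : seq G) := forall x, exists2 a, a \in s & W (a^-1 * x)%g.
have [s0 cs0] : exists s, covers s.
  apply: (@compact_finite_net _ cG (fun a => [set x | W (a^-1 * x)%g])) => a.
  have c : continuous (fun x : G => a^-1 * x)%g.
    by apply: cts_mulg; [exact: ctsC|exact: cts_id].
  by apply: (c a); rewrite mulVg.
(* Minimality of the length of a cover is what yields Hall's condition. *)
have exP : exists m, `[< exists2 s, covers s & size s = m >].
  by exists (size s0); apply/asboolP; exists s0.
case: (ex_minnP exP) => m /asboolP[s cs sm] mmin.
have m0 : (0 < m)%N by rewrite -sm; have [a] := cs 1%g; case: (s).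
exists s; split; first by rewrite sm.
move=> f e oV x.
pose S (i : 'I_m) := nth 1%g s i.
have coverS y : exists i, W ((S i)^-1 * y)%g.
  have [a sa Wa] := cs y.
  have ltm : (index a s < m)%N by rewrite -sm index_mem.
  by exists (Ordinal ltm); rewrite /S /= nth_index.
(* [i] and [j] are related when the translates of [W] by [x * S i] and by [S j] meet. *)
pose r i j := `[< exists y, W ((x * S i)^-1 * y)%g /\ W ((S j)^-1 * y)%g >].
have hall (B : {set 'I_m}) : (#|B| <= #|[set j | [exists i in B, r i j]]%SET|)%N.
  set N := [set j | _]%SET.
  (* Replacing the translates with index in [B] by all [S j] that meet them leaves a cover, which
     has at least [m] members. *)
  pose t := [seq (x * S i)%g | i <- enum (~: B)%SET] ++ [seq S j | j <- enum N].
  have ct : covers t.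
    move=> y; have [i Wi] := coverS (x^-1 * y)%g.
    have Wi' : W ((x * S i)^-1 * y)%g by rewrite invgM -mulgA.
    have [iB|iB] := boolP (i \in B); last first.
      exists (x * S i)%g => //; rewrite mem_cat; apply/orP; left.
      by apply/mapP; exists i => //; rewrite mem_enum inE.
    have [j Wj] := coverS y; exists (S j) => //.
    rewrite mem_cat; apply/orP; right; apply/mapP; exists j => //.
    rewrite mem_enum inE; apply/existsP; exists i; rewrite iB /=.
    by apply/asboolP; exists y.
  have : (m <= size t)%N by apply: mmin; apply/asboolP; exists t.
  rewrite size_cat !size_map -!cardE.
  have := cardsC B; rewrite card_ord; set b := #|B|; set c := #|(~: B)%SET|.
  by move: (#|N|) => k bc; rewrite -[in X in (X <= _)%N]bc addnC leq_add2l.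
have [sg [sgI sgr]] := hall_marriage hall.
have avgE g : avg s g = (\sum_(i < m) g (S i)) / m%:R.
  by rewrite /avg sm (big_nth 1%g) big_mkord sm.
rewrite !avgE [X in `|_ - X / _|](reindex_inj sgI) /= -mulrBl -sumrB.
have eE : e = (\sum_(i < m) e) / m%:R.
  by rewrite sumr_const card_ord -[e *+ m]mulr_natr mulfK// pnatr_eq0 -lt0n.
rewrite [leRHS]eE normrM normfV (ger0_norm (ler0n R m)) ler_pM2r ?invr_gt0 ?ltr0n//.
apply: le_trans (ler_norm_sum _ _ _) _.
apply: ler_sum => i _.
have /asboolP[y [W1 W2]] := sgr i.
(* The common point [y] puts the quotient of [x * S i] by its partner [S (sg i)] in [V]. *)
have := oV (S (sg i)) _ (WV _ _ W2 W1).
by rewrite (invgM (x * S i)^-1 y)%g invgK -mulgA !mulVKg.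
Qed.

(** Inversion exchanges left and right. *)
Lemma lnet_ex V : compact [set: G] -> nbhs 1%g V -> exists s, lnet V s.
Proof.
move=> cG nV.
have nV' : nbhs 1%g [set v : G | V v^-1%g].
  have c : continuous (fun v : G => v^-1)%g by apply: cts_invg; exact: cts_id.
  by apply: (c 1%g); rewrite /= invg1.
have [s [s0 sV]] := rnet_ex cG nV'.
exists (map (fun x : G => x^-1)%g s); split; first by rewrite size_map.
move=> f e oV x.
have avgE g : avg [seq (a^-1)%g | a <- s] g = avg s (fun a => g (a^-1)%g).
  by rewrite /avg size_map big_map.
have := sV (fun a => f (a^-1)%g) e _ (x^-1)%g.
rewrite !avgE; under [X in `|avg s X - _|]eq_fun do rewrite invgM invgK.
by apply=> y v Vv; rewrite invgM; exact: oV.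
Qed.

End Nets.

(** * Existence, invariance and positivity of the mean *)

Section Mean.
Variables (R : realType) (G : topologicalGroupType).
Hypothesis cG : compact [set: G].
Local Notation rnet := (@rnet R G).
Local Notation lnet := (@lnet R G).
Implicit Types (f g : G -> R) (V : set G) (s : seq G) (e : R) (x : G).

Let near1_small (T : topologicalType) (h : T -> G -> R) e :
  compact [set: T] -> continuous (fun p : T * G => h p.1 p.2) ->
  (forall t, h t 1%g = 0) -> 0 < e ->
  \forall v \near 1%g, forall t, `|h t v| <= e.
Proof.
move=> cT ch h1 e0.
apply: (@compact_near_all _ cT _ (nbhs (1%g : G)) (fun v t => `|h t v| <= e)) => t.
have /ctsP/(_ (t, 1%g) e e0) := ch.
by apply: filterS => -[y v] /=; rewrite h1 subr0 => /ltW.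
Qed.

Lemma near_rosc f e : continuous f -> 0 < e -> \forall v \near 1%g, rosc [set v] e f.
Proof.
move=> cf e0; have := @near1_small G (fun x v => f (x * v)%g - f x) e cG.
move=> h; apply: filterS (h _ _ e0) => [v hv x _ ->//||x]; last first.
  by rewrite mulg1 subrr.
apply: cts_sub; (apply: cts_comp cf); last exact: cts_fst.
by apply: cts_mulg; [exact: cts_fst|exact: cts_snd].
Qed.

Lemma near_losc f e : continuous f -> 0 < e -> \forall v \near 1%g, losc [set v] e f.
Proof.
move=> cf e0; have := @near1_small G (fun x v => f (v * x)%g - f x) e cG.
move=> h; apply: filterS (h _ _ e0) => [v hv x _ ->//||x]; last first.
  by rewrite mul1g subrr.
apply: cts_sub; (apply: cts_comp cf); last exact: cts_fst.
by apply: cts_mulg; [exact: cts_snd|exact: cts_fst].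
Qed.

Definition osc V e f := rosc V e f /\ losc V e f.

Lemma near_osc f e : continuous f -> 0 < e -> \forall v \near 1%g, osc [set v] e f.
Proof.
by move=> cf e0; apply: filterS (filterI (near_rosc cf e0) (near_losc cf e0)).
Qed.

Lemma osc_set V e f : (forall v, V v -> osc [set v] e f) -> osc V e f.
Proof. by move=> h; split=> x v Vv; have [r l] := h v Vv; [exact: r|exact: l]. Qed.

(** The double average of [f (b * a)] is near [avg s f] because [s] is almost left invariant, and
    near [avg t f] because [t] is almost right invariant. *)
Lemma rlnet_close V W s t f e d : rnet V s -> lnet W t -> rosc V e f ->
  losc W d f -> `|avg s f - avg t f| <= e + d.
Proof.
move=> [s0 hs] [t0 ht] rf lf.
pose D := avg t (fun b => avg s (fun a => f (b * a)%g)).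
have h1 : `|D - avg s f| <= e.
  by rewrite -[X in _ - X](avg_cst _ t0); apply: avg_close => // b; exact: hs.
have h2 : `|D - avg t f| <= d.
  rewrite -[X in _ - X](avg_cst _ s0) /D avg_exch.
  by apply: avg_close => // b; exact: ht.
move: h1 h2; rewrite !ler_norml => /andP[? ?] /andP[? ?]; apply/andP; split; lra.
Qed.

(** Two right nets, compared through a common left net, have averages at most [e *+ 2 + d *+ 2]
    apart. So these numbers are lower estimates, and their supremum is the limit of the averages. *)
Let lower f : set R := [set r | exists V s e,
  [/\ nbhs 1%g V, osc V e f, rnet V s & r = avg s f - e *+ 2]].

Definition mean f : R := sup (lower f).

Lemma mean_rnet V s e f : nbhs 1%g V -> osc V e f -> rnet V s ->
  `|avg s f - mean f| <= e *+ 2.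
Proof.
move=> nV oV nVs.
have cross W t d : nbhs 1%g W -> osc W d f -> rnet W t ->
    `|avg s f - avg t f| <= e *+ 2 + d *+ 2.
  move=> nW oW nWt; have nVW : nbhs 1%g (V `&` W) by exact: filterI.
  have [l nl] := lnet_ex R cG nVW.
  have h1 := @rlnet_close _ _ _ _ f _ _ nVs nl oV.1 (sub_losc (@subIsetl _ _ _) oV.2).
  have h2 := @rlnet_close _ _ _ _ f _ _ nWt nl oW.1 (sub_losc (@subIsetr _ _ _) oW.2).
  move: h1 h2; rewrite !ler_norml => /andP[? ?] /andP[? ?]; apply/andP; split; lra.
have ub : ubound (lower f) (avg s f + e *+ 2).
  move=> _ [W [t [d [nW oW nWt ->]]]].
  have := cross _ _ _ nW oW nWt; rewrite ler_norml => /andP[? ?]; lra.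
have in_l : lower f (avg s f - e *+ 2) by exists V, s, e.
have h1 : mean f <= avg s f + e *+ 2 by apply: ge_sup => //; exists (avg s f - e *+ 2).
have h2 : avg s f - e *+ 2 <= mean f.
  by apply: ub_le_sup => //; exists (avg s f + e *+ 2).
rewrite ler_norml; apply/andP; split; lra.
Qed.

(* The same finite set serves a whole equicontinuous family, which is what makes
   Fubini's theorem for the mean elementary. *)
Lemma mean_approx (P : set (G -> R)) e : 0 < e ->
  (\forall v \near 1%g, forall f, P f -> osc [set v] e f) ->
  exists s, (0 < size s)%N /\ forall f, P f -> `|avg s f - mean f| <= e *+ 2 /\
    forall x, `|avg s (fun a => f (x * a)%g) - avg s f| <= e.
Proof.
move=> e0 nP.
have [s ns] := rnet_ex R cG nP; exists s; split=> [|f Pf]; first by case: ns.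
have o : osc [set v | forall f, P f -> osc [set v] e f] e f.
  by apply: osc_set => v /(_ f Pf).
split; first exact: mean_rnet o ns.
by move=> x; case: ns => _; apply; exact: o.1.
Qed.

Lemma mean_approx3 f g h e : continuous f -> continuous g -> continuous h -> 0 < e ->
  exists s, [/\ (0 < size s)%N, `|avg s f - mean f| <= e,
    `|avg s g - mean g| <= e & `|avg s h - mean h| <= e].
Proof.
move=> cf cg ch e0; have e2 : 0 < e / 2 by rewrite divr_gt0.
have [||s [s0 hs]] := @mean_approx [set k | [\/ k = f, k = g | k = h]] (e / 2) => //.
  apply: filterS (filterI (near_osc cf e2)
    (filterI (near_osc cg e2) (near_osc ch e2))).
  by move=> v [vf [vg vh]] k [->|->|->].
have E : (e / 2) *+ 2 = e by rewrite -mulr_natr divfK// pnatr_eq0.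
exists s; split => //; rewrite -E; apply hs;
  [exact: Or31|exact: Or32|exact: Or33].
Qed.

(** Left nets compute the same mean as right nets; this is how the mean becomes right invariant
    too. *)
Lemma mean_lnet V s e f : continuous f -> losc V e f -> lnet V s ->
  `|avg s f - mean f| <= e.
Proof.
move=> cf oV nVs; apply/ler_addgt0Pr => d d0.
have d3 : 0 < d / 3 by rewrite divr_gt0.
have nW := near_osc cf d3.
have [t nWt] := rnet_ex R cG nW.
have oW : osc [set v | osc [set v] (d / 3) f] (d / 3) f by apply: osc_set.
have h1 := mean_rnet nW oW nWt.
have h2 := rlnet_close nWt nVs oW.1 oV.
move: h1 h2; rewrite !ler_norml => /andP[? ?] /andP[? ?]; apply/andP; split; lra.
Qed.

Let eq_eps (a b : R) : (forall e, 0 < e -> `|a - b| <= e) -> a = b.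
Proof.
move=> h; apply/eqP; rewrite -subr_eq0 -normr_le0; apply/ler_addgt0Pr => e e0.
by rewrite add0r; exact: h.
Qed.

Let le_eps (a b : R) : (forall e, 0 < e -> a <= b + e) -> a <= b.
Proof. by move=> h; apply/ler_addgt0Pr. Qed.

Lemma meanD f g : continuous f -> continuous g ->
  mean (fun x => f x + g x) = mean f + mean g.
Proof.
move=> cf cg; apply: eq_eps => e e0.
have e3 : 0 < e / 3 by rewrite divr_gt0.
have [s [_ + + +]] := mean_approx3 cf cg (cts_add cf cg) e3; rewrite avgD.
rewrite !ler_norml => /andP[? ?] /andP[? ?] /andP[? ?]; apply/andP; split; lra.
Qed.

Lemma meanZ c f : continuous f -> mean (fun x => c * f x) = c * mean f.
Proof.
move=> cf; apply: eq_eps => e e0.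
have d0 : 0 < `|c| + 1 by rewrite ltr_wpDl.
have e3 : 0 < e / 2 / (`|c| + 1) by rewrite !divr_gt0.
have ccf : continuous (fun x => c * f x) by apply: cts_mul => //; exact: ctsC.
have [s [_ h _ h']] := mean_approx3 cf cf ccf e3.
rewrite avgZ in h'.
rewrite (_ : _ - _ = c * (avg s f - mean f) - (c * avg s f - mean (fun x => c * f x)));
  last by ring.
apply: le_trans (ler_normB _ _) _; rewrite normrM.
apply: le_trans (lerD (ler_wpM2l (normr_ge0 c) h) h') _.
rewrite -[X in _ + X]mul1r -mulrDl mulrC divfK ?gt_eqF//; lra.
Qed.

Lemma mean_cst c : mean (fun=> c) = c.
Proof.
apply: eq_eps => e e0.
have [s [s0 + _ _]] := mean_approx3 (@ctsC G R c) (@ctsC G R c) (@ctsC G R c) e0.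
by rewrite avg_cst// distrC.
Qed.

Lemma meanB f g : continuous f -> continuous g ->
  mean (fun x => f x - g x) = mean f - mean g.
Proof.
move=> cf cg; have cg' : continuous (fun x => -1 * g x).
  by apply: cts_mul => //; exact: ctsC.
rewrite -mulN1r -meanZ// -meanD//; congr mean.
by apply/funext => x; rewrite mulN1r.
Qed.

Lemma le_mean f g : continuous f -> continuous g -> (forall x, f x <= g x) ->
  mean f <= mean g.
Proof.
move=> cf cg fg; apply: le_eps => e e0.
have e3 : 0 < e / 2 by rewrite divr_gt0.
have [s [_ + + _]] := mean_approx3 cf cg cg e3; have := le_avg s fg.
rewrite !ler_norml => ? /andP[? ?] /andP[? ?]; lra.
Qed.

Lemma mean_ge0 f : continuous f -> (forall x, 0 <= f x) -> 0 <= mean f.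
Proof. by move=> cf f0; rewrite -(mean_cst 0); apply: le_mean => //; exact: ctsC. Qed.

Lemma mean_close f g e : continuous f -> continuous g ->
  (forall x, `|f x - g x| <= e) -> `|mean f - mean g| <= e.
Proof.
move=> cf cg fg; rewrite -meanB// ler_norml -{1}(mean_cst (- e)) -{2}(mean_cst e).
have := cts_sub cf cg => cfg.
by apply/andP; split; (apply: le_mean; rewrite //; try exact: ctsC) => x;
  have := fg x; rewrite ler_norml => /andP[].
Qed.

Lemma mean_sum (I : Type) (r : seq I) (F : I -> G -> R) :
  (forall i, continuous (F i)) ->
  mean (fun x => \sum_(i <- r) F i x) = \sum_(i <- r) mean (F i).
Proof.
move=> cF; elim: r => [|i r IH].
  by rewrite big_nil -[RHS](mean_cst 0); congr mean; apply/funext => x; rewrite big_nil.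
rewrite big_cons -IH -meanD//; last exact: cts_sum.
by congr mean; apply/funext => x; rewrite big_cons.
Qed.

Lemma cts_ltrans f a : continuous f -> continuous (fun x => f (a * x)%g).
Proof.
by move=> cf; apply: cts_comp cf; apply: cts_mulg; [exact: ctsC|exact: cts_id].
Qed.

Lemma cts_rtrans f a : continuous f -> continuous (fun x => f (x * a)%g).
Proof.
by move=> cf; apply: cts_comp cf; apply: cts_mulg; [exact: cts_id|exact: ctsC].
Qed.

Lemma mean_ltrans f a : continuous f -> mean (fun x => f (a * x)%g) = mean f.
Proof.
move=> cf; have cf' := @cts_ltrans _ a cf; apply: eq_eps => e e0.
have e3 : 0 < e / 5 by rewrite divr_gt0.
have [|s [s0 hs]] := @mean_approx [set k | k = f \/ k = fun x => f (a * x)%g] _ e3.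
  apply: filterS (filterI (near_osc cf e3) (near_osc cf' e3)).
  by move=> v [h1 h2] k [->|->].
have [+ /(_ a)] := hs f (or_introl erefl).
have [+ _] := hs _ (or_intror erefl).
rewrite !ler_norml => /andP[? ?] /andP[? ?] /andP[? ?]; apply/andP; split; lra.
Qed.

Lemma mean_rtrans f a : continuous f -> mean (fun x => f (x * a)%g) = mean f.
Proof.
move=> cf; have cf' := @cts_rtrans _ a cf; apply: eq_eps => e e0.
have e3 : 0 < e / 3 by rewrite divr_gt0.
pose W := [set v | losc [set v] (e / 3) f /\ losc [set v] (e / 3) (fun x => f (x * a)%g)].
have nW : nbhs 1%g W by apply: filterI; exact: near_losc.
have [t nWt] := lnet_ex R cG nW.
have o1 : losc W (e / 3) f by move=> x v [+ _]; apply.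
have o2 : losc W (e / 3) (fun x => f (x * a)%g) by move=> x v [_]; apply.
have := mean_lnet cf o1 nWt; have := mean_lnet cf' o2 nWt.
have := nWt.2 f _ o1 a.
rewrite !ler_norml => /andP[? ?] /andP[? ?] /andP[? ?]; apply/andP; split; lra.
Qed.

(** By compactness a finite sum of left translates of [f] is at least [c] everywhere, and every
    translate has the mean of [f]. *)
Lemma mean_gt0 f x0 : continuous f -> (forall x, 0 <= f x) -> 0 < f x0 ->
  0 < mean f.
Proof.
move=> cf f0 fx0; pose c := f x0 / 2.
have c0 : 0 < c by rewrite divr_gt0.
have [|s hs] := @compact_finite_net _ cG (fun a => [set x | c < f (x0 * a^-1 * x)%g]).
  move=> a; have /ctsP/(_ a c c0) := @cts_ltrans _ (x0 * a^-1)%g cf.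
  apply: filterS => y /=; rewrite mulgVK ltr_norml => /andP[? _].
  have -> : c = f x0 - c by rewrite /c; field.
  lra.
pose S x := \sum_(a <- s) f (x0 * a^-1 * x)%g.
have cS : continuous S by apply: cts_sum => a; exact: cts_ltrans.
have : c <= mean S.
  rewrite -(mean_cst c); apply: le_mean => //; first exact: ctsC.
  move=> x; have [a sa /= /ltW ca] := hs x; apply: le_trans ca _.
  by rewrite /S (big_rem a)//= lerDl sumr_ge0.
rewrite /S mean_sum; last by move=> a; exact: cts_ltrans.
under eq_bigr do rewrite mean_ltrans//.
move=> h; rewrite lt_neqAle mean_ge0// andbT; apply/eqP => m0.
move: h; rewrite -m0 big1// leNgt => /negP; exact.
Qed.

Lemma mean_sqr_eq0 f : continuous f -> mean (fun x => f x * f x) = 0 -> forall x, f x = 0.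
Proof.
move=> cf m0 x; apply/eqP; apply/negP => /negP fx.
have : 0 < mean (fun x => f x * f x).
  apply: (@mean_gt0 _ x); first exact: cts_mul.
    by move=> y; rewrite -expr2 sqr_ge0.
  by rewrite -expr2 exprn_even_gt0.
by rewrite m0 ltxx.
Qed.

(** * Means depending on a parameter *)

Section ParametricMean.
Variables (T : topologicalType) (F : T -> G -> R).
Hypothesis cF : continuous (fun p : T * G => F p.1 p.2).

Lemma cts_param t : continuous (F t).
Proof.
have -> : F t = (fun p : T * G => F p.1 p.2) \o (fun x => (t, x)) by [].
by apply: cts_comp cF; apply: cts_pair; [exact: ctsC|exact: cts_id].
Qed.

Lemma near_param t e : 0 < e ->
  \forall t' \near t, forall x, `|F t' x - F t x| < e.
Proof.
move=> e0; apply: (@compact_near_all _ cG _ (nbhs t)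
  (fun t' x => `|F t' x - F t x| < e)) => x.
pose h (p : G * T) := F p.2 p.1 - F t p.1.
have ch : continuous h.
  apply: cts_sub; last exact: (@cts_comp _ _ _ fst (F t) (@cts_fst _ _) (@cts_param t)).
  have -> : (fun p : G * T => F p.2 p.1) = (fun p : T * G => F p.1 p.2) \o
    (fun p => (p.2, p.1)) by [].
  by apply: cts_comp cF; apply: cts_pair; [exact: cts_snd|exact: cts_fst].
have /ctsP/(_ (x, t) e e0) := ch; apply: filterS => -[y t'] /=.
by rewrite /h /= subrr subr0.
Qed.

Lemma cts_mean_param : continuous (fun t => mean (F t)).
Proof.
apply/ctsP => t e e0; have e2 : 0 < e / 2 by rewrite divr_gt0.
apply: filterS (near_param t e2) => t' h.
apply: le_lt_trans (_ : e / 2 < e); last by rewrite ltr_pdivrMr// ltr_pMr// ltr1n.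
by apply: mean_close => [||x]; [exact: cts_param|exact: cts_param|exact: ltW].
Qed.

End ParametricMean.

Lemma mean_fubini (F : G -> G -> R) : continuous (fun p : G * G => F p.1 p.2) ->
  mean (fun x => mean (F x)) = mean (fun y => mean (fun x => F x y)).
Proof.
move=> cF; pose F' y x := F x y.
have cF' : continuous (fun p : G * G => F' p.1 p.2).
  have -> : (fun p : G * G => F' p.1 p.2) = (fun p : G * G => F p.1 p.2) \o
    (fun p => (p.2, p.1)) by [].
  by apply: cts_comp cF; apply: cts_pair; [exact: cts_snd|exact: cts_fst].
have oscF (H : G -> G -> R) (e : R) : continuous (fun p : G * G => H p.1 p.2) ->
    0 < e -> \forall v \near 1%g, forall x, osc [set v] e (H x).
  move=> cH e0; have cGG : compact [set: G * G].
    by rewrite -setXTT; exact: compact_setX.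
  have c2 : continuous (fun p : (G * G) * G => H p.1.1 p.1.2).
    by apply: cts_comp cH; exact: cts_fst.
  have c11 : continuous (fun p : (G * G) * G => p.1.1).
    by apply: (@cts_comp _ (G * G)%type) => //; exact: cts_fst.
  have c12 : continuous (fun p : (G * G) * G => p.1.2).
    by apply: (@cts_comp _ (G * G)%type); [exact: cts_fst|exact: cts_snd].
  have c1 (m : G -> G -> G) : continuous (fun p : G * G => m p.1 p.2) ->
      continuous (fun p : (G * G) * G => H p.1.1 (m p.1.2 p.2)).
    move=> cm; have -> : (fun p : (G * G) * G => H p.1.1 (m p.1.2 p.2)) =
      (fun p : G * G => H p.1 p.2) \o (fun p => (p.1.1, m p.1.2 p.2)) by [].
    apply: cts_comp cH; apply: cts_pair => //.
    have -> : (fun p : (G * G) * G => m p.1.2 p.2) =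
      (fun p : G * G => m p.1 p.2) \o (fun p => (p.1.2, p.2)) by [].
    by apply: cts_comp cm; apply: cts_pair => //; exact: cts_snd.
  have h1 := @near1_small _ (fun p v => H p.1 (p.2 * v)%g - H p.1 p.2) e cGG.
  have h2 := @near1_small _ (fun p v => H p.1 (v * p.2)%g - H p.1 p.2) e cGG.
  have {}h1 := h1 (cts_sub (c1 _ (@mulg_continuous G)) c2) (fun _ => _) e0.
  have {}h2 := h2 (cts_sub (c1 (fun a b => b * a)%g _) c2) (fun _ => _) e0.
  near=> v => x; split=> y _ ->.
  - have /(_ (x, y)) : forall t : G * G, `|H t.1 (t.2 * v)%g - H t.1 t.2| <= e.
      by near: v; apply: h1 => p; rewrite mulg1 subrr.
    by [].
  - have /(_ (x, y)) : forall t : G * G, `|H t.1 (v * t.2)%g - H t.1 t.2| <= e.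
      near: v; apply: h2 => [|p]; last by rewrite mul1g subrr.
      by apply: cts_mulg; [exact: cts_snd|exact: cts_fst].
    by [].
have cm := cts_mean_param cF; have cm' := cts_mean_param cF'.
apply: eq_eps => e e0; have e8 : 0 < e / 8 by rewrite divr_gt0.
(* One finite set approximates the means of all slices and of both partial means; for averages over
   it the exchange is [avg_exch]. The four errors are at most [e / 4] each. *)
pose P : set (G -> R) := [set f | [\/ exists x, f = F x, exists y, f = F' y,
  f = (fun x => mean (F x)) | f = (fun y => mean (F' y))]].
have [|s [s0 hs]] := @mean_approx P _ e8.
  apply: filterS (filterI (filterI (oscF F _ cF e8) (oscF F' _ cF' e8))
    (filterI (near_osc cm e8) (near_osc cm' e8))).
  by move=> v [[h1 h2] [h3 h4]] f [[x ->]|[y ->]|->|->].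
have hF x : `|avg s (F x) - mean (F x)| <= (e / 8) *+ 2.
  by apply hs; apply: Or41; exists x.
have hF' x : `|avg s (F' x) - mean (F' x)| <= (e / 8) *+ 2.
  by apply hs; apply: Or42; exists x.
have := avg_close s0 hF; have := avg_close s0 hF'.
have [+ _] := hs _ (Or43 _ _ _ erefl); have [+ _] := hs _ (Or44 _ _ _ erefl).
rewrite avg_exch -/(F' _) !ler_norml => /andP[? ?] /andP[? ?] /andP[? ?] /andP[? ?].
by apply/andP; split; lra.
Unshelve. all: by end_near. Qed.

End Mean.

(** * Convolution operators *)

Section PeterWeyl.
Variables (R : realType) (G : topologicalGroupType).
Hypothesis cG : compact [set: G].
Implicit Types (f g h u : G -> R) (x y : G).
Local Notation mean := (@mean R G).

Definition ip f g := mean (fun x => f x * g x).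

Lemma ipC f g : ip f g = ip g f.
Proof. by congr mean; apply/funext => x; rewrite mulrC. Qed.

Lemma ipZl c f g : continuous f -> continuous g ->
  ip (fun x => c * f x) g = c * ip f g.
Proof.
move=> cf cg; rewrite /ip -(meanZ cG); last exact: cts_mul.
by congr mean; apply/funext => x; rewrite mulrA.
Qed.

Lemma cts_scale c f : continuous f -> continuous (fun x => c * f x).
Proof. by move=> cf; apply: cts_mul => //; exact: ctsC. Qed.

Lemma ipBl f g h : continuous f -> continuous g -> continuous h ->
  ip (fun x => f x - g x) h = ip f h - ip g h.
Proof.
move=> cf cg ch; rewrite /ip -(meanB cG); [|exact: cts_mul|exact: cts_mul].
by congr mean; apply/funext => x; rewrite mulrBl.
Qed.

Lemma ip_suml (m : nat) (c : nat -> R) (u : nat -> G -> R) h :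
  (forall i, continuous (u i)) -> continuous h ->
  ip (fun x => \sum_(i < m) c i * u i x) h = \sum_(i < m) c i * ip (u i) h.
Proof.
move=> cu ch; rewrite /ip.
under [in RHS]eq_bigr => i _ do rewrite -(meanZ cG _ (cts_mul (cu i) ch)).
rewrite -(mean_sum cG); last by move=> i; apply: cts_scale; exact: cts_mul.
congr mean; apply/funext => x; rewrite mulr_suml; apply: eq_bigr => i _.
by rewrite mulrA.
Qed.

Lemma ip_ge0 f : continuous f -> 0 <= ip f f.
Proof.
by move=> cf; apply: (mean_ge0 cG); [exact: cts_mul|move=> x; rewrite -expr2 sqr_ge0].
Qed.

Lemma ip_le f (e : R) : continuous f -> 0 <= e -> (forall x, `|f x| <= e) -> ip f f <= e ^+ 2.
Proof.
move=> cf e0 fe; rewrite -(mean_cst cG (e ^+ 2)); apply: (le_mean cG).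
- exact: cts_mul.
- exact: ctsC.
- by move=> x; rewrite -expr2 -real_normK ?num_real// lerXn2r ?nnegrE.
Qed.

Lemma ip_gt0 f x : continuous f -> f x != 0 -> 0 < ip f f.
Proof.
move=> cf fx; rewrite lt_neqAle ip_ge0// andbT eq_sym; apply/eqP.
by move=> /(mean_sqr_eq0 cG cf)/(_ x) /eqP; rewrite (negPf fx).
Qed.

Lemma ip_cauchy_schwarz f g : continuous f -> continuous g ->
  ip f g ^+ 2 <= ip f f * ip g g.
Proof.
move=> cf cg; have [g0|g0] := eqVneq (ip g g) 0.
  have : ip f g = 0.
    rewrite -(mean_cst cG 0); congr mean; apply/funext => x.
    by rewrite (mean_sqr_eq0 cG cg g0) mulr0.
  by move=> ->; rewrite expr0n g0 mulr0.
have gg : 0 < ip g g by rewrite lt_neqAle eq_sym g0 ip_ge0.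
(* The inequality comes from expanding the square norm of [a * f - b * g]. *)
pose a := ip g g; pose b := ip f g.
have cag : continuous (fun x => a * f x) by exact: cts_scale.
have cbg : continuous (fun x => b * g x) by exact: cts_scale.
have := ip_ge0 (cts_sub cag cbg).
rewrite ipBl//; last exact: cts_sub.
rewrite !ipZl//; [|exact: cts_sub|exact: cts_sub].
rewrite ![ip _ (fun x => _ - _)]ipC !ipBl// !ipZl// (ipC g f) -/a -/b => h.
have : 0 <= a * (ip f f * a - b ^+ 2) by lra.
by rewrite pmulr_rge0// subr_ge0.
Qed.

(** The left regular representation; the inverse makes it multiplicative in [a]. *)
Definition ltr (a : G) f : G -> R := fun x => f (a^-1 * x)%g.

Lemma cts_ltr a f : continuous f -> continuous (ltr a f).
Proof. exact: cts_ltrans. Qed.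

Lemma ip_ltr a f g : continuous f -> continuous g -> ip (ltr a f) (ltr a g) = ip f g.
Proof.
move=> cf cg; rewrite /ip -(mean_ltrans cG a^-1%g (cts_mul cf cg)).
by congr mean; apply/funext => x.
Qed.

Lemma ip_ltr_adj a f g : continuous f -> continuous g ->
  ip (ltr a f) g = ip f (ltr a^-1%g g).
Proof.
move=> cf cg; rewrite -(ip_ltr a cf (@cts_ltr _ _ cg)); congr ip.
by apply/funext => x; rewrite /ltr invgK mulVKg.
Qed.

Lemma ltrM a b f : ltr (a * b)%g f = ltr a (ltr b f).
Proof. by apply/funext => x; rewrite /ltr invgM mulgA. Qed.

(** * Convolution with an even kernel *)

Section Convolution.
Variable k : G -> R.
Hypothesis ck : continuous k.
Hypothesis kV : forall x, k x^-1%g = k x.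

(** The kernel depends only on [x^-1 * y], so the operator commutes with left translations; [kV]
    makes it symmetric. *)
Definition conv f : G -> R := fun x => mean (fun y => k (x^-1 * y)%g * f y).

Let cker : continuous (fun p : G * G => k (p.1^-1 * p.2)%g).
Proof.
apply: cts_comp ck; apply: cts_mulg; last exact: cts_snd.
by apply: cts_invg; exact: cts_fst.
Qed.

Let cFf f : continuous f -> continuous (fun p : G * G => k (p.1^-1 * p.2)%g * f p.2).
Proof.
by move=> cf; apply: cts_mul => //; apply: cts_comp cf; exact: cts_snd.
Qed.

Lemma cts_conv f : continuous f -> continuous (conv f).
Proof. by move=> cf; apply: (cts_mean_param cG); exact: cFf. Qed.

Let ckx x : continuous (ltr x k).
Proof. exact: cts_ltr. Qed.

Lemma convE f x : conv f x = ip (ltr x k) f.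
Proof. by []. Qed.

Lemma convB f g : continuous f -> continuous g ->
  conv (fun x => f x - g x) = fun x => conv f x - conv g x.
Proof.
by move=> cf cg; apply/funext => x; rewrite !convE ![ip (ltr x k) _]ipC ipBl.
Qed.

Lemma convZ c f : continuous f -> conv (fun x => c * f x) = fun x => c * conv f x.
Proof.
by move=> cf; apply/funext => x; rewrite !convE ![ip (ltr x k) _]ipC ipZl.
Qed.

Lemma conv_adj f g : continuous f -> continuous g -> ip (conv f) g = ip f (conv g).
Proof.
move=> cf cg; pose F x y := k (x^-1 * y)%g * f y * g x.
have cF : continuous (fun p : G * G => F p.1 p.2).
  by apply: cts_mul; [exact: cFf|apply: cts_comp cg; exact: cts_fst].
transitivity (mean (fun x => mean (F x))).
  congr mean; apply/funext => x; rewrite mulrC /conv -(meanZ cG); last first.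
    by apply: cts_mul => //; exact: ckx.
  by congr mean; apply/funext => y; rewrite /F mulrC.
rewrite (mean_fubini cG cF); congr mean; apply/funext => y.
rewrite /conv -(meanZ cG); last by apply: cts_mul => //; exact: ckx.
congr mean; apply/funext => x; rewrite /F -kV invgM invgK; ring.
Qed.

Lemma conv_ltr a f : continuous f -> conv (ltr a f) = ltr a (conv f).
Proof.
move=> cf; apply/funext => x; rewrite /ltr /conv.
have cc : continuous (fun y => k ((a^-1 * x)^-1 * y)%g * f y).
  by apply: cts_mul => //; exact: ckx.
rewrite -(mean_ltrans cG a^-1%g cc); congr mean; apply/funext => y.
by rewrite invgM invgK -mulgA mulVKg.
Qed.

(** The squared Hilbert-Schmidt norm of [conv]: by invariance every row [ltr x k] of the kernel has
    this squared norm. *)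
Definition kk := ip k k.

Lemma kk_ge0 : 0 <= kk. Proof. exact: ip_ge0. Qed.

Lemma conv_bound f x : continuous f -> conv f x ^+ 2 <= kk * ip f f.
Proof.
move=> cf; rewrite convE; apply: le_trans (ip_cauchy_schwarz (@ckx x) cf) _.
by rewrite ip_ltr.
Qed.

Let sqr_le (t b : R) : 0 <= b -> t ^+ 2 <= b ^+ 2 -> `|t| <= b.
Proof.
by move=> b0; rewrite -[t ^+ 2]real_normK ?num_real// ler_pXn2r ?nnegrE.
Qed.

Lemma conv_sup f e x : continuous f -> 0 <= e -> (forall y, `|f y| <= e) ->
  `|conv f x| <= (kk + 1) * e.
Proof.
move=> cf e0 fe; have k0 := kk_ge0.
apply: sqr_le; first by rewrite mulr_ge0// addr_ge0.
apply: le_trans (conv_bound x cf) _; rewrite exprMn.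
apply: ler_pM => //; [exact: ip_ge0|nra|exact: ip_le].
Qed.

(** The image of the unit ball is equicontinuous; with [conv_bound] this replaces compactness of the
    operator on a completed Hilbert space. *)
Lemma conv_equicontinuous x (e : R) : 0 < e -> \forall x' \near x,
  forall f, continuous f -> ip f f <= 1 -> `|conv f x' - conv f x| <= e.
Proof.
move=> e0; have := near_param cG (F := fun x y => k (x^-1 * y)%g) cker x e0.
apply: filterS => x' h f cf f1.
have cd : continuous (fun y => ltr x' k y - ltr x k y) by exact: cts_sub.
rewrite !convE -ipBl//.
apply: sqr_le; first exact: ltW.
apply: le_trans (ip_cauchy_schwarz cd cf) _.
rewrite -[leRHS]mulr1; apply: ler_pM => //; try exact: ip_ge0.
by apply: ip_le => //; [exact: ltW|move=> y; apply: ltW; exact: h].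
Qed.

(** * Existence of an eigenfunction *)

Section Eigenfunction.
Variable L : set (G -> R).
Hypothesis Lc : forall f, L f -> continuous f.
Hypothesis LZ : forall c f, L f -> L (fun x => c * f x).
Hypothesis Lconv : forall f, L f -> L (conv f).
Hypothesis Lclosed : forall f, continuous f ->
  (forall e, 0 < e -> exists2 g, L g & forall x, `|g x - f x| <= e) -> L f.

Let B : set (G -> R) := [set f | L f /\ ip f f <= 1].
Let energy f := ip (conv f) (conv f).
(** The squared norm of [conv] on [L]. Its square is used because it is positive, with top
    eigenvalue [lam], whereas [conv] might only have the eigenvalue minus the root of [lam]. *)
Let lam := sup [set energy f | f in B].

(* A maximizer of the energy on the unit ball of [L], obtained as a limit of
   [conv f] along an ultrafilter of almost maximizing [f]. *)
Lemma conv_eigenfunction f0 x0 : L f0 -> conv f0 x0 != 0 ->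
  exists l h, [/\ 0 < l, L h, exists x, h x != 0 &
    conv (conv h) = fun x => l * h x].
Proof.
move=> Lf0 f0x0; have cf0 := Lc Lf0.
have energy_kk f : L f -> energy f <= kk * ip f f.
  move=> Lf; rewrite -(mean_cst cG (kk * ip f f)); apply: (le_mean cG).
  - by apply: cts_mul; exact: cts_conv (Lc Lf).
  - exact: ctsC.
  - by move=> x; rewrite -expr2; exact: conv_bound (Lc Lf).
have energy_lam f : B f -> energy f <= lam.
  move=> Bf; apply: ub_le_sup; last by exists f.
  exists kk => _ [g [Lg g1] <-]; apply: le_trans (energy_kk g Lg) _.
  by rewrite ler_piMr// kk_ge0.
have energyZ c f : L f -> energy (fun x => c * f x) = c ^+ 2 * energy f.
  move=> Lf; have cf := Lc Lf; have cTf := cts_conv cf.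
  rewrite /energy convZ// ipZl//; last exact: cts_scale.
  by rewrite ipC ipZl// mulrA expr2.
have normalize f : L f -> 0 < ip f f -> exists2 c, 0 < c &
    B (fun x => c * f x) /\ c ^+ 2 * ip f f = 1.
  move=> Lf f1; have cf := Lc Lf.
  have E : (Num.sqrt (ip f f))^-1 ^+ 2 * ip f f = 1.
    by rewrite exprVn sqr_sqrtr ?ltW// mulVf// gt_eqF.
  exists (Num.sqrt (ip f f))^-1; first by rewrite invr_gt0 sqrtr_gt0.
  split => //; split; first exact: LZ.
  rewrite ipZl//; last exact: cts_scale.
  by rewrite ipC ipZl// mulrA -expr2 E.
have energy_le f : L f -> energy f <= lam * ip f f.
  move=> Lf; have [f1|f1] := ltP 0 (ip f f).
    have [c c0 [Bc E]] := normalize f Lf f1.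
    have := energy_lam _ Bc; rewrite energyZ// => h.
    rewrite -(ler_pM2l (exprn_gt0 2 c0)); apply: le_trans h _.
    by rewrite mulrCA E mulr1.
  have -> : ip f f = 0 by apply/eqP; rewrite eq_le f1 ip_ge0//; exact: Lc.
  rewrite mulr0; apply: le_trans (energy_kk f Lf) _.
  by rewrite mulr_ge0_le0// kk_ge0.
have lam0 : 0 < lam.
  have cT0 := cts_conv cf0; have e0 := ip_gt0 cT0 f0x0.
  have [c c0 [Bc _]] : exists2 c, 0 < c &
      B (fun x => c * f0 x) /\ c ^+ 2 * ip f0 f0 = 1.
    apply: normalize => //; rewrite lt_neqAle ip_ge0// andbT eq_sym.
    apply/eqP => f00; have := energy_kk f0 Lf0.
    by rewrite f00 mulr0 leNgt e0.
  apply: lt_le_trans (energy_lam _ Bc); rewrite energyZ//.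
  by rewrite mulr_gt0// exprn_gt0.
(* Expanding the square and bounding the first term by [lam * energy f] shows that almost maximizers
   are almost eigenfunctions. *)
have residual f : B f -> ip (fun x => conv (conv f) x - lam * f x)
    (fun x => conv (conv f) x - lam * f x) <= lam * (lam - energy f).
  move=> [Lf f1]; have cf := Lc Lf; have c1 := cts_conv cf; have c2 := cts_conv c1.
  have clf : continuous (fun x => lam * f x) by exact: cts_scale.
  have cr : continuous (fun x => conv (conv f) x - lam * f x) by exact: cts_sub.
  rewrite ipBl// ipZl// ![ip _ (fun x => _ - _)]ipC !ipBl// !ipZl//.
  have -> : ip f (conv (conv f)) = energy f by rewrite -conv_adj.
  have -> : ip (conv (conv f)) f = energy f by rewrite conv_adj.
  have h : ip (conv (conv f)) (conv (conv f)) <= lam * energy f.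
    exact: energy_le (Lconv Lf).
  have : lam * (lam * ip f f) <= lam * (lam * 1) by rewrite !ler_pM2l.
  lra.
pose F : set_system (G -> R) := filter_from [set e : R | 0 < e]
  (fun e => [set f | B f /\ lam - e < energy f]).
have PF : ProperFilter F.
  apply: filter_from_proper; last first.
    move=> e e0; have hs : has_sup [set energy f | f in B].
      split; last by exists lam => _ [f Bf <-]; exact: energy_lam.
      exists (energy (fun x => 0 * f0 x)), (fun x => 0 * f0 x) => //.
      split; first exact: LZ.
      rewrite ipZl//; last exact: cts_scale.
      by rewrite mul0r.
    by have [_ [f Bf <-] fe] := sup_adherent e0 hs; exists f.
  apply: filter_from_filter; first by exists 1 => /=.
  move=> d e d0 e0; exists (Num.min d e); first by rewrite /= lt_min d0.
  move=> f [Bf fde]; split; split => //; apply: le_lt_trans fde;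
    by rewrite lerD2l lerN2 ge_min lexx ?orbT.
have [U [ultraU FU]] := ultraFilterLemma PF.
have UB e : 0 < e -> \forall f \near U, B f /\ lam - e < energy f.
  by move=> e0; apply: FU; exists e.
(* The values [conv f x] stay in a compact interval, so they converge along the ultrafilter. *)
have limU x : exists l : R, forall e, 0 < e -> \forall f \near U, `|conv f x - l| < e.
  have [] := @segment_compact R (- (kk + 1)) (kk + 1) (conv^~ x @ U) _ _.
    apply: filterS (UB _ lam0) => f [[Lf f1] _] /=.
    rewrite in_itv /= -ler_norml; apply: sqr_le; first by rewrite addr_ge0 ?kk_ge0.
    apply: le_trans (conv_bound x (Lc Lf)) _; have := kk_ge0; nra.
  move=> l [_ cl]; exists l => e e0.
  have [//|nU] := in_ultra_setVsetC [set f | `|conv f x - l| < e] ultraU.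
  have [||r []] := cl [set r | ~ (`|r - l| < e)] [set r | `|r - l| < e].
  - exact: nU.
  - by apply: filterS (@nbhsx_ballx _ _ l e e0) => r; rewrite /ball /= distrC.
  - by [].
have [h hU] := choice limU.
have ch : continuous h.
  apply/ctsP => x e e0; have e4 : 0 < e / 4 by rewrite divr_gt0.
  apply: filterS (conv_equicontinuous x e4) => x' eq.
  have [f [[[[Lf f1] _] fx] fx']] := filter_ex (filterI (filterI (UB _ lam0)
    (hU x _ e4)) (hU x' _ e4)).
  have := eq f (Lc Lf) f1; move: fx fx'; rewrite !ler_norml !ltr_norml.
  by move=> /andP[? ?] /andP[? ?] /andP[? ?]; apply/andP; split; lra.
(* Equicontinuity upgrades pointwise convergence along [U] to uniform convergence. *)
have hU_unif (e : R) : 0 < e -> \forall f \near U, forall x, `|conv f x - h x| <= e.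
  move=> e0; have e4 : 0 < e / 4 by rewrite divr_gt0.
  apply: (@compact_near_all _ cG _ U (fun f x => `|conv f x - h x| <= e)) => x.
  exists ([set x' | (forall f, continuous f -> ip f f <= 1 ->
    `|conv f x' - conv f x| <= e / 4) /\ `|h x' - h x| < e / 4],
    [set f | (B f /\ lam - lam < energy f) /\ `|conv f x - h x| < e / 4]) => /=.
    split; apply: filterI; [exact: conv_equicontinuous| |exact: UB|exact: hU].
    by move/ctsP : ch => /(_ x _ e4).
  move=> [x' f] /= [[eq hx] [[[Lf f1] _] fx]].
  have := eq f (Lc Lf) f1; move: hx fx; rewrite !ler_norml !ltr_norml.
  by move=> /andP[? ?] /andP[? ?] /andP[? ?]; apply/andP; split; lra.
exists lam, h; split => //.
- apply: Lclosed => // e e0.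
  have [f [[[Lf _] _] fh]] := filter_ex (filterI (UB _ lam0) (hU_unif e e0)).
  by exists (conv f) => //; exact: Lconv.
- apply/not_existsP => h0.
  have h0' x : h x = 0 by apply/eqP/negPn/negP; exact: h0.
  (* Since [d <= 1] and [d <= lam / 2], a function [conv f] bounded by [d] has energy at most
     [lam / 2], too little for an almost maximizer. *)
  pose d := lam / (2 * (lam + 1)).
  have d0 : 0 < d by rewrite divr_gt0// mulr_gt0// addr_gt0.
  have l2 : 0 < lam / 2 by rewrite divr_gt0.
  have [f [[[Lf f1] fe] fh]] := filter_ex (filterI (UB _ l2) (hU_unif d d0)).
  have : energy f <= d ^+ 2.
    apply: ip_le; [exact: cts_conv (Lc Lf)|exact: ltW|].
    by move=> x; have := fh x; rewrite h0' subr0.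
  apply/negP; rewrite -ltNge; apply: le_lt_trans fe.
  have d1 : d <= 1.
    by rewrite /d ler_pdivrMr ?mulr_gt0 ?addr_gt0//; lra.
  have d2 : d <= lam / 2.
    rewrite /d ler_pdivrMr ?mulr_gt0 ?addr_gt0//.
    have := sqr_ge0 lam; nra.
  nra.
- apply/funext => x; apply/eqP; rewrite -subr_eq0 -normr_le0.
  apply/ler_addgt0Pr => e e0; rewrite add0r.
  have k0 := kk_ge0; set K := kk + 1.
  have K0 : 0 < K by rewrite /K; lra.
  (* [d] controls the errors from replacing [conv f] by [h], and [b] the convolution of the residual
     of [f]. *)
  pose d := e / 3 / (K ^+ 2 + lam + 1).
  have D0 : 0 < K ^+ 2 + lam + 1 by rewrite !addr_gt0// exprn_gt0.
  have d0 : 0 < d by rewrite !divr_gt0.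
  have dE : d * (K ^+ 2 + lam + 1) = e / 3 by rewrite /d divfK// gt_eqF.
  pose b := (e / 3) ^+ 2 / (K * lam).
  have b0 : 0 < b by rewrite divr_gt0// ?exprn_gt0 ?divr_gt0// mulr_gt0.
  have [f [[[Lf f1] fe] fh]] := filter_ex (filterI (UB _ b0) (hU_unif d d0)).
  have cf := Lc Lf; have c1 := cts_conv cf; have c2 := cts_conv c1.
  have cTh := cts_conv ch.
  have h1 : `|conv (conv (fun z => conv f z - h z)) x| <= K * (K * d).
    apply: conv_sup; [|by rewrite mulr_ge0// ltW|].
      by apply: cts_conv; exact: cts_sub.
    by move=> y; apply: conv_sup; [exact: cts_sub|exact: ltW|].
  have h2 : `|conv (fun y => conv (conv f) y - lam * f y) x| <= e / 3.
    have clf : continuous (fun x => lam * f x) by exact: cts_scale.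
    apply: sqr_le; first by rewrite divr_ge0// ltW.
    apply: le_trans (conv_bound x (cts_sub c2 clf)) _.
    apply: le_trans (_ : K * (lam * b) <= _); last first.
      by rewrite mulrA /b mulrC divfK// gt_eqF// mulr_gt0.
    apply: ler_pM => //; first exact: ip_ge0 (cts_sub c2 clf).
      by rewrite /K; lra.
    apply: le_trans (residual f _) _ => //.
    by rewrite ler_pM2l//; lra.
  have h3 := fh x.
  move: h1 h2; rewrite (convB c1 ch) (convB c2 cTh).
  rewrite (convB c2 (@cts_scale lam f cf)) (convZ lam cf) => h1 h2.
  have -> : conv (conv h) x - lam * h x =
    - (conv (conv (conv f)) x - conv (conv h) x)
    + (conv (conv (conv f)) x - lam * conv f x) + lam * (conv f x - h x) by ring.
  apply: le_trans (ler_normD _ _) _.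
  apply: le_trans (lerD (ler_normD _ _) (lexx _)) _.
  rewrite normrN normrM (gtr0_norm lam0).
  have h3' : lam * `|conv f x - h x| <= lam * d by rewrite ler_pM2l.
  have : K * (K * d) + lam * d <= e / 3.
    rewrite -dE; have := ltW d0; lra.
  lra.
Qed.

End Eigenfunction.
End Convolution.
End PeterWeyl.

(** * Finite-dimensional representations from eigenspaces *)

Section OrthogonalReps.
Variables (R : realType) (G : topologicalGroupType).
Hypothesis cG : compact [set: G].
Implicit Types (f g h u : G -> R) (x y : G).
Local Notation ip := (@ip R G).

Definition orth_rep m (rho : G -> 'M[R]_m) := [/\
  forall x, rho x *m (rho x)^T = 1%:M,
  forall x y, rho (x * y)%g = rho x *m rho y &
  forall i j, continuous (fun x => rho x i j)].

(** Indexing by [nat] lets the family grow without a change of type; only the first [m] terms are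
    constrained. *)
Definition orthonormal m (e : nat -> G -> R) := forall i j, (i < m)%N -> (j < m)%N ->
  ip (e i) (e j) = (i == j)%:R.

(** The common squared norm [l] fits the images [conv (e i)] of an orthonormal family of
    eigenfunctions. *)
Lemma bessel m (u : nat -> G -> R) (l : R) f : 0 < l -> (forall i, continuous (u i)) ->
  continuous f ->
  (forall i j, (i < m)%N -> (j < m)%N -> ip (u i) (u j) = l * (i == j)%:R) ->
  \sum_(i < m) ip f (u i) ^+ 2 <= l * ip f f.
Proof.
move=> l0 cu cf ul; pose c i := ip f (u i) / l.
pose s x := \sum_(i < m) c i * u i x.
have cs : continuous s by apply: cts_sum => i; exact: cts_scale.
have sf : ip s f = (\sum_(i < m) ip f (u i) ^+ 2) / l.
  rewrite (ip_suml cG)// mulr_suml; apply: eq_bigr => i _.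
  by rewrite [ip (u i) f]ipC /c expr2; ring.
have ss : ip s s = ip s f.
  rewrite (ip_suml cG)// [RHS](ip_suml cG)//; apply: eq_bigr => i _.
  congr (_ * _); rewrite ipC (ip_suml cG)//.
  rewrite (bigD1 i)//= big1 ?addr0 => [|j ji].
    by rewrite ul// eqxx mulr1 /c divfK ?gt_eqF// ipC.
  by rewrite ul// (_ : (j == i :> nat) = false) ?mulr0//; exact/negbTE.
have := ip_ge0 cG (cts_sub cf cs).
rewrite (ipBl cG)//; last exact: cts_sub.
rewrite ![ip _ (fun x => _ - _)]ipC !(ipBl cG)// ss (ipC f s) sf => h.
rewrite -ler_pdivrMl//; set S := \sum_(i < m) _ in h *.
have : S / l <= ip f f by lra.
by rewrite mulrC.
Qed.

(** * Finite-dimensional invariant eigenspaces *)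

Section Eigenspace.
Variable k : G -> R.
Hypothesis ck : continuous k.
Hypothesis kV : forall x, k x^-1%g = k x.
Variables (l : R) (L : set (G -> R)).
Hypothesis l0 : 0 < l.
Hypothesis Lc : forall f, L f -> continuous f.
Hypothesis LZ : forall c f, L f -> L (fun x => c * f x).
Hypothesis LB : forall f g, L f -> L g -> L (fun x => f x - g x).
Hypothesis Lltr : forall a f, L f -> L (ltr a f).
Local Notation conv := (conv k).

Let E : set (G -> R) := [set h | L h /\ conv (conv h) = fun x => l * h x].

Let Ec f : E f -> continuous f. Proof. by move=> [/Lc]. Qed.

Let EZ c f : E f -> E (fun x => c * f x).
Proof.
move=> [Lf Ef]; split; first exact: LZ.
have cf := Lc Lf; have c1 := cts_conv cG ck cf.
by rewrite !convZ// Ef; apply/funext => x; ring.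
Qed.

Let EB f g : E f -> E g -> E (fun x => f x - g x).
Proof.
move=> [Lf Ef] [Lg Eg]; split; first exact: LB.
have cf := Lc Lf; have cg := Lc Lg.
have c1 := cts_conv cG ck cf; have c2 := cts_conv cG ck cg.
by rewrite !convB// Ef Eg; apply/funext => x; ring.
Qed.

Let Eltr a f : E f -> E (ltr a f).
Proof.
move=> [Lf Ef]; split; first exact: Lltr.
have cf := Lc Lf; have c1 := cts_conv cG ck cf.
by rewrite !conv_ltr// Ef.
Qed.

(** Bessel's inequality for the row [ltr x k] and the family [conv (e i)], whose coefficients are
    [l * e i x], bounds the sum of the [e i x] squared; taking the mean over [x] counts the
    family. *)
Lemma eigenspace_bound m (e : nat -> G -> R) : (forall i, E (e i)) -> orthonormal m e ->
  l * m%:R <= kk k.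
Proof.
move=> Ee oe; have ce i : continuous (e i) by exact: Ec.
have cTe i : continuous (conv (e i)) by exact: cts_conv.
have h x : l * \sum_(i < m) e i x * e i x <= kk k.
  have : \sum_(i < m) ip (ltr x k) (conv (e i)) ^+ 2 <= l * ip (ltr x k) (ltr x k).
    apply: (@bessel m (fun i => conv (e i))) => //; first exact: cts_ltr.
    move=> i j im jm; rewrite (conv_adj cG ck kV)//.
    rewrite (Ee j).2 ipC (ipZl cG)// oe//.
    by rewrite eq_sym.
  rewrite ip_ltr// -/(kk k).
  rewrite (eq_bigr (fun i : 'I_m => l ^+ 2 * (e i x * e i x))); last first.
    move=> i _; have := congr1 (@^~ x) (Ee i).2; rewrite /= convE => ->.
    by rewrite exprMn -!expr2.
  by rewrite -mulr_sumr expr2 -mulrA ler_pM2l.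
have cs : continuous (fun x => \sum_(i < m) e i x * e i x).
  by apply: (cts_sum (f := fun (i : 'I_m) x => e i x * e i x)) => i; exact: cts_mul.
rewrite -(mean_cst cG (kk k)).
apply: le_trans (le_mean cG (@cts_scale _ _ l _ cs) (@ctsC _ _ _) h).
rewrite (meanZ cG)// ler_pM2l//.
rewrite (@mean_sum R G cG _ _ (fun (i : 'I_m) x => e i x * e i x)); last by move=> i; exact: cts_mul.
rewrite (eq_bigr (fun=> 1)) ?sumr_const ?card_ord//.
by move=> i _; have := oe i i (ltn_ord i) (ltn_ord i); rewrite eqxx.
Qed.

(** An orthonormal family of largest size exists by [eigenspace_bound] and is a basis of the
    eigenspace. Translations preserve the eigenspace and the inner product, so their matrices are
    orthogonal. *)
Lemma eigenspace_orth_rep h x0 : E h -> h x0 != 0 ->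
  exists m (rho : G -> 'M[R]_m) (e : nat -> G -> R),
    [/\ (0 < m)%N, orth_rep rho, forall i, E (e i), orthonormal m e &
    forall a (j : 'I_m), ltr a (e j) = fun x => \sum_(i < m) rho a i j * e i x].
Proof.
move=> Eh hx0.
have normalize f : E f -> 0 < ip f f -> exists2 c, 0 < c &
    ip (fun x => c * f x) (fun x => c * f x) = 1.
  move=> Ef f1; have cf := Ec Ef; exists (Num.sqrt (ip f f))^-1.
    by rewrite invr_gt0 sqrtr_gt0.
  rewrite (ipZl cG)//; last exact: cts_scale.
  rewrite ipC (ipZl cG)// mulrA -expr2.
  by rewrite exprVn sqr_sqrtr ?ltW// mulVf// gt_eqF.
pose ON m := `[< exists e, (forall i, E (e i)) /\ orthonormal m e >].
have ON1 : ON 1%N.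
  have [c c0 hc] := normalize h Eh (ip_gt0 cG (Ec Eh) hx0).
  apply/asboolP; exists (fun _ x => c * h x); split => [i|]; first exact: EZ.
  by case=> // -[].
have ONub m : ON m -> (m <= Num.bound (kk k / l))%N.
  move=> /asboolP[e [Ee oe]]; have := eigenspace_bound Ee oe.
  rewrite -ler_pdivlMl// mulrC => hm.
  rewrite -(ler_nat R); apply: le_trans hm _; apply: ltW.
  by apply: archi_boundP; rewrite divr_ge0 ?kk_ge0// ltW.
case: (ex_maxnP (ex_intro (fun m => ON m) 1%N ON1) ONub) => m /asboolP[e [Ee oe]] mmax.
have ce i : continuous (e i) by exact: Ec.
have expand f : E f -> f = fun x => \sum_(i < m) ip f (e i) * e i x.
  move=> Ef; have cf := Ec Ef.
  pose s n x := \sum_(i < n) ip f (e i) * e i x.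
  have Eg n : E (fun x => f x - s n x).
    elim: n => [|n IH].
      rewrite (_ : (fun x => _) = f)//; apply/funext => x.
      by rewrite /s big_ord0 subr0.
    rewrite (_ : (fun x => _) = fun x => (f x - s n x) - ip f (e n) * e n x).
      by apply: EB => //; exact: EZ.
    by apply/funext => x; rewrite /s big_ord_recr/= opprD addrA.
  (* If the part of [f] orthogonal to the family were not zero, normalizing it would give a larger
     family. *)
  pose g x := f x - s m x; have {}Eg : E g := Eg m; have cg := Ec Eg.
  have cs : continuous (s m) by apply: cts_sum => i; exact: cts_scale.
  have ge i : (i < m)%N -> ip g (e i) = 0.
    move=> im; rewrite /g (ipBl cG)// /s (ip_suml cG m (fun i => ip f (e i)))//.
    rewrite (bigD1 (Ordinal im))//= big1 ?addr0 => [|j ji].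
      by rewrite oe// eqxx mulr1 subrr.
    rewrite oe// (_ : (j == i :> nat) = false) ?mulr0//.
    by apply: negbTE; apply: contraNneq ji => ji; apply/eqP/val_inj.
  have [g0|g0] := eqVneq (ip g g) 0.
    apply/funext => x; apply/eqP; rewrite -subr_eq0; apply/eqP.
    exact: (mean_sqr_eq0 cG cg g0).
  have g1 : 0 < ip g g by rewrite lt_neqAle eq_sym g0 ip_ge0.
  have [c c0 hc] := normalize g Eg g1.
  have : ON m.+1.
    apply/asboolP; exists (fun i => if (i < m)%N then e i else fun x => c * g x).
    split => [i|i j]; first by case: ifP => _ //; exact: EZ.
    rewrite !ltnS => im jm; case: ltnP => im'; case: ltnP => jm'.
    - exact: oe.
    - rewrite ipC (ipZl cG)// ge// mulr0 (_ : (i == j) = false)//.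
      by apply: negbTE; rewrite neq_ltn (leq_trans im' jm').
    - rewrite (ipZl cG)// ge// mulr0 (_ : (i == j) = false)//.
      by apply: negbTE; rewrite neq_ltn (leq_trans jm' im') orbT.
    - by rewrite (@anti_leq i j) ?eqxx// (leq_trans im jm') (leq_trans jm im').
  by move/mmax; rewrite ltnn.
pose rho a : 'M[R]_m := \matrix_(i, j) ip (ltr a (e j)) (e i).
have rhoE a (j : 'I_m) : ltr a (e j) = fun x => \sum_(i < m) rho a i j * e i x.
  rewrite {1}(expand _ (Eltr a (Ee j))); apply/funext => x.
  by apply: eq_bigr => i _; rewrite mxE.
have rhoM x y : rho (x * y)%g = rho x *m rho y.
  apply/matrixP => i j; rewrite !mxE ltrM rhoE.
  have -> : ltr x (fun z => \sum_(i < m) rho y i j * e i z) =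
      fun z => \sum_(i < m) (rho y) i j * ltr x (e i) z by [].
  (* A column of [rho y] extended by [0] to all of [nat], as [ip_suml] requires. *)
  pose c n := if insub n is Some i then rho y i j else 0.
  have cE (i' : 'I_m) : rho y i' j = c i' by rewrite /c valK.
  under eq_fun do under eq_bigr do rewrite cE.
  rewrite (ip_suml cG m c (fun i => cts_ltr (ce i)) (ce i)); apply: eq_bigr => i' _.
  by rewrite -cE mulrC !mxE.
have rho1 : rho 1%g = 1%:M.
  apply/matrixP => i j; rewrite !mxE.
  have -> : ltr 1%g (e j) = e j by apply/funext => x; rewrite /ltr invg1 mul1g.
  by rewrite oe// eq_sym.
have rhoV x : rho x^-1%g = (rho x)^T.
  by apply/matrixP => i j; rewrite !mxE ipC -(ip_ltr_adj cG)// ipC.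
exists m, rho, e; split => //; first exact: mmax.
split => // [x|i j]; first by rewrite -rhoV -rhoM mulgV.
under eq_fun do rewrite mxE.
apply: (@cts_mean_param R G cG _ (fun a x => ltr a (e j) x * e i x)).
apply: cts_mul; last by apply: cts_comp (ce i); exact: cts_snd.
apply: cts_comp (ce j); apply: cts_mulg; last exact: cts_snd.
by apply: cts_invg; exact: cts_fst.
Qed.

End Eigenspace.

Lemma orth_rep1 m (rho : G -> 'M[R]_m) : orth_rep rho -> rho 1%g = 1%:M.
Proof.
by move=> [ro rM _]; have := ro 1%g; rewrite -{1}(mulg1 1%g) rM -mulmxA ro mulmx1.
Qed.

Definition orth_core : set G :=
  [set n | forall m (rho : G -> 'M[R]_m), orth_rep rho -> rho n = 1%:M].

Let coreV n : orth_core n -> orth_core n^-1%g.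
Proof.
move=> nN m rho rr; have [ro rM _] := rr; have := rM n n^-1%g.
by rewrite mulgV (orth_rep1 rr) nN// mul1mx.
Qed.

Let coreJ n a : orth_core n -> orth_core (a * n * a^-1)%g.
Proof.
move=> nN m rho rr; have [ro rM _] := rr.
by rewrite !rM nN// mulmx1 -rM mulgV (orth_rep1 rr).
Qed.

Let inv_fun (e : G -> R) := continuous e /\ forall n x, orth_core n -> e (n * x)%g = e x.

(* Functions orthogonal to those that do not see the common kernel of the
   orthogonal representations: a nonzero eigenspace in this space affords such
   a representation, hence is orthogonal to itself. *)
Let L : set (G -> R) := [set f | continuous f /\ forall e, inv_fun e -> ip f e = 0].

(** A nontrivial [n] in the core would give a nonzero [f] in [L] and a kernel whose convolution does
    not kill [f], hence an eigenfunction in [L]. The core fixes the basis of its eigenspace, so a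
    basis vector is orthogonal to itself. *)
Lemma orth_core_trivial : hausdorff_space G -> forall n, orth_core n -> n = 1%g.
Proof.
move=> hG n nN; apply/eqP/negPn/negP => n1.
have Lc f : L f -> continuous f by case.
have LZ c f : L f -> L (fun x => c * f x).
  move=> [cf Lf]; split; first exact: cts_scale.
  by move=> e ie; rewrite (ipZl cG)// ?Lf ?mulr0//; case: ie.
have LB f g : L f -> L g -> L (fun x => f x - g x).
  move=> [cf Lf] [cg Lg]; split; first exact: cts_sub.
  by move=> e ie; rewrite (ipBl cG)// ?Lf ?Lg ?subr0//; case: ie.
have Lltr a f : L f -> L (ltr a f).
  move=> [cf Lf]; split; first exact: cts_ltr.
  move=> e [ce ie]; rewrite (ip_ltr_adj cG)//; apply: Lf; split.
    exact: cts_ltr.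
  move=> n' x n'N; rewrite /ltr invgK.
  rewrite (_ : a * (n' * x) = (a * n' * a^-1) * (a * x))%g; last first.
    by rewrite -!mulgA mulKg.
  by rewrite ie//; exact: coreJ.
have [u [cu u0 u1]] : exists u : G -> R, [/\ continuous u, u 1%g = 0 & u n^-1%g = 1].
  have /normal_separatorP sep := compact_normal hG cG.
  have cl1 := accessible_closed_set1 (hausdorff_accessible hG).
  have /(uniform_separatorP (R := R))[u [cu _ u0 u1]] :
      uniform_separator [set 1%g : G] [set n^-1%g].
    apply: (sep R) => //; apply/seteqP; split => // x [-> /= e].
    by move/negP: n1; apply; rewrite -invg_eq1 -e.
  by exists u; split=> //; [apply: u0; exists 1%g|apply: u1; exists n^-1%g].
(* Translating by [n] does not change the inner product with a function invariant under the core, so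
   this difference lies in [L]. *)
pose f y := u (n^-1 * y)%g - u y.
have cu' : continuous (fun y => u (n^-1 * y)%g) by exact: cts_ltrans.
have Lf : L f.
  split=> [|e [ce ie]]; first exact: cts_sub.
  rewrite (ipBl cG)// [X in X - _](_ : _ = ip u e) ?subrr//.
  rewrite -[X in ip X _]/(ltr n u) (ip_ltr_adj cG)//; congr ip.
  by apply/funext => x; rewrite /ltr invgK ie.
have cf := Lc f Lf.
have f1 : f 1%g = 1 by rewrite /f mulg1 u0 u1 subr0.
pose fp y := (`|f y| + f y) / 2.
have cfp : continuous fp.
  by apply: cts_mul; [apply: cts_add => //; exact: cts_norm|exact: ctsC].
have fp0 y : 0 <= fp y.
  by rewrite /fp divr_ge0//; have := ler_norm (- f y); rewrite normrN; lra.
have fpf y : fp y * f y = fp y * fp y.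
  have [fy|fy] := leP 0 (f y); rewrite /fp.
    by rewrite ger0_norm//; congr (_ * _); lra.
  by rewrite ltr0_norm// addNr !mul0r.
(* This kernel is even, and [conv k f] at [1] is the mean of the nonnegative function
   [fp y * fp y * fp (y^-1)], which is [1] at [1]. *)
pose k y := fp y * fp (y^-1)%g.
have cfpV : continuous (fun y => fp (y^-1)%g).
  by apply: cts_comp cfp; apply: cts_invg; exact: cts_id.
have ck : continuous k by exact: cts_mul.
have kV x : k x^-1%g = k x by rewrite /k invgK mulrC.
have Tf1 : conv k f 1%g != 0.
  rewrite gt_eqF// /conv.
  have ckf : continuous (fun y => k (1^-1 * y)%g * f y).
    by apply: cts_mul => //; exact: cts_ltrans.
  have E y : k (1^-1 * y)%g * f y = fp y * fp y * fp (y^-1)%g.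
    by rewrite invg1 mul1g /k mulrAC fpf.
  apply: (mean_gt0 cG (x0 := 1%g)) => // [x|]; rewrite E.
    by apply: mulr_ge0; [apply: mulr_ge0|].
  have fp1 : fp 1%g = 1 by rewrite /fp f1 normr1; field.
  by rewrite invg1 fp1 !mulr1.
have Lconv g : L g -> L (conv k g).
  move=> [cg Lg]; split; first exact: cts_conv.
  move=> e [ce ie]; rewrite (conv_adj cG ck kV)//; apply: Lg.
  split=> [|m x mN]; first exact: cts_conv.
  have {}ie : ltr m^-1%g e = e by apply/funext => y; rewrite /ltr invgK ie.
  by rewrite -[in RHS]ie conv_ltr// /ltr invgK.
have Lclosed g : continuous g ->
    (forall e : R, 0 < e -> exists2 g', L g' & forall x, `|g' x - g x| <= e) -> L g.
  move=> cg ga; split=> // e ie; have [ce _] := ie.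
  have cne := cts_norm ce; set M := mean (fun x => `|e x|).
  have M0 : 0 <= M by apply: mean_ge0.
  apply/eqP; rewrite -normr_le0; apply/ler_addgt0Pr => d d0; rewrite add0r.
  have d1 : 0 < d / (M + 1) by rewrite divr_gt0// ltr_wpDl.
  have [g' [cg' /(_ e ie) g'0] g'g] := ga _ d1.
  rewrite -[ip g e]opprK normrN -[- _]add0r -g'0 -(ipBl cG)//.
  have cd : continuous (fun x => (g' x - g x) * e x).
    by apply: cts_mul => //; exact: cts_sub.
  have cde : continuous (fun x => d / (M + 1) * `|e x|) by exact: cts_scale.
  have le1 x : `|(g' x - g x) * e x| <= d / (M + 1) * `|e x|.
    by rewrite normrM ler_wpM2r.
  have hd : d / (M + 1) * M <= d.
    rewrite mulrAC ler_pdivrMr ?ltr_wpDl//; nra.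
  apply: le_trans hd; rewrite -(meanZ cG)// ler_norml -(mulN1r (mean _)) -(meanZ cG)//.
  apply/andP; split.
    apply: (le_mean cG) => // [|x]; first exact: cts_scale.
    by have := le1 x; rewrite ler_norml mulN1r => /andP[].
  by apply: (le_mean cG) => // x; have := le1 x; rewrite ler_norml => /andP[].
have [l [h [l0 Lh [x0 hx0] Eh]]] :=
  @conv_eigenfunction _ _ cG k ck kV L Lc LZ Lconv Lclosed f 1%g Lf Tf1.
have [m [rho [e [m0 rr Ee oe rhoE]]]] :=
  @eigenspace_orth_rep k ck kV l L l0 Lc LZ LB Lltr h x0 (conj Lh Eh) hx0.
have [[ce0 Le0] _] := Ee 0%N.
have : ip (e 0%N) (e 0%N) = 0.
  apply: Le0; split=> // n' x n'N.
  have rho1 := coreV n'N rr.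
  have := congr1 (@^~ x) (rhoE n'^-1%g (Ordinal m0)); rewrite /ltr invgK /= => ->.
  rewrite rho1 (bigD1 (Ordinal m0))//= big1 ?addr0 => [|i ii].
    by rewrite mxE eqxx mul1r.
  by rewrite mxE (negbTE ii) mul0r.
by rewrite oe// eqxx => /eqP; rewrite oner_eq0.
Qed.

End OrthogonalReps.

(** * Unitary representations *)

Section ComplexEntries.
Variables (R : realType) (T : topologicalType).
Local Notation C := R[i].
Local Notation normc := (@ComplexField.Normc.normc R).
Implicit Types (f g : T -> C).

(** Splitting into real and imaginary parts makes the real-valued mean applicable. *)
Definition ccts f := continuous (fun x => complex.Re (f x)) /\
  continuous (fun x => complex.Im (f x)).

Lemma conjCE (z : C) : z^* = conjc z.
Proof. by []. Qed.

Lemma ReM (z w : C) : complex.Re (z * w) =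
  complex.Re z * complex.Re w - complex.Im z * complex.Im w.
Proof. by case: z; case: w. Qed.

Lemma ImM (z w : C) : complex.Im (z * w) =
  complex.Re z * complex.Im w + complex.Im z * complex.Re w.
Proof. by case: z; case: w. Qed.

Lemma complexP (z w : C) : complex.Re z = complex.Re w -> complex.Im z = complex.Im w ->
  z = w.
Proof. by case: z; case: w => a b c d /= -> ->. Qed.

Lemma ccts_cst (c : C) : ccts (fun=> c).
Proof. by split; exact: ctsC. Qed.

Lemma cctsM f g : ccts f -> ccts g -> ccts (fun x => f x * g x).
Proof.
move=> [rf jf] [rg jg]; split.
  under eq_fun do rewrite ReM.
  by apply: cts_sub; apply: cts_mul.
under eq_fun do rewrite ImM.
by apply: cts_add; apply: cts_mul.
Qed.

Lemma ccts_conj f : ccts f -> ccts (fun x => (f x)^*).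
Proof.
move=> [rf jf]; split.
  rewrite (_ : (fun x => complex.Re (f x)^*) = (fun x => complex.Re (f x)))//.
  by apply/funext => x; case: (f x).
rewrite (_ : (fun x => complex.Im (f x)^*) = (fun x => - complex.Im (f x))).
  exact: cts_opp.
by apply/funext => x; case: (f x).
Qed.

Lemma ccts_sum (I : Type) (r : seq I) (f : I -> T -> C) :
  (forall i, ccts (f i)) -> ccts (fun x => \sum_(i <- r) f i x).
Proof.
move=> cf; split.
  under eq_fun do rewrite raddf_sum.
  by apply: (@cts_sum _ _ _ r (fun i x => complex.Re (f i x))) => i; have [] := cf i.
under eq_fun do rewrite raddf_sum.
by apply: (@cts_sum _ _ _ r (fun i x => complex.Im (f i x))) => i; have [] := cf i.
Qed.

Lemma normc_Re (z : C) : `|complex.Re z| <= normc z.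
Proof.
case: z => a b /=; rewrite -(@ler_pXn2r _ 2)// ?nnegrE ?sqrtr_ge0//.
by rewrite sqr_sqrtr ?addr_ge0 ?sqr_ge0// real_normK ?num_real// lerDl sqr_ge0.
Qed.

Lemma normc_Im (z : C) : `|complex.Im z| <= normc z.
Proof.
case: z => a b /=; rewrite -(@ler_pXn2r _ 2)// ?nnegrE ?sqrtr_ge0//.
by rewrite sqr_sqrtr ?addr_ge0 ?sqr_ge0// real_normK ?num_real// lerDr sqr_ge0.
Qed.

Lemma normc_le (z : C) : normc z <= `|complex.Re z| + `|complex.Im z|.
Proof.
case: z => a b /=; rewrite -(@ler_pXn2r _ 2)// ?nnegrE ?sqrtr_ge0// ?addr_ge0//.
rewrite sqr_sqrtr ?addr_ge0 ?sqr_ge0// sqrrD !real_normK ?num_real//.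
by rewrite addrAC lerDl mulrn_wge0// mulr_ge0.
Qed.

End ComplexEntries.

(** * The operator norm against matrix entries *)

Section OperatorNormEntries.
Variable R : realType.
Local Notation C := R[i].
Local Notation normc := (@ComplexField.Normc.normc R).

Lemma normc_ge0 (z : C) : 0 <= normc z.
Proof. by case: z => a b; rewrite /= sqrtr_ge0. Qed.

Lemma l2norm_delta n (i : 'I_n) : l2norm (delta_mx i 0 : 'cV[C]_n) = 1.
Proof.
rewrite /l2norm (bigD1 i)//= big1 ?addr0 => [|j ji].
  by rewrite mxE !eqxx ComplexField.Normc.normc1 expr1n sqrtr1.
by rewrite mxE (negbTE ji) ComplexField.Normc.normc0 expr0n.
Qed.

Lemma normc_l2norm n (v : 'cV[C]_n) i : normc (v i 0) <= l2norm v.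
Proof.
rewrite /l2norm -(@ler_pXn2r _ 2)// ?nnegrE ?normc_ge0 ?sqrtr_ge0//.
rewrite sqr_sqrtr ?sumr_ge0// => [|j _]; last exact: sqr_ge0.
by rewrite (bigD1 i)//= lerDl sumr_ge0// => j _; exact: sqr_ge0.
Qed.

Lemma l2norm_le_sum n (v : 'cV[C]_n) : l2norm v <= \sum_i normc (v i 0).
Proof.
have E : v = \sum_i v i 0 *: delta_mx i 0.
  rewrite {1}(matrix_sum_delta v); apply: eq_bigr => i _; by rewrite big_ord1.
rewrite {1}E; have : forall s : seq 'I_n,
    l2norm (\sum_(i <- s) v i 0 *: delta_mx i 0) <= \sum_(i <- s) normc (v i 0).
  elim=> [|i s IH]; first by rewrite !big_nil l2norm0.
  rewrite !big_cons; apply: le_trans (l2normD _ _) _.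
  by rewrite lerD// l2normZ l2norm_delta mulr1.
exact.
Qed.

Lemma normc_opnorm n (A : 'M[C]_n) i j : normc (A i j) <= opnorm A.
Proof.
have := opnormP A (delta_mx j 0); rewrite l2norm_delta mulr1; apply: le_trans.
have := normc_l2norm (A *m delta_mx j 0) i.
by rewrite -colE mxE.
Qed.

Lemma opnorm_le_sum n (A : 'M[C]_n) : opnorm A <= \sum_i \sum_j normc (A i j).
Proof.
apply: opnorm_le => v v1; apply: le_trans (l2norm_le_sum _) _.
apply: ler_sum => i _; rewrite mxE.
have : forall s : seq 'I_n,
    normc (\sum_(j <- s) A i j * v j 0) <= \sum_(j <- s) normc (A i j).
  elim=> [|j s IH]; first by rewrite !big_nil ComplexField.Normc.normc0.
  rewrite !big_cons; apply: le_trans (le_normcD _ _) _.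
  rewrite lerD// ComplexField.Normc.normcM ler_piMr ?normc_ge0//.
  exact: le_trans (normc_l2norm _ _) v1.
exact.
Qed.

End OperatorNormEntries.

(** * From unitary to irreducible representations *)

Section UnitaryReps.
Variables (R : realType) (G : topologicalGroupType).
Local Notation C := R[i].
Local Notation normc := (@ComplexField.Normc.normc R).
Local Open Scope sesquilinear_scope.

Definition unitary_rep m (rho : G -> 'M[C]_m) := [/\
  forall x, rho x \is unitarymx,
  forall x y, rho (x * y)%g = rho x *m rho y &
  forall i j, ccts (fun x => rho x i j)].

Lemma trmxC_mul m n p (A : 'M[C]_(m, n)) (B : 'M[C]_(n, p)) :
  (A *m B)^t* = B^t* *m A^t*.
Proof. by rewrite trmx_mul map_mxM. Qed.

Lemma unitary_mulVmx m (A : 'M[C]_m) : A \is unitarymx -> A ^t* *m A = 1%:M.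
Proof. by move=> /unitarymxP h; exact: mulmx1C. Qed.

Lemma unitary_rep1 m (rho : G -> 'M[C]_m) : unitary_rep rho -> rho 1%g = 1%:M.
Proof.
move=> [ro rM _]; have /unitarymxP h := ro 1%g.
by have := congr1 (mulmx^~ ((rho 1%g)^t*)) (rM 1%g 1%g); rewrite mulg1 -mulmxA h mulmx1.
Qed.

Lemma unitary_repV m (rho : G -> 'M[C]_m) x : unitary_rep rho ->
  rho x^-1%g = (rho x)^t*.
Proof.
move=> rr; have [ro rM _] := rr.
rewrite -[RHS]mul1mx -(unitary_rep1 rr) -(mulVg x) rM -mulmxA.
by rewrite (unitarymxP (ro x)) mulmx1.
Qed.

Lemma irrep_ccts m (phi : irrep R G m) i j : ccts (fun x => phi x i j).
Proof.
split; apply/ctsP => x e e0; have := irrep_continuous phi x e0;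
  apply: filterS => y; apply: le_lt_trans;
  rewrite -raddfB /=; have := normc_opnorm (phi y - phi x) i j;
  rewrite 2!mxE; apply: le_trans.
- exact: normc_Re.
- exact: normc_Im.
Qed.

Lemma irrep_unitary_rep m (phi : irrep R G m) : unitary_rep phi.
Proof.
by split; [exact: irrep_unitary|exact: irrepM|exact: irrep_ccts].
Qed.

Lemma unitary_rep_opnorm m (rho : G -> 'M[C]_m) : unitary_rep rho ->
  forall x e, 0 < e -> \forall y \near x, opnorm (rho y - rho x) < e.
Proof.
(* Each of the [m * m] entries contributes at most [2 * d]; the [+ 1] makes the total strictly less
   than [e]. *)
move=> [_ _ rc] x e e0; pose d := e / (2 * (m%:R * m%:R + 1)).
have D0 : 0 < 2 * (m%:R * m%:R + 1) :> R by rewrite mulr_gt0// ltr_wpDl// mulr_ge0.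
have d0 : 0 < d by rewrite divr_gt0.
have near_d : \forall y \near x, forall i j,
    `|complex.Re (rho y i j) - complex.Re (rho x i j)| < d /\
    `|complex.Im (rho y i j) - complex.Im (rho x i j)| < d.
  apply: filter_forall => i; apply: filter_forall => j.
  have [/ctsP/(_ x d d0) h1 /ctsP/(_ x d d0) h2] := rc i j.
  exact: filterI.
apply: filterS near_d => y h; apply: le_lt_trans (opnorm_le_sum _) _.
apply: le_lt_trans (_ : \sum_(i < m) \sum_(j < m) (d + d) < e).
  apply: ler_sum => i _; apply: ler_sum => j _; apply: le_trans (normc_le _) _.
  have [h1 h2] := h i j.
  by rewrite 2!mxE !raddfB/= lerD// ltW.
rewrite !sumr_const card_ord -!mulrnA -[_ *+ _]mulr_natr natrM.
have dE : d * (2 * (m%:R * m%:R + 1)) = e by rewrite /d divfK// gt_eqF.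
rewrite -[ltRHS]dE; lra.
Qed.

Lemma unitary_rep_irrep m (rho : G -> 'M[C]_m) : unitary_rep rho -> irreducible rho ->
  exists phi : irrep R G m, irrep_fun phi = rho.
Proof.
move=> rr ir; have [ro rM _] := rr.
by exists (Irrep ro rM (unitary_rep_opnorm rr) ir).
Qed.

(** The rows of [B] are an orthonormal basis of an invariant row space, and the compression is the
    representation in that basis. *)
Lemma unitary_subrep m (rho : G -> 'M[C]_m) r (B : 'M[C]_(r, m)) :
  unitary_rep rho -> B \is unitarymx -> (forall x, B *m rho x <= B)%MS ->
  unitary_rep (fun x => B *m rho x *m B^t*) /\
  forall x, B *m rho x = B *m rho x *m B^t* *m B.
Proof.
move=> rr uB Bst; have [ro rM rc] := rr.
have BE x : B *m rho x = B *m rho x *m B^t* *m B.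
  have /submxP[D ->] := Bst x.
  by rewrite -(mulmxA D) (unitarymxP uB) mulmx1.
have BM x y : B *m rho (x * y)%g *m B^t* = B *m rho x *m B^t* *m (B *m rho y *m B^t*).
  by rewrite rM mulmxA [in LHS](BE x) !mulmxA.
split=> //; split => // [x|i j].
  apply/unitarymxP; rewrite trmxC_mul trmxCK trmxC_mul mulmxA -BE mulmxA.
  by rewrite -(mulmxA B) (unitarymxP (ro x)) mulmx1 (unitarymxP uB).
under eq_fun do rewrite mxE.
apply: ccts_sum => k; apply: cctsM; last exact: ccts_cst.
under eq_fun do rewrite mxE.
by apply: ccts_sum => k'; apply: cctsM => //; exact: ccts_cst.
Qed.

(* A representation of least dimension not killing [n] is irreducible, since
   its restrictions to an invariant subspace and to its complement kill [n]. *)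
Lemma irrep_separates m (rho : G -> 'M[C]_m) n : unitary_rep rho -> rho n <> 1%:M ->
  exists m' (phi : irrep R G m'), phi n <> 1%:M.
Proof.
move=> rr0 rn0.
pose P d := `[< exists rho : G -> 'M[C]_d, unitary_rep rho /\ rho n <> 1%:M >].
have P0 : P m by apply/asboolP; exists rho.
case: (ex_minnP (ex_intro (fun d => P d) m P0)) => d /asboolP[{rr0 rn0 P0}r [rr rn]] dmin.
have [ro rM rc] := rr.
suff ir : irreducible r.
  by have [phi phiE] := unitary_rep_irrep rr ir; exists d, phi; rewrite phiE.
split.
  rewrite lt0n; apply/eqP => d0; apply: rn; apply/matrixP => i.
  by have := ltn_ord i; rewrite {2}d0.
move=> W Wst; apply: contrapT => /not_orP[W0 W1].
(* [W] consists of columns while ranks and inclusions concern row spaces, so a basis of [W] is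
   conjugated and transposed. *)
pose A : 'M[C]_(\dim W, d) := \matrix_i ((vbasis W)`_i)^t*.
have AW (u : 'cV[C]_d) : (u^t* <= A)%MS = (u \in W).
  apply/idP/idP => [/submxP[D uD]|uW].
    rewrite -[u]trmxCK uD mulmx_sum_row linear_sum/= raddf_sum/=.
    apply: memv_suml => i _; rewrite linearZ/= map_mxZ/= memvZ//.
    by rewrite rowK trmxCK vbasis_mem// mem_nth// size_tuple.
  rewrite (coord_vbasis uW) linear_sum/= raddf_sum/= summx_sub// => i _.
  rewrite linearZ/= map_mxZ/= scalemx_sub//.
  by rewrite -(rowK (fun i : 'I__ => ((vbasis W)`_i)^t*)) row_sub.
have Ast x : (A *m r x <= A)%MS.
  apply/row_subP => i; rewrite row_mul rowK -[r x]trmxCK -(unitary_repV x rr).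
  by rewrite -trmxC_mul AW Wst// vbasis_mem// mem_nth// size_tuple.
have A0 : (0 < \rank A)%N.
  rewrite lt0n mxrank_eq0; apply/eqP => Az; apply: W0; apply/eqP.
  rewrite -subv0; apply/subvP => u; rewrite -AW Az => /submx0null uz.
  by rewrite -[u]trmxCK uz trmx0 map_mx0 mem0v.
have A1 : (\rank A < d)%N.
  rewrite ltn_neqAle rank_leq_col andbT; apply/eqP => Ad; apply: W1; apply/eqP.
  rewrite eqEsubv subvf; apply/subvP => u _; rewrite -AW submx_full//.
  by rewrite /row_full Ad.
(* By minimality of [d], [r n] acts trivially on every invariant row space of smaller rank; this
   applies to [A] and to its orthogonal complement, which together span everything. *)
have step (p : nat) (M : 'M[C]_(p, d)) : (\rank M < d)%N -> (forall x, (M *m r x <= M)%MS) ->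
    M *m r n = M.
  move=> Md Mst; pose B := schmidt (row_base M).
  have uB : B \is unitarymx by rewrite schmidt_unitarymx// rank_leq_col.
  have BM : (B :=: M)%MS.
    by apply: eqmx_trans (eqmx_schmidt_free (row_base_free _)) (eq_row_base _).
  have Bst x : (B *m r x <= B)%MS.
    by rewrite (eqmxMr _ BM) BM.
  have [rB BE] := unitary_subrep rr uB Bst.
  have rBn : B *m r n *m B^t* = 1%:M.
    apply: contrapT => nB; suff /dmin : P (\rank M) by rewrite leqNgt Md.
    by apply/asboolP; exists (fun x => B *m r x *m B^t*).
  have /submxP[D ->] : (M <= B)%MS by rewrite BM.
  by rewrite -mulmxA BE rBn mul1mx.
have rA := step _ A A1 Ast.
pose A' := orthomx Num.conj (mx_of_hermitian (hermitian1mx _)) A.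
have A'o : A *m A'^t* = 0.
  by apply/orthomx1P; apply: ortho_mx_ortho.
have rA' : A' *m r n = A'.
  apply: step; first by rewrite rank_ortho ltn_subrL A0 (leq_trans _ A1).
  move=> x; apply/orthomx1P.
  have /submxP[D AD] := Ast x^-1%g.
  rewrite -[LHS]trmxCK trmxC_mul trmxCK (trmxC_mul A') mulmxA.
  rewrite -(unitary_repV x rr) AD -mulmxA A'o mulmx0.
  by rewrite trmx0 map_mx0.
apply: rn.
have : (1%:M <= A + A')%MS by rewrite addsmx_ortho.
move: A' rA' {A'o} => A' rA' /sub_addsmxP[[u1 u2] /= E].
by rewrite -[LHS]mul1mx E mulmxDl -!mulmxA rA rA'.
Qed.

End UnitaryReps.

Section IrrepsSeparatePoints.
Variables (R : realType) (G : topologicalGroupType).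
Local Notation C := R[i].
Local Open Scope sesquilinear_scope.

(** The core is trivial, so an orthogonal representation moves [n]; read over the complex numbers it
    is unitary. *)
Lemma irreps_separate_points : hausdorff_space G -> compact [set: G] ->
  forall n : G, n <> 1%g -> exists m (phi : irrep R G m), phi n <> 1%:M.
Proof.
move=> hG cG n n1.
have [m [rho [[ro rM rc] rn]]] : exists m (rho : G -> 'M[R]_m), orth_rep rho /\ rho n <> 1%:M.
  apply: contrapT => h; apply/n1/(orth_core_trivial cG hG) => m rho rr.
  by apply: contrapT => rn; apply: h; exists m, rho.
pose rhoC x := map_mx (real_complex R) (rho x).
apply: (@irrep_separates R G m rhoC n).
  split=> [x|x y|i j].
  - apply/unitarymxP; rewrite (_ : (rhoC x)^t* = map_mx (real_complex R) (rho x)^T).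
      by rewrite -map_mxM ro map_mx1.
    by apply/matrixP => i j; rewrite !mxE conjCE conjc_real.
  - by rewrite /rhoC rM map_mxM.
  - split; under eq_fun do rewrite mxE /=; [exact: rc|exact: ctsC].
move=> rn1; apply: rn; apply/matrixP => i j.
by have /matrixP/(_ i j)/(congr1 (@complex.Re R)) := rn1; rewrite !mxE; case: (i == j).
Qed.

End IrrepsSeparatePoints.

(** * Schur's lemma and uniform discreteness of the dual *)

Section Schur.
Variables (R : realType) (G : topologicalGroupType).
Hypothesis cG : compact [set: G].
Local Notation C := R[i].
Local Notation normc := (@ComplexField.Normc.normc R).
Local Notation mean := (@mean R G).
Local Open Scope sesquilinear_scope.

Definition cmean (f : G -> C) : C :=
  Complex (mean (fun x => complex.Re (f x))) (mean (fun x => complex.Im (f x))).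

Lemma cmeanZ c f : ccts f -> cmean (fun x => c * f x) = c * cmean f.
Proof.
move=> [rf jf]; apply: complexP; rewrite ?ReM ?ImM /=.
  under [X in mean X = _]eq_fun do rewrite ReM.
  by rewrite (meanB cG) ?(meanZ cG)//; exact: cts_scale.
under [X in mean X = _]eq_fun do rewrite ImM.
by rewrite (meanD cG) ?(meanZ cG)//; exact: cts_scale.
Qed.

Lemma cmean_sum (I : Type) (r : seq I) (f : I -> G -> C) : (forall i, ccts (f i)) ->
  cmean (fun x => \sum_(i <- r) f i x) = \sum_(i <- r) cmean (f i).
Proof.
move=> cf; apply: complexP; rewrite raddf_sum /=.
  under [X in mean X = _]eq_fun do rewrite raddf_sum.
  by rewrite (@mean_sum R G cG _ _ (fun i x => complex.Re (f i x)))// => i; have [] := cf i.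
under [X in mean X = _]eq_fun do rewrite raddf_sum.
by rewrite (@mean_sum R G cG _ _ (fun i x => complex.Im (f i x)))// => i; have [] := cf i.
Qed.

Lemma cmean_rtrans f a : ccts f -> cmean (fun x => f (x * a)%g) = cmean f.
Proof.
move=> [rf jf]; apply: complexP => /=.
  exact: (@mean_rtrans R G cG (fun x => complex.Re (f x))).
exact: (@mean_rtrans R G cG (fun x => complex.Im (f x))).
Qed.

Definition mxmean n (F : G -> 'M[C]_n) : 'M[C]_n := \matrix_(i, j) cmean (fun x => F x i j).

Lemma mxmeanE n (F : G -> 'M[C]_n) i j : mxmean F i j = cmean (fun x => F x i j).
Proof. by rewrite mxE. Qed.

Lemma mxmean_rtrans n (F : G -> 'M[C]_n) y : (forall i j, ccts (fun x => F x i j)) ->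
  mxmean (fun x => F (x * y)%g) = mxmean F.
Proof.
move=> cF; apply/matrixP => i j; rewrite !mxmeanE.
exact: (@cmean_rtrans (fun x => F x i j) y (cF i j)).
Qed.

Lemma mxmean_mull n (P : 'M[C]_n) (F : G -> 'M[C]_n) : (forall i j, ccts (fun x => F x i j)) ->
  mxmean (fun x => P *m F x) = P *m mxmean F.
Proof.
move=> cF; apply/matrixP => i j; rewrite !mxE.
under [X in cmean X = _]eq_fun do rewrite mxE.
rewrite cmean_sum => [|k]; last by apply: cctsM => //; exact: ccts_cst.
by apply: eq_bigr => k _; rewrite cmeanZ// mxE.
Qed.

Lemma mxmean_mulr n (P : 'M[C]_n) (F : G -> 'M[C]_n) : (forall i j, ccts (fun x => F x i j)) ->
  mxmean (fun x => F x *m P) = mxmean F *m P.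
Proof.
move=> cF; apply/matrixP => i j; rewrite !mxE.
under [X in cmean X = _]eq_fun do rewrite mxE.
rewrite cmean_sum => [|k]; last by apply: cctsM => //; exact: ccts_cst.
apply: eq_bigr => k _; rewrite mxE [RHS]mulrC -cmeanZ//.
by congr cmean; apply/funext => x; rewrite mulrC.
Qed.

Lemma Re_conjM (a b : C) : complex.Re (a^* * b) =
  (normc a ^+ 2 + normc b ^+ 2 - normc (b - a) ^+ 2) / 2.
Proof.
case: a b => [a1 a2] [b1 b2]; rewrite conjCE ReM /= !sqr_sqrtr ?addr_ge0 ?sqr_ge0//.
by field.
Qed.

Lemma conjCM_normc (a : C) : a^* * a = ((normc a ^+ 2)%:C)%C.
Proof.
case: a => [a1 a2]; apply: complexP; rewrite conjCE ?ReM ?ImM /=.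
  by rewrite !sqr_sqrtr ?addr_ge0 ?sqr_ge0//; ring.
by ring.
Qed.

(* The average of [phi^* psi] intertwines, and is nonzero because [phi^* psi]
   stays close to the identity; Schur's lemma makes it a multiple of a unitary. *)
Lemma close_irreps_equiv n (phi psi : irrep R G n) :
  (forall x, opnorm (phi x - psi x) < 1) -> unitary_equiv psi phi.
Proof.
move=> close; have rphi := irrep_unitary_rep phi; have rpsi := irrep_unitary_rep psi.
have [up pM pc] := rphi; have [us sM sc] := rpsi.
have [n0 irr] := irrep_irreducible psi.
pose F x := (phi x)^t* *m psi x.
have cF i j : ccts (fun x => F x i j).
  under eq_fun do rewrite mxE.
  apply: ccts_sum => k; apply: cctsM => //.
  under eq_fun do rewrite !mxE.
  exact: ccts_conj.
pose A := mxmean F.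
have FM x y : F (x * y)%g = (phi y)^t* *m F x *m psi y.
  by rewrite /F pM sM trmxC_mul -!mulmxA.
have AE y : A = (phi y)^t* *m A *m psi y.
  rewrite /A -mxmean_mull// -mxmean_mulr; last first.
    move=> i j; under eq_fun do rewrite mxE.
    by apply: ccts_sum => k; apply: cctsM => //; exact: ccts_cst.
  rewrite -(mxmean_rtrans y cF); congr mxmean.
  by apply/funext => x; exact: FM.
have Apsi y : phi y *m A = A *m psi y.
  by rewrite [in LHS](AE y) !mulmxA (unitarymxP (up y)) mul1mx.
have AphiV y : A^t* *m phi y = psi y *m A^t*.
  have := congr1 (fun M : 'M[C]_n => M^t*) (Apsi y^-1%g).
  rewrite !trmxC_mul (unitary_repV _ rphi) (unitary_repV _ rpsi) !trmxCK.
  by [].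
pose i0 := Ordinal n0.
have FRe x : 2^-1 <= complex.Re (F x i0 i0).
  (* Polarization: the columns of [phi x] and [psi x] with index [i0] are unit vectors at distance
     at most [1], so the real part of their inner product is at least one half. *)
  rewrite mxE raddf_sum /=.
  have col1 (M : 'M[C]_n) : M \is unitarymx -> \sum_l normc (M l i0) ^+ 2 = 1.
    move=> /unitary_mulVmx /matrixP/(_ i0 i0)/(congr1 (@complex.Re R)).
    rewrite !mxE raddf_sum eqxx /= => <-; apply: eq_bigr => l _.
    by rewrite !mxE conjCM_normc.
  have E l : complex.Re ((phi x)^t* i0 l * psi x l i0) =
    (normc (phi x l i0) ^+ 2 + normc (psi x l i0) ^+ 2 -
     normc (psi x l i0 - phi x l i0) ^+ 2) / 2.
    by rewrite !mxE Re_conjM.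
  under eq_bigr do rewrite E.
  rewrite -mulr_suml sumrB big_split/= !col1//.
  have : \sum_l normc (psi x l i0 - phi x l i0) ^+ 2 <= 1.
    have := opnormP (psi x - phi x) (delta_mx i0 0).
    rewrite l2norm_delta mulr1 -colE => h.
    have {}h : l2norm (col i0 (psi x - phi x)) <= 1.
      by apply: le_trans h _; rewrite -opnormN opprB ltW.
    have : l2norm (col i0 (psi x - phi x)) ^+ 2 <= 1 by rewrite expr_le1// l2norm_ge0.
    rewrite /l2norm sqr_sqrtr ?sumr_ge0// => [|l _]; last exact: sqr_ge0.
    by under eq_bigr do rewrite !mxE.
  by lra.
have A00 : A i0 i0 != 0.
  apply/eqP => /(congr1 (@complex.Re R)); rewrite mxmeanE /= => m0.
  have : 2^-1 <= mean (fun x => complex.Re (F x i0 i0)).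
    rewrite -(mean_cst cG 2^-1); apply: (le_mean cG) => //; first exact: ctsC.
    by have [] := cF i0 i0.
  by rewrite m0; lra.
pose S := A^t* *m A.
have Spsi y : S *m psi y = psi y *m S.
  by rewrite /S -mulmxA -Apsi !mulmxA AphiV.
have SV : S^t* = S by rewrite /S trmxC_mul trmxCK.
have [a /eigenvalueP[v vS v0]] := eigenvalue_closed S n0.
(* [v] is a row eigenvector; since [S] is self-adjoint, its conjugate transpose is a column
   eigenvector for [a^*]. That eigenspace is invariant under [psi], hence everything. *)
pose c := a^*.
pose W := lker (linfun (mulmx (S - c%:M) : 'cV[C]_n -> 'cV[C]_n)).
have WE (w : 'cV[C]_n) : (w \in W) = (S *m w == c *: w).
  by rewrite memv_ker lfunE/= mulmxBl mul_scalar_mx subr_eq0.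
have SE : S = c%:M.
  have [|W0|W1] := irr W.
  - move=> x w; rewrite !WE => /eqP Sw; apply/eqP.
    by rewrite mulmxA Spsi -mulmxA Sw scalemxAr.
  - have : v^t* \in W.
      by rewrite WE -[X in X *m _]SV -trmxC_mul vS linearZ/= map_mxZ.
    rewrite W0 memv0 => /eqP vz; move: v0.
    by rewrite -[v]trmxCK vz trmx0 map_mx0 eqxx.
  - apply/matrixP => i j; have := memvf (delta_mx j 0 : 'cV[C]_n).
    rewrite -W1 WE -colE => /eqP/colP/(_ i); rewrite !mxE eqxx andbT => ->.
    by rewrite mulr_natr.
pose r := \sum_l normc (A l i0) ^+ 2.
have cr : c = (r%:C)%C.
  have := congr1 (fun M : 'M[C]_n => M i0 i0) SE; rewrite /S 2!mxE eqxx mulr1n => <-.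
  rewrite /r rmorph_sum/=; apply: eq_bigr => l _.
  by rewrite !mxE conjCM_normc.
have r0 : 0 < r.
  rewrite /r (bigD1 i0)//= ltr_wpDr ?sumr_ge0// => [l _|]; first exact: sqr_ge0.
  rewrite exprn_gt0// lt_neqAle normc_ge0 andbT eq_sym.
  by apply: contraNneq A00 => /ComplexField.Normc.eq0_normc ->.
(* [A^t* *m A] is the positive scalar [r], so dividing [A] by the root of [r] makes it unitary. *)
pose q : C := ((Num.sqrt r)^-1%:C)%C.
apply/asboolP; exists (q *: A); last by move=> x; rewrite -scalemxAl -scalemxAr Apsi.
apply/unitarymxP/mulmx1C; have -> : (q *: A)^t* = q^* *: A^t* by apply/matrixP => i j; rewrite !mxE rmorphM.
rewrite -scalemxAl -scalemxAr.
rewrite -/S SE cr scalerA conjCE conjc_real scale_scalar_mx -!rmorphM/=.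
by rewrite -invfM -expr2 sqr_sqrtr ?ltW// mulVf ?gt_eqF.
Qed.

End Schur.

(** * Consequences for the uniformity of the dual *)

Section UniformDiscreteness.
Variables (R : realType) (G : topologicalGroupType).
Hypothesis cG : compact [set: G].

Lemma unitary_dual_discrete :
  entourage [set p : unitary_dual R G * unitary_dual R G | p.1 = p.2].
Proof.
change (@sum_entourage _ (unitary_dual_n R G)
  [set p : unitary_dual R G * unitary_dual R G | p.1 = p.2]) => n.
set pn := (\pi_(unitary_dual_n R G n)%qT : irrep R G n -> unitary_dual_n R G n).
change (final_entourage pn [set p : unitary_dual_n R G n * unitary_dual_n R G n |
  existT (unitary_dual_n R G) n p.1 = existT _ n p.2]).
(* The discrete uniformity: by [close_irreps_equiv], with [setT] as the compact set and [1] as the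
   distance, it makes the projection uniformly continuous. *)
exists [set A | forall x, A (x, x)]; split.
- split.
  + by split => // A B AB VA x; exact: AB.
  + by move=> A VA [x y] xy; have <- : x = y := xy; exact: VA.
  + by move=> A VA x; exact: VA.
  + move=> A VA; exists [set p | p.1 = p.2] => //.
    by move=> [x y] [z /= -> ->]; exact: VA.
- move=> A VA; change (compact_entourage [set p : irrep R G n * irrep R G n |
    A (pn p.1, pn p.2)]).
  exists setT, 1; split => // -[phi psi] h /=.
  have -> : pn phi = pn psi; last exact: VA.
  by apply/esym/eqmodP; apply: (close_irreps_equiv cG) => x; exact: h.
- by move=> x.
Qed.

(** The diagonal of the dual of [G], pulled back along the inverse of restriction, is an entourage
    of the dual of [H]; pulled back again to representations of [H] it contains a band over some
    compact [K]. *)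
Lemma determines_compact_band (H : subgroup G) (dH : dense H) n :
  determines R dH -> exists K (e : R), [/\ compact (K : set (subgroup_type H)), 0 < e &
    forall phi psi : irrep R G n,
      (forall x, K x -> opnorm (phi (subgroup_incl x) - psi (subgroup_incl x)) < e) ->
      \pi_(unitary_dual_n R G n)%qT phi = \pi_(unitary_dual_n R G n)%qT psi].
Proof.
move=> [g [fK gK ucf ucg]].
have : entourage [set p | g p.1 = g p.2] by exact: (ucg _ unitary_dual_discrete).
move=> /(_ n) /final_unif_continuous[K [e [cK e0 Ke]]].
exists K, e; split=> // phi psi close.
have := Ke (restrict_irrep dH phi, restrict_irrep dH psi) close; rewrite /=.
rewrite -!restrict_dual_nE.
set a := \pi_(unitary_dual_n R G n)%qT phi; set b := \pi_(unitary_dual_n R G n)%qT psi.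
have E (c : unitary_dual_n R G n) :
    existT _ n (restrict_dual_n dH c) = restrict_dual dH (existT _ n c) by [].
by rewrite !E !fK => /eqP; rewrite eq_Tagged/= => /eqP.
Qed.

End UniformDiscreteness.

Lemma near_natSinv_lt (R : realType) (e : R) : 0 < e ->
  \forall n \near \oo, n.+1%:R^-1 < e.
Proof.
move=> e0; exists (Num.bound e^-1) => // n /= bn.
rewrite -[ltRHS]invrK ltf_pV2 ?posrE ?invr_gt0 ?ltr0n//.
apply: lt_trans (archi_boundP _) _; first by rewrite invr_ge0 ltW.
by rewrite ltr_nat ltnS.
Qed.

(** * Metrizability and countable duals *)

Section Pseudometrics.
Variables (R : realType) (T : topologicalType).

Definition cts_pseudometric (d : T -> T -> R) := [/\ forall x, d x x = 0,
  forall x y, d x y = d y x, forall x y z, d x z <= d x y + d y z &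
  forall x e, 0 < e -> \forall y \near x, d x y < e].

Lemma pseudometric_ge0 d x y : cts_pseudometric d -> 0 <= d x y.
Proof. by move=> [d0 ds dt _]; have := dt x y x; rewrite d0 (ds y x); lra. Qed.

Lemma near_pseudometric2 d x y e : cts_pseudometric d -> 0 < e ->
  \forall p \near (x, y), `|d p.1 p.2 - d x y| < e.
Proof.
move=> [d0 ds dt dc] e0; have e2 : 0 < e / 2 by rewrite divr_gt0.
exists ([set x' | d x x' < e / 2], [set y' | d y y' < e / 2]) => /=.
  by split; exact: dc.
move=> [x' y'] /= [hx hy].
have := dt x x' y; have := dt x' y' y; have := dt x' x y'; have := dt x y y'.
rewrite (ds x' x) (ds y' y) ltr_norml => *; apply/andP; split; lra.
Qed.

Lemma sum_pseudometric d d' : cts_pseudometric d -> cts_pseudometric d' ->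
  cts_pseudometric (fun x y => d x y + d' x y).
Proof.
move=> [d0 ds dt dc] [d0' ds' dt' dc']; split.
- by move=> x; rewrite d0 d0' addr0.
- by move=> x y; rewrite ds ds'.
- by move=> x y z; have := dt x y z; have := dt' x y z; lra.
- move=> x e e0; have e2 : 0 < e / 2 by rewrite divr_gt0.
  by apply: filterS (filterI (dc x _ e2) (dc' x _ e2)) => y [h1 h2]; lra.
Qed.

(** Away from a neighbourhood [A] of [x] the distance to [x] is positive, hence bounded below by
    compactness, so [A] contains a ball. *)
Lemma pseudometric_metrizable d : compact [set: T] -> cts_pseudometric d ->
  (forall x y, d x y = 0 -> x = y) -> metrizable R T.
Proof.
move=> cT pd dI; have [d0 ds dt dc] := pd; exists d; split => //.
move=> x; apply/seteqP; split; last first.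
  by move=> A [e e0 eA]; apply: filterS (dc x e e0).
move=> A nA.
have : \forall n \near \oo, forall y, d x y < n.+1%:R^-1 -> A y.
  apply: (@compact_near_all _ cT _ \oo (fun n y => d x y < n.+1%:R^-1 -> A y)) => y.
  have [dxy|dxy] := eqVneq (d x y) 0.
    exists (A, setT); first by split; [rewrite -(dI _ _ dxy)|exact: filterT].
    by move=> [z n] /= [].
  have dxy0 : 0 < d x y by rewrite lt_neqAle eq_sym dxy pseudometric_ge0.
  have dxy2 : 0 < d x y / 2 by rewrite divr_gt0.
  exists ([set z | d y z < d x y / 2], [set n | n.+1%:R^-1 < d x y / 2]).
    by split; [exact: dc|exact: (near_natSinv_lt dxy2)].
  move=> [z n] /= [h1 h2] h3; have := dt x z y; rewrite (ds z y) => h4.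
  have h5 := lt_trans h3 h2; suff: d x y < d x y by rewrite ltxx.
  lra.
by move=> /filter_ex[n hn]; exists n.+1%:R^-1 => //=; rewrite invr_gt0.
Qed.

(** * Suprema of countably many pseudometrics *)

Section Supremum.
Variables (J : Type) (D : set J) (p : J -> nat) (delta : J -> T -> T -> R).
Hypothesis pD : {in D &, injective p}.
Hypothesis deltaP : forall j, cts_pseudometric (delta j).

(** Truncating at the inverse of [(p j).+1] leaves only finitely many indices relevant at a given
    scale, which keeps the supremum continuous; the value [0] covers an empty [D]. *)
Let vals x y : set R :=
  [set r | r = 0 \/ exists2 j, D j & r = Num.min (p j).+1%:R^-1 (delta j x y)].

Definition supd x y : R := sup (vals x y).

Let vals_sup x y : has_sup (vals x y).
Proof.
split; first by exists 0; left.
exists 1 => _ [->//|[j _ ->]].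
by rewrite ge_min invf_le1 ?ltr0n// ler1n.
Qed.

Lemma supd_le x y e : 0 <= e ->
  (forall j, D j -> Num.min (p j).+1%:R^-1 (delta j x y) <= e) -> supd x y <= e.
Proof.
move=> e0 h; apply: ge_sup; first by case: (vals_sup x y).
by move=> _ [->//|[j Dj ->]]; exact: h.
Qed.

Lemma le_supd x y j : D j -> Num.min (p j).+1%:R^-1 (delta j x y) <= supd x y.
Proof.
by move=> Dj; apply: ub_le_sup; [case: (vals_sup x y)|right; exists j].
Qed.

Lemma supd_lt x y j : D j -> supd x y < (p j).+1%:R^-1 -> delta j x y <= supd x y.
Proof.
move=> /(le_supd x y); rewrite ge_min => /orP[h1 /(le_lt_trans h1)|//].
by rewrite ltxx.
Qed.

Let supd_ge0 x y : 0 <= supd x y.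
Proof. by apply: ub_le_sup; [case: (vals_sup x y)|left]. Qed.

Lemma supd_eq0 x y : supd x y = 0 <-> forall j, D j -> delta j x y = 0.
Proof.
split=> [h j Dj|h]; apply/eqP; rewrite eq_le.
  rewrite (pseudometric_ge0 _ _ (deltaP j)) andbT -h.
  by apply: supd_lt => //; rewrite h invr_gt0.
rewrite supd_ge0 andbT; apply: supd_le => // j Dj.
by rewrite h// ge_min lexx orbT.
Qed.

Lemma eq_supd x y x' y' : (forall j, delta j x y = delta j x' y') ->
  supd x y = supd x' y'.
Proof.
move=> E; congr sup; apply/seteqP; split=> r [->|[j Dj ->]].
- by left.
- by right; exists j; rewrite ?E.
- by left.
- by right; exists j; rewrite ?E.
Qed.

Lemma supd_pseudometric : cts_pseudometric supd.
Proof.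
split.
- by move=> x; apply/supd_eq0 => j _; have [] := deltaP j.
- move=> x y; congr sup; apply/seteqP; split=> r [->|[j Dj ->]]; [by left| |by left|];
    by right; exists j => //; have [_ ->] := deltaP j.
- move=> x y z; apply: supd_le => [|j Dj]; first by rewrite addr_ge0 ?supd_ge0.
  apply: le_trans (lerD (le_supd x y Dj) (le_supd y z Dj)).
  have key (q a b c : R) : 0 < q -> 0 <= a -> 0 <= b -> c <= a + b ->
      Num.min q c <= Num.min q a + Num.min q b.
    by case: (leP q c) => ?; case: (leP q a) => ?; case: (leP q b) => ?; lra.
  have [_ _ dt _] := deltaP j.
  by apply: key => //; [rewrite invr_gt0|exact: pseudometric_ge0|exact: pseudometric_ge0].
- move=> x e e0; have e2 : 0 < e / 2 by rewrite divr_gt0.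
  have [N hN] : exists N, N.+1%:R^-1 < e / 2.
    by have [N] := filter_ex (near_natSinv_lt e2); exists N.
  have near_k (k : nat) : \forall y \near x, forall j, D j -> p j = k -> delta j x y < e / 2.
    have [[j [Dj <-]]|nj] := pselect (exists j, D j /\ p j = k); last first.
      by apply: filterE => y j Dj jk; case: nj; exists j.
    have [_ _ _ dc] := deltaP j; apply: filterS (dc x _ e2) => y h i Di ij.
    by rewrite (pD _ _ ij)// ?inE.
  have : \forall y \near x, forall k : 'I_N, forall j, D j -> p j = k -> delta j x y < e / 2.
    by apply: filter_forall => k; exact: near_k.
  apply: filterS => y h; apply: le_lt_trans (_ : e / 2 < e); last by lra.
  apply: supd_le => [|j Dj]; first exact: ltW.
  rewrite ge_min; have [jN|Nj] := ltnP (p j) N.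
    by rewrite (ltW (h (Ordinal jN) j Dj erefl)) orbT.
  apply/orP; left; apply: le_trans (ltW hN).
  by rewrite lef_pV2 ?posrE ?ltr0n// ler_nat ltnS.
Qed.

End Supremum.
End Pseudometrics.

(** * Pseudometrics from representations *)

Section RepresentationMetric.
Variables (R : realType) (G : topologicalGroupType).
Local Notation C := R[i].
Local Notation normc := (@ComplexField.Normc.normc R).
Local Open Scope sesquilinear_scope.

Definition rep_dist n (phi : irrep R G n) x y : R := opnorm (phi x - phi y).

Lemma rep_dist_pseudometric n (phi : irrep R G n) : cts_pseudometric (rep_dist phi).
Proof.
rewrite /rep_dist; split.
- by move=> x; rewrite subrr opnorm0.
- by move=> x y; rewrite -opnormN opprB.
- move=> x y z; rewrite (_ : phi x - phi z = (phi x - phi y) + (phi y - phi z)).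
    exact: opnormD.
  by rewrite addrA subrK.
- move=> x e e0; apply: filterS (irrep_continuous phi x e0) => y.
  by rewrite -opnormN opprB.
Qed.

Lemma opnorm_eq0 n (A : 'M[C]_n) : opnorm A = 0 -> A = 0.
Proof.
move=> A0; apply/matrixP => i j; rewrite mxE; apply: ComplexField.Normc.eq0_normc.
apply/eqP; rewrite eq_le -{1}A0 normc_opnorm.
by rewrite normc_ge0.
Qed.

Lemma rep_dist_eq0 n (phi : irrep R G n) x y : rep_dist phi x y = 0 <-> phi x = phi y.
Proof.
split=> [/opnorm_eq0/eqP|xy]; first by rewrite subr_eq0 => /eqP.
by rewrite /rep_dist xy subrr opnorm0.
Qed.

Lemma l2norm_unitary n (U : 'M[C]_n) (v : 'cV[C]_n) : U \is unitarymx ->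
  l2norm (U *m v) = l2norm v.
Proof.
move=> uU; have E (w : 'cV[C]_n) :
    ((\sum_i normc (w i 0) ^+ 2)%:C)%C = (w^t* *m w) 0 0.
  rewrite mxE rmorph_sum/=; apply: eq_bigr => i _.
  by rewrite -conjCM_normc !mxE.
congr Num.sqrt; apply: (@complexI R).
rewrite !E trmxC_mul mulmxA -(mulmxA _ _ U) unitary_mulVmx// mulmx1.
by [].
Qed.

Lemma opnorm_unitaryl n (U A : 'M[C]_n) : U \is unitarymx -> opnorm (U *m A) = opnorm A.
Proof.
move=> uU; rewrite /opnorm; congr sup.
have E v : l2norm (U *m A *m v) = l2norm (A *m v) by rewrite -mulmxA l2norm_unitary.
by apply/seteqP; split=> _ [v v1 <-]; exists v.
Qed.

Lemma rep_dist_ltrans n (phi : irrep R G n) a x y :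
  rep_dist phi (a * x)%g (a * y)%g = rep_dist phi x y.
Proof.
by rewrite /rep_dist !irrepM -mulmxBr opnorm_unitaryl// irrep_unitary.
Qed.

(** One representative per class gives countably many pseudometrics, whose supremum separates points
    because the irreducible representations do. *)
Lemma countable_dual_metrizable : hausdorff_space G -> compact [set: G] ->
  (forall n, countable [set: unitary_dual_n R G n]) -> metrizable R G.
Proof.
move=> hG cG cn.
have exf n : exists f : unitary_dual_n R G n -> nat, injective f.
  have /countable_injP[f fI] := cn n.
  by exists f => x y; apply: fI; rewrite inE.
pose f n := sval (cid (exf n)).
have fI n : injective (f n) := svalP (cid (exf n)).
pose p (j : unitary_dual R G) := pickle (tag j, f _ (tagged j)).
have pI : injective p.
  move=> [n x] [m y] /(pcan_inj pickleK)[/= nm]; move: nm x y => <- x y /fI ->.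
  by [].
pose delta (j : unitary_dual R G) := rep_dist (repr (tagged j) : irrep R G (tag j)).
have pd := @supd_pseudometric R G _ setT p delta (in2W pI)
  (fun j => rep_dist_pseudometric _).
apply: (pseudometric_metrizable cG pd) => x y.
rewrite supd_eq0 => [xy|j]; last exact: rep_dist_pseudometric.
apply: contrapT => nxy.
have [|m [phi nphi]] := @irreps_separate_points R G hG cG (y^-1 * x)%g.
  by move=> e; apply: nxy; rewrite -[x](mulKg y^-1%g) e invgK mulg1.
pose j : unitary_dual R G := existT _ m (\pi_(unitary_dual_n R G m)%qT phi).
have /rep_dist_eq0 := xy j I; rewrite /j /=; set psi := repr _ => psixy.
have /eqmodP/asboolP[U uU pU] :
  \pi_(unitary_dual_n R G m)%qT psi = \pi_(unitary_dual_n R G m)%qT phi by rewrite reprK.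
have Uu := unitarymx_unit uU.
have phixy : phi x = phi y.
  by rewrite -[phi x](mulmxK Uu) -pU psixy pU mulmxK.
apply: nphi; have rphi := irrep_unitary_rep phi.
by rewrite irrepM phixy -irrepM mulVg unitary_rep1.
Qed.

End RepresentationMetric.

(** * Dense sequences modulo uncountably many representations *)

Section DenseSequences.
Variables (R : realType) (G : topologicalGroupType).
Hypothesis cG : compact [set: G].
Implicit Types (d : G -> G -> R) (x y : G).

(* Every ball contains terms of arbitrarily large index, so that there is room
   to modify the sequence infinitely often. *)
Definition recurrently_dense d (g : nat -> G) := forall x e m, 0 < e ->
  exists2 k, (m <= k)%N & d (g k) x < e.

Lemma injective_unbounded (f : nat -> nat) m : injective f -> exists q, (m <= f q)%N.
Proof.
move=> fI; apply: contrapT => /forallNP h.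
have lt q : (f q < m)%N by rewrite ltnNge; apply/negP/h.
pose f' (q : 'I_m.+1) := Ordinal (lt q).
have : injective f' by move=> q r /(congr1 val) /= /fI /val_inj.
by move=> /leq_card; rewrite !card_ord ltnn.
Qed.

Lemma recurrently_dense_ex d : cts_pseudometric d -> exists g, recurrently_dense d g.
Proof.
move=> [d0 ds dt dc].
have net t : exists s : seq G, forall x, exists2 a, a \in s & d a x < t.+1%:R^-1.
  by apply: (@compact_finite_net _ cG (fun a => [set x | d a x < t.+1%:R^-1])) => a;
    apply: dc; rewrite invr_gt0.
have [s hs] := choice net.
(* The sequence enumerates the points of finite nets for all scales; each finer net supplies another
   term close to [x], so close terms recur. Other indices give [1]. *)
exists (fun k => if unpickle k is Some (t, i) then nth 1%g (s t) i else 1%g) => x e m e0.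
have [N _ hN] := near_natSinv_lt e0.
have hi t : exists i, d (nth 1%g (s t) i) x < t.+1%:R^-1.
  by have [a sa da] := hs t x; exists (index a (s t)); rewrite nth_index.
have [i hi'] := choice hi.
have [q mq] : exists q, (m <= pickle (N + q, i (N + q)%N))%N.
  by apply: injective_unbounded => q r /(pcan_inj pickleK)[/addnI].
exists (pickle (N + q, i (N + q)%N)%N) => //.
rewrite pickleK; apply: lt_trans (hi' _) _; apply: hN => /=.
exact: leq_addr.
Qed.

(* The quotient map by the kernel of a left invariant pseudometric is open. *)
Lemma pseudometric_lift d d' c e : cts_pseudometric d -> cts_pseudometric d' ->
  (forall a x y, d (a * x)%g (a * y)%g = d x y) -> 0 < e ->
  exists2 q, 0 < q & forall x, d c x < q -> exists2 x', d x x' = 0 & d' c x' < e.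
Proof.
move=> pd pd' dl e0; have [d0 ds dt dc] := pd; have [_ _ _ dc'] := pd'.
have : \forall n \near \oo, forall x, d c x < n.+1%:R^-1 ->
    exists2 x', d x x' = 0 & d' c x' < e.
  apply: (@compact_near_all _ cG _ \oo (fun n x => d c x < n.+1%:R^-1 ->
    exists2 x', d x x' = 0 & d' c x' < e)) => x.
  have [dcx|dcx] := eqVneq (d c x) 0.
    (* Right multiplication by [x^-1 * c] moves [x] to [c] and, by left invariance and [d c x = 0],
       every point by [d]-distance zero. *)
    have cf : continuous (fun y : G => y * (x^-1 * c))%g.
      by apply: cts_mulg; [exact: cts_id|exact: ctsC].
    have nx : \forall y \near x, d' c (y * (x^-1 * c))%g < e.
      apply: (cf x [set z | d' c z < e]); rewrite mulVKg.
      exact: dc'.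
    exists ([set y | d' c (y * (x^-1 * c))%g < e], setT).
      by split => //; exact: filterT.
    move=> [y n] /= [h _] _; exists (y * (x^-1 * c))%g => //.
    by rewrite -[in X in d X _](mulg1 y) dl -(dl x) mulg1 mulVKg ds.
  have dcx0 : 0 < d c x by rewrite lt_neqAle eq_sym dcx pseudometric_ge0.
  have dcx2 : 0 < d c x / 2 by rewrite divr_gt0.
  exists ([set z | d x z < d c x / 2], [set n | n.+1%:R^-1 < d c x / 2]).
    by split; [exact: dc|exact: near_natSinv_lt].
  move=> [z n] /= [h1 h2] h3; have := dt c z x; rewrite (ds z x) => h4.
  have h5 := lt_trans h3 h2; suff: d c x < d c x by rewrite ltxx.
  lra.
by move=> /filter_ex[n hn]; exists n.+1%:R^-1 => //; rewrite invr_gt0.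
Qed.

(** Take a sequence [c] recurrently dense for [d']. At strictly increasing indices, move a term of
    [g] within its [d]-class to within the inverse of [t.+1] of [c t]; leave the other terms
    alone. *)
Lemma recurrently_dense_lift d d' g : cts_pseudometric d -> cts_pseudometric d' ->
  (forall a x y, d (a * x)%g (a * y)%g = d x y) -> recurrently_dense d g ->
  exists g', (forall k, d (g k) (g' k) = 0) /\ recurrently_dense d' g'.
Proof.
move=> pd pd' dl dg; have [d0 ds dt dc] := pd; have [d0' ds' dt' dc'] := pd'.
have [c hc] := recurrently_dense_ex pd'.
have step (tm : nat * nat) : exists kx : nat * G, [/\ (tm.2 <= kx.1)%N,
    d (g kx.1) kx.2 = 0 & d' (c tm.1) kx.2 < tm.1.+1%:R^-1].
  have t0 : 0 < tm.1.+1%:R^-1 :> R by rewrite invr_gt0.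
  have [q q0 hq] := pseudometric_lift (c tm.1) pd pd' dl t0.
  have [k mk] := dg (c tm.1) q tm.2 q0; rewrite ds => /hq[x h1 h2].
  by exists (k, x).
have [K hK] := choice step.
pose fix kx (t : nat) : nat * G := if t is t'.+1 then K (t, (kx t').1.+1) else K (0, 0).
have kxP t : d (g (kx t).1) (kx t).2 = 0 /\ d' (c t) (kx t).2 < t.+1%:R^-1.
  by case: t => [|t]; [have [] := hK (0, 0)%N|have [] := hK (t.+1, (kx t).1.+1)].
have kxS t : ((kx t).1 < (kx t.+1).1)%N by have [] := hK (t.+1, (kx t).1.+1).
have kx_mono : {mono (fun t => (kx t).1) : t u / (t <= u)%N}.
  apply: leq_mono => t u.
  have tr (y x z : nat) : (x < y -> y < z -> x < z)%N by exact: ltn_trans.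
  exact: (homo_ltn (f := fun t => (kx t).1) tr kxS).
have kxI t u : (kx t).1 = (kx u).1 -> t = u.
  by move=> e; apply/eqP; rewrite eqn_leq -(kx_mono t u) -(kx_mono u t) /= e leqnn.
have le_kx t : (t <= (kx t).1)%N.
  by elim: t => // t IH; exact: leq_ltn_trans IH (kxS t).
have lift k : exists x, d (g k) x = 0 /\ forall t, (kx t).1 = k -> x = (kx t).2.
  have [[t <-]|nt] := pselect (exists t, (kx t).1 = k).
    by exists (kx t).2; split=> [|u /kxI -> //]; have [] := kxP t.
  by exists (g k); split=> // t tk; case: nt; exists t.
have [g' hg'] := choice lift; exists g'; split=> [k|x e m e0].
  by have [] := hg' k.
have e2 : 0 < e / 2 by rewrite divr_gt0.
have [N _ hN] := near_natSinv_lt e2.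
have [t mt ht] := hc x _ (maxn m N) e2.
exists (kx t).1; first by rewrite (leq_trans _ (le_kx t))// (leq_trans _ mt) ?leq_maxl.
have [_ /(_ t erefl) ->] := hg' (kx t).1.
have [_ h1] := kxP t; have h2 : t.+1%:R^-1 < e / 2.
  by apply: hN => /=; rewrite (leq_trans _ mt)// leq_maxr.
have h3 := lt_trans h1 h2; have := dt' (kx t).2 (c t) x; rewrite (ds' _ (c t)).
lra.
Qed.

End DenseSequences.

Section FiniteIntersections.
Variables (T : topologicalType) (J : eqType) (D : set J) (B : J -> set T).
Hypothesis cT : compact [set: T].
Hypothesis clB : forall j, D j -> closed (B j).

Lemma compact_finite_intersection :
  (forall l : seq J, (forall j, j \in l -> D j) ->
    exists x, forall j, j \in l -> B j x) ->
  exists x, forall j, D j -> B j x.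
Proof.
move=> fip; pose F : set_system T := [set A | exists2 l : seq J,
  (forall j, j \in l -> D j) & forall x, (forall j, j \in l -> B j x) -> A x].
have PF : ProperFilter F.
  split.
    by move=> [l lD] h; have [x /h] := fip l lD.
  split.
  - by exists [::].
  - move=> A A' [l lD lA] [l' lD' lA']; exists (l ++ l').
      by move=> j; rewrite mem_cat => /orP[/lD|/lD'].
    move=> x h; split; [apply: lA|apply: lA'] => j jl; apply: h;
      by rewrite mem_cat jl ?orbT.
  - by move=> A A' AA' [l lD lA]; exists l => // x /lA /AA'.
have [x [_ cx]] := cT PF (filterT : F setT).
exists x => j Dj; apply: (clB Dj); move=> V nV; apply: cx => //.
exists [:: j] => [i|y]; first by rewrite inE => /eqP ->.
by apply; rewrite inE.
Qed.

End FiniteIntersections.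

(** * A maximal family by Zorn's lemma *)

Section UncountableFamily.
Variables (R : realType) (G : topologicalGroupType).
Hypothesis cG : compact [set: G].
Variables (I : choiceType) (n : nat) (phi : I -> irrep R G n).
Local Notation V := (nat -> 'M[R[i]]_n).
Implicit Types (S : set I) (A : set (I * V)).

(* A partial family of sequences of matrices [y = a.2], indexed by [a.1], such that
   finitely many of them are values of the [phi a.1] along a sequence of points of
   [G] which is dense for these [phi a.1]; the condition is of finite character. *)
Definition dense_values A := forall l : seq (I * V), (forall a, a \in l -> A a) ->
  (forall k, exists g, forall a, a \in l -> phi a.1 g = a.2 k) /\
  (forall x (e : R) m, 0 < e -> exists2 k, (m <= k)%N &
     forall a, a \in l -> opnorm (a.2 k - phi a.1 x) < e).

Lemma maximal_dense_values : exists A, dense_values A /\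
  forall B, A `<` B -> ~ dense_values B.
Proof.
apply: Zorn_bigcup => F FP Ftot l lF.
have [->|[X FX lX]] : l = [::] \/ exists2 X, F X & forall a, a \in l -> X a.
- elim: l lF => [|a l IH] lF; first by left.
  right; have [X FX Xa] : (\bigcup_(X in F) X) a by apply: lF; rewrite inE eqxx.
  case: IH => [b bl|->|[Y FY lY]]; first by apply: lF; rewrite inE bl orbT.
    by exists X => // b; rewrite inE => /eqP ->.
  have [XY|YX] := Ftot _ _ FX FY.
    by exists Y => // b; rewrite inE => /orP[/eqP->|/lY//]; exact: XY.
  by exists X => // b; rewrite inE => /orP[/eqP->//|/lY]; exact: YX.
- by split=> [k|x e m e0]; [exists 1%g|exists m].
- exact: FP FX l lX.
Qed.

Lemma closed_irrep_fiber i (M : 'M[R[i]]_n) : closed [set x | phi i x = M].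
Proof.
move=> x cx; apply/eqP; rewrite -subr_eq0; apply/eqP; apply: opnorm_eq0.
apply/eqP; rewrite eq_le opnorm_ge0 andbT; apply/ler_addgt0Pr => e e0; rewrite add0r.
have [y [/= <- xy]] := cx _ (irrep_continuous (phi i) x e0).
by rewrite -opnormN opprB ltW.
Qed.

Lemma dense_values_realized A : dense_values A ->
  exists g : nat -> G, forall k a, A a -> phi a.1 (g k) = a.2 k.
Proof.
move=> dA.
have ex k : exists x, forall a, A a -> phi a.1 x = a.2 k.
  apply: (@compact_finite_intersection G _ A (fun a => [set x | phi a.1 x = a.2 k])) => //.
    by move=> a _; exact: closed_irrep_fiber.
  by move=> l lA; have [/(_ k)] := dA l lA.
by have [g gA] := choice ex; exists g.
Qed.

Lemma finitely_many_below S (p : I -> nat) N : {in S &, injective p} ->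
  exists l : seq I, (forall i, i \in l -> S i) /\ forall i, S i -> (p i < N)%N -> i \in l.
Proof.
move=> pI; elim: N => [|N [l [lS Sl]]]; first by exists [::].
have [[i [Si iN]]|ni] := pselect (exists i, S i /\ p i = N).
  exists (i :: l); split=> j; rewrite inE; first by move=> /orP[/eqP->//|/lS].
  move=> Sj; rewrite ltnS leq_eqVlt => /orP[/eqP jN|/Sl->//]; last by rewrite orbT.
  by rewrite (pI j i) ?inE ?eqxx// jN iN.
exists l; split=> // j Sj; rewrite ltnS leq_eqVlt => /orP[/eqP jN|]; last exact: Sl.
by case: ni; exists j.
Qed.

(** If a maximal family had a countable index set [S], one pseudometric [d] would describe it.
    Correcting its sequence within the [d]-classes to be dense for one more index [i0] would enlarge
    the family. *)
Lemma uncountable_dense_sequence : ~ countable [set: I] ->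
  exists (g : nat -> G) S, ~ countable S /\
    forall x (l : seq I) e m, (forall i, i \in l -> S i) -> 0 < e ->
      exists2 k, (m <= k)%N & forall i, i \in l -> rep_dist (phi i) (g k) x < e.
Proof.
move=> ncI; have [A [dA Amax]] := maximal_dense_values.
have [g gA] := dense_values_realized dA.
pose S : set I := [set i | exists y, A (i, y)].
have exy i : exists y, S i -> A (i, y).
  by have [[y Ay]|nS] := pselect (S i); [exists y|exists (fun=> 0)].
have [y yA] := choice exy.
have dS x (l : seq I) (e : R) m : (forall i, i \in l -> S i) -> 0 < e ->
    exists2 k, (m <= k)%N & forall i, i \in l -> rep_dist (phi i) (g k) x < e.
  move=> lS e0; have [|_ /(_ x e m e0)[k mk hk]] := dA [seq (i, y i) | i <- l].
    by move=> a /mapP[i /lS/yA ? ->].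
  exists k => // i il; have Ai := yA _ (lS i il).
  by rewrite /rep_dist (gA k _ Ai); apply: hk; apply/mapP; exists i.
exists g, S; split => // cS.
have /countable_injP[p pI] := cS.
pose delta i := rep_dist (phi i).
have pdelta i : cts_pseudometric (delta i) by exact: rep_dist_pseudometric.
pose d := supd S p delta.
have pd : cts_pseudometric d by exact: supd_pseudometric.
have dl a x z : d (a * x)%g (a * z)%g = d x z.
  by apply: eq_supd => j; exact: rep_dist_ltrans.
have [i0 ni0] : exists i0, ~ S i0.
  apply: contrapT => /forallNP h; apply: ncI; apply: sub_countable cS.
  by apply: subset_card_le => i _; apply: contrapT; exact: h.
have dg : recurrently_dense d g.
  move=> x e m e0; have e2 : 0 < e / 2 by rewrite divr_gt0.
  have [N hN] := filter_ex (near_natSinv_lt e2).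
  have [l [lS Sl]] := finitely_many_below N pI.
  have [k mk hk] := dS x l _ m lS e2; exists k => //.
  apply: le_lt_trans (_ : e / 2 < e); last by lra.
  apply: supd_le => [|j Sj]; first exact: ltW.
  rewrite ge_min; have [jN|Nj] := ltnP (p j) N.
    by rewrite (ltW (hk j (Sl j Sj jN))) orbT.
  apply/orP; left; apply: le_trans (ltW hN).
  by rewrite lef_pV2 ?posrE ?ltr0n// ler_nat ltnS.
have pd' := sum_pseudometric pd (pdelta i0).
have [g' [gg' dg']] := recurrently_dense_lift cG pd pd' dl dg.
pose y0 : V := fun k => phi i0 (g' k).
pose B := A `|` [set (i0, y0)].
have g'B k a : B a -> phi a.1 (g' k) = a.2 k.
  move=> [|-> //]; case: a => i z Az; have Si : S i by exists z.
  have := gg' k; rewrite /d supd_eq0 // => /(_ i Si)/rep_dist_eq0 <-.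
  exact: (gA k (i, z)).
apply: (Amax B).
  split; first by move=> a Aa; left.
  by move=> /(_ (i0, y0) (or_intror erefl)) Ai0; apply: ni0; exists y0.
move=> l lB; split=> [k|x e m e0].
  by exists (g' k) => a /lB/g'B.
(* Below [q] the truncations in [d] are inactive, so [d < q] bounds each pseudometric in the
   list. *)
have [q [q0 qe ql]] : exists q : R, [/\ 0 < q, q <= e &
    forall a, a \in l -> q <= (p a.1).+1%:R^-1].
  elim: l {lB} => [|a l [q [q0 qe ql]]]; first by exists e.
  exists (Num.min q (p a.1).+1%:R^-1); split.
  - by rewrite lt_min q0 invr_gt0 ltr0n.
  - by rewrite ge_min qe.
  - move=> b; rewrite inE => /orP[/eqP->|/ql qb]; first by rewrite ge_min lexx orbT.
    by rewrite ge_min qb.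
have [k mk hk] := dg' x q m q0; exists k => // a al; have Ba := lB a al.
rewrite -(g'B k a Ba) -/(rep_dist (phi a.1) (g' k) x).
have d0 := pseudometric_ge0 (g' k) x pd.
have d0' := pseudometric_ge0 (g' k) x (pdelta i0).
case: Ba => [Aa|-> /=]; last by rewrite -/(delta i0 _ _); lra.
have Sa : S a.1 by exists a.2; case: (a) Aa.
have dq : d (g' k) x < q by lra.
apply: le_lt_trans (_ : d (g' k) x < e); last exact: lt_le_trans qe.
by apply: (@supd_lt _ _ _ S p delta) => //; exact: lt_le_trans (ql a al).
Qed.

End UncountableFamily.

(** * A dense subgroup that does not determine *)

Section GeneratedSubgroup.
Variables (R : realType) (G : topologicalGroupType).
Hypothesis cG : compact [set: G].
Variables (I : choiceType) (n : nat) (phi : I -> irrep R G n).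
Variables (g : nat -> G) (S : set I).

Definition word_eval (w : seq (bool * nat)) : G :=
  foldr (fun a x => ((if a.1 then (g a.2)^-1 else g a.2) * x)%g) 1%g w.

Lemma word_eval_cat v w : word_eval (v ++ w) = (word_eval v * word_eval w)%g.
Proof. by elim: v => [|a v IH] /=; rewrite ?mul1g// IH mulgA. Qed.

Definition word_inv (w : seq (bool * nat)) := rev [seq (~~ a.1, a.2) | a <- w].

Lemma word_eval_inv w : word_eval (word_inv w) = (word_eval w)^-1%g.
Proof.
rewrite /word_inv; elim: w => [|[b k] w IH] /=; first by rewrite invg1.
rewrite rev_cons -cats1 word_eval_cat IH /= mulg1 invgM.
by case: b => /=; rewrite ?invgK.
Qed.

(* The saturation, modulo the common kernel of the [phi i] with [S i], of the
   subgroup generated by the sequence [g]. *)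
Definition saturated_set : set G :=
  [set h | exists w, forall i, S i -> phi i h = phi i (word_eval w)].

Lemma saturated_closed : group_closed (fun x => x \in saturated_set).
Proof.
split.
  by apply: mem_set; exists [::].
move=> u v /set_mem[w wu] /set_mem[w' wv]; apply: mem_set.
exists (w ++ word_inv w') => i Si; rewrite word_eval_cat word_eval_inv.
rewrite !irrepM !(unitary_repV _ (irrep_unitary_rep (phi i))).
by rewrite wu// wv.
Qed.

Definition saturated : subgroup G := Subgroup saturated_closed.

(** Compactness gives [z] in the closure of the sequence with the same image as [x] modulo the
    common kernel. Right multiplication by [z^-1 * x] carries terms near [z] to points near [x]
    without changing their images. *)
Lemma saturated_dense :
  (forall x (l : seq I) (e : R) m, (forall i, i \in l -> S i) -> 0 < e ->
    exists2 k, (m <= k)%N & forall i, i \in l -> rep_dist (phi i) (g k) x < e) ->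
  dense saturated.
Proof.
move=> dg O [x Ox] oO.
(* [None] stands for the closure of the sequence, [Some (i, k)] for closeness to [x] under [phi i]
   at scale [k]. *)
pose D : set (option (I * nat)) := [set j | if j is Some a then S a.1 else True].
pose B (j : option (I * nat)) : set G :=
  if j is Some (i, k) then [set z | rep_dist (phi i) z x <= k.+1%:R^-1]
  else closure (range g).
have clB j : D j -> closed (B j).
  case: j => [[i k] _|_]; last exact: closed_closure.
  have pd := rep_dist_pseudometric (phi i); have [d0 ds dt dc] := pd.
  move=> z cz; rewrite /B /=; apply/ler_addgt0Pr => e e0.
  have [y [/= yx zy]] := cz _ (dc z e e0).
  by apply: le_trans (dt z y x) _; rewrite addrC lerD// ltW.
have [|z hz] := compact_finite_intersection cG clB.
  move=> l lD; pose k0 := (\max_(j <- l) (if j is Some (_, k) then k else 0))%N.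
  have [||k _ hk] := dg x [seq a.1 | a <- pmap id l] k0.+1%:R^-1 0%N.
  - by move=> i /mapP[a]; rewrite mem_pmap map_id => /lD Da ->.
  - by rewrite invr_gt0 ltr0n.
  exists (g k) => -[[i k']|] jl; last by apply: subset_closure; exists k.
  apply: le_trans (ltW (hk i _)) _.
    apply/mapP; exists (i, k') => //; rewrite mem_pmap map_id.
    exact: jl.
  rewrite lef_pV2 ?posrE ?ltr0n// ler_nat ltnS /k0.
  exact: (bigmaxn_sup_seq (Some (i, k')) jl).
have phiz i : S i -> phi i z = phi i x.
  move=> Si; apply/(rep_dist_eq0 (phi i)); apply/eqP; rewrite eq_le.
  rewrite (pseudometric_ge0 _ _ (rep_dist_pseudometric _)) andbT.
  apply/ler_addgt0Pr => e e0; rewrite add0r.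
  have [k hk] := filter_ex (near_natSinv_lt e0).
  exact: le_trans (hz (Some (i, k)) Si) (ltW hk).
have cf : continuous (fun y : G => y * (z^-1 * x))%g.
  by apply: cts_mulg; [exact: cts_id|exact: ctsC].
have nO : nbhs z [set y | O (y * (z^-1 * x))%g].
  by apply: (cf z O); rewrite mulVKg; exact: open_nbhs_nbhs.
have [_ [[k _ <-] Ok]] := hz None Logic.I _ nO.
exists (g k * (z^-1 * x))%g; split=> //=.
exists [:: (false, k)] => i Si; rewrite /= mulg1 !irrepM.
rewrite (unitary_repV _ (irrep_unitary_rep (phi i))) phiz//.
by rewrite unitary_mulVmx ?mulmx1//; exact: irrep_unitary.
Qed.

End GeneratedSubgroup.

(** * Compact sets that are countable modulo the kernel *)

Section CountableCompacts.
Variables (R : realType) (G : topologicalGroupType).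
Variables (I : choiceType) (n : nat) (phi : I -> irrep R G n) (S : set I).
Variables (W : countType) (ev : W -> G) (K : set G).
Hypothesis cK : compact K.
Hypothesis Kev : forall x, K x -> exists w, forall i, S i -> phi i x = phi i (ev w).

Let compact_net (d : G -> G -> R) (e : R) : cts_pseudometric d -> 0 < e ->
  exists2 s : seq G, (forall a, a \in s -> K a) &
    forall x, K x -> exists2 a, a \in s & d a x < e.
Proof.
move=> [d0 ds dt dc] e0; pose F : set_system (seq G) :=
  [set A : set (seq G) | exists2 s0 : seq G, (forall a, a \in s0 -> K a) &
    forall s : seq G, (forall a, a \in s -> K a) -> {subset s0 <= s} -> A s].
have FF : Filter F.
  split; first by exists [::].
    move=> A B [s1 K1 A1] [s2 K2 B2]; exists (s1 ++ s2).
      by move=> a; rewrite mem_cat => /orP[/K1|/K2].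
    move=> s Ks ss; split; [apply: A1|apply: B2] => // x xs; apply: ss;
      by rewrite mem_cat xs ?orbT.
  by move=> A B AB [s Ks As]; exists s => // s' Ks' /(As _ Ks')/AB.
have := (compact_near_coveringP K).1 cK _ F
  (fun s x => K x -> exists2 a, a \in s & d a x < e) FF.
case=> [x Kx|s0 K0 hs0].
  exists ([set y | d x y < e], [set s : seq G | x \in s]).
    split; first exact: dc.
    exists [:: x] => [a|s _]; first by rewrite inE => /eqP ->.
    by apply; rewrite inE.
  by move=> [y s] /= [xy xs] _; exists x.
by exists s0 => // x Kx; apply: (hs0 s0 K0 _ x Kx Kx).
Qed.

Let separating_index : S !=set0 -> exists s : W * W -> I, (forall u, S (s u)) /\
  forall u, (exists2 i, S i & phi i (ev u.1) <> phi i (ev u.2)) ->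
    phi (s u) (ev u.1) <> phi (s u) (ev u.2).
Proof.
move=> [i0 Si0].
have ex u : exists i, S i /\ ((exists2 i, S i & phi i (ev u.1) <> phi i (ev u.2)) ->
    phi i (ev u.1) <> phi i (ev u.2)).
  have [[i Si ni]|nu] := pselect (exists2 i, S i & phi i (ev u.1) <> phi i (ev u.2)).
    by exists i.
  by exists i0.
have [s hs] := choice ex; exists s.
by split=> u; have [] := hs u.
Qed.

(* Countably many indices separate the points of [K], so [K] is metrizable and
   the functions [phi i] on it, [S i], cannot be uniformly separated. *)
Lemma close_on_compact e : ~ countable S -> 0 < e ->
  exists i j, [/\ S i, S j, i <> j & forall x, K x -> opnorm (phi i x - phi j x) < e].
Proof.
have lt_half (a b : R) : - (b / 2) < a - b -> b / 2 <= a by lra.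
have lt_quarters (a b c : R) : a < e / 4 -> b < e / 4 -> c < e / 4 -> 0 < e ->
  a + b + c < e by lra.
move=> ncS e0.
have S0 : S !=set0.
  by apply/set0P/eqP => SE; apply: ncS; rewrite SE; exact: countable0.
have [s [Ss ssep]] := separating_index S0.
pose delta u := rep_dist (phi (s u)).
pose d := supd setT (@pickle (W * W)%type) delta.
have pdelta u : cts_pseudometric (delta u) by exact: rep_dist_pseudometric.
have pI : {in [set: W * W] &, injective (@pickle (W * W)%type)}.
  by move=> u v _ _; exact: (pcan_inj pickleK).
have pd : cts_pseudometric d by exact: supd_pseudometric.
have [d0 ds dt dc] := pd.
have dsep x y i : K x -> K y -> d x y = 0 -> S i -> phi i x = phi i y.
  move=> /Kev[w wx] /Kev[w' wy]; rewrite /d supd_eq0 // => dxy Si.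
  rewrite wx// wy//; apply: contrapT => ne.
  apply: (ssep (w, w')); first by exists i.
  rewrite /= -wx// -wy//.
  by have /rep_dist_eq0 := dxy (w, w') Logic.I.
have e4 : 0 < e / 4 by rewrite divr_gt0.
(* Since [d] vanishes only where [phi i] agrees, compactness of [K] times [K] makes [phi i]
   uniformly continuous for [d] on [K]. *)
have unif i : exists m, S i -> forall x y, K x -> K y ->
    d x y < m.+1%:R^-1 -> rep_dist (phi i) x y < e / 4.
  have [Si|nSi] := pselect (S i); last by exists 0%N.
  have pi := rep_dist_pseudometric (phi i).
  have cKK : compact (K `*` K) by exact: compact_setX.
  have := (compact_near_coveringP _).1 cKK _ \oo (fun m (q : G * G) =>
    d q.1 q.2 < m.+1%:R^-1 -> rep_dist (phi i) q.1 q.2 < e / 4) _.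
  move=> h; have : \forall m \near \oo, K `*` K `<=` (fun q : G * G =>
    d q.1 q.2 < m.+1%:R^-1 -> rep_dist (phi i) q.1 q.2 < e / 4).
    apply: h => -[x y] [/= Kx Ky].
    have [dxy|dxy] := eqVneq (d x y) 0.
      exists ([set q | `|rep_dist (phi i) q.1 q.2 - rep_dist (phi i) x y| < e / 4], setT).
        by split; [exact: near_pseudometric2|exact: filterT].
      move=> [[x' y'] m] /= [+ _] _.
      have -> : rep_dist (phi i) x y = 0 by apply/rep_dist_eq0; exact: dsep.
      by rewrite subr0 => /(le_lt_trans (ler_norm _)).
    have dxy0 : 0 < d x y by rewrite lt_neqAle eq_sym dxy pseudometric_ge0.
    have dxy2 : 0 < d x y / 2 by rewrite divr_gt0.
    exists ([set q | `|d q.1 q.2 - d x y| < d x y / 2], [set m | m.+1%:R^-1 < d x y / 2]).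
      by split; [exact: near_pseudometric2|exact: near_natSinv_lt].
    move=> [[x' y'] m] /= [h1 h2] h3; have h5 := lt_trans h3 h2.
    move: h1; rewrite ltr_norml => /andP[/lt_half /le_lt_trans/(_ h5)].
    by rewrite ltxx.
  by move=> /filter_ex[m hm]; exists m => _ x y Kx Ky; apply: (hm (x, y)).
have [m hm] := choice unif.
have m0 k : 0 < k.+1%:R^-1 :> R by rewrite invr_gt0.
have [L hL] : exists L : nat -> seq G, forall k, (forall a, a \in L k -> K a) /\
    forall x, K x -> exists2 a, a \in L k & d a x < k.+1%:R^-1.
  have ex k : exists s : seq G, (forall a, a \in s -> K a) /\
      forall x, K x -> exists2 a, a \in s & d a x < k.+1%:R^-1.
    by have [t t1 t2] := compact_net pd (m0 k); exists t.
  by have [L hL] := choice ex; exists L.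
(* Rounding at scale [N^-1] costs at most [2 * N^-1] in each of [n * n] entries, so less than
   [N^-1 * c = e / 4] in total. *)
pose c : R := 2 * (n%:R * n%:R) + 1.
have c0 : 0 < c by rewrite ltr_wpDl// !mulr_ge0.
pose N : R := c / (e / 4).
have N0 : 0 < N by rewrite divr_gt0.
have NE : N^-1 * c = e / 4 by rewrite /N invfM invrK mulrAC mulVf ?mul1r// gt_eqF.
pose entry_code (M : 'M[R[i]]_n) : {ffun 'I_n * 'I_n -> int * int} :=
  [ffun ab => (Num.floor (N * complex.Re (M ab.1 ab.2)),
               Num.floor (N * complex.Im (M ab.1 ab.2)))].
have floor_close (a b : R) : Num.floor (N * a) = Num.floor (N * b) -> `|a - b| <= N^-1.
  move=> ab; have /andP[a1 a2] := floor_itv (N * a); have /andP[b1 b2] := floor_itv (N * b).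
  rewrite -(ler_pM2l N0) -{1}(gtr0_norm N0) -normrM mulrBr mulfV ?gt_eqF//.
  move: a1 a2; rewrite ab intrD mulr1z; move: b2; rewrite intrD mulr1z => b2 a1 a2.
  by rewrite ler_norml; apply/andP; split; lra.
have entry_close (M M' : 'M[R[i]]_n) : entry_code M = entry_code M' -> opnorm (M - M') < e / 4.
  move=> /ffunP h; apply: le_lt_trans (opnorm_le_sum _) _.
  apply: (@le_lt_trans _ _ (\sum_(i < n) \sum_(j < n) (N^-1 + N^-1))).
    apply: ler_sum => a _; apply: ler_sum => b _.
    have := h (a, b); rewrite !ffunE => -[h1 h2].
    apply: le_trans (normc_le _) _; rewrite 2!mxE !raddfB/=.
    by rewrite lerD// floor_close.
  rewrite !sumr_const card_ord -!mulrnA -[_ *+ _]mulr_natr natrM -NE /c.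
  have Ni : 0 < N^-1 by rewrite invr_gt0.
  lra.
(* The modulus of continuity and the rounded values on the matching finite net form a countable
   code, so two indices of the uncountable [S] share it. *)
pose code i := (m i, [seq entry_code (phi i a) | a <- L (m i)]).
have [i [j [Si Sj ij cij]]] : exists i j, [/\ S i, S j, i <> j & code i = code j].
  apply: contrapT => h; apply: ncS; apply/countable_injP.
  exists (pickle \o code) => i j /set_mem Si /set_mem Sj /= /(pcan_inj pickleK) cij.
  by apply: contrapT => ij; apply: h; exists i, j.
exists i, j; split=> // x Kx; case: cij => mij.
rewrite -mij => /eq_in_map aij.
have [_ /(_ x Kx)[a aL ax]] := hL (m i); have Ka := (hL (m i)).1 a aL.
have h1 := entry_close _ _ (aij a aL).
have h2 := hm i Si a x Ka Kx ax.
have h3 : rep_dist (phi j) a x < e / 4 by apply: (hm j Sj a x Ka Kx); rewrite -mij.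
(* Pass through the net point [a]: uniform continuity at both ends, equal rounding in the middle. *)
have -> : phi i x - phi j x = - (phi i a - phi i x) + (phi i a - phi j a)
    + (phi j a - phi j x) by rewrite opprB !subrKA.
apply: le_lt_trans (opnormD _ _) _.
apply: le_lt_trans (lerD (opnormD _ _) (lexx _)) _.
rewrite opnormN -/(rep_dist (phi i) a x) -/(rep_dist (phi j) a x).
exact: lt_quarters.
Qed.

End CountableCompacts.

Theorem theorem6p10 (R : realType) (G : topologicalGroupType) :
  hausdorff_space G -> compact [set: G] ->
  determined R G -> metrizable R G.
Proof.
move=> hG cG detG; apply: contrapT => nmG.
have [n ncI] : exists n, ~ countable [set: unitary_dual_n R G n].
  apply: contrapT => /forallNP h; apply: nmG; apply: countable_dual_metrizable => // n.
  by apply: contrapT; exact: h.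
pose phi (i : unitary_dual_n R G n) : irrep R G n := repr i.
have [g [S [ncS dS]]] := uncountable_dense_sequence cG phi ncI.
have dH := saturated_dense cG dS.
have [K [e [cK e0 Ke]]] := @determines_compact_band R G cG _ dH n (detG _ dH).
pose K' := (@subgroup_incl G (saturated phi g S)) @` K.
have cK' : compact K'.
  apply: continuous_compact cK; apply: continuous_subspaceT.
  exact: subgroup_incl_continuous.
(* By construction each point of the saturated subgroup agrees with a word in the sequence under all
   [phi i] with [S i], and words are countable. *)
have Kev x : K' x -> exists w, forall i, S i -> phi i x = phi i (word_eval g w).
  by move=> [h _ <-]; exact: (set_mem (valP h)).
have [i [j [_ _ ij close]]] := close_on_compact cK' Kev ncS e0.
apply: ij; rewrite -(reprK i) -(reprK j); apply: Ke => h Kh.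
by apply: close; exists h.
Qed.
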